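(* Let $A$ be a hereditary artinian $k$-algebra of Gabriel-type with admissible ideal, and let $\mathcal M=(A_i,{}_iM_j)$ be its corresponding $k$-pre-modulation. Then the category $\mathrm{Rep}(\mathcal M)$ is equivalent to the category $\mathrm{Mod}A$ of $A$-modules, and the category $\mathrm{rep}(\mathcal M)$ is equivalent to the category $\mathrm{mod}A$ of finitely generated $A$-modules.
   Context: $k$ is a field; modules are right modules; algebras $A_i$ below are finite-dimensional. Generalized path algebras: for a finite quiver $Q$ and a family $\mathcal B=\{B_i\mid i\in Q_0\}$ of $k$-algebras, let $\Omega(i,j)$ be the set of arrows from $i$ to $j$, $B_0=\prod_iB_i$, and $M=\bigoplus_{(i,j)}B_i\Omega(i,j)B_j$ with $B_i\Omega(i,j)B_j$ the free $B_i$-$B_j$-bimodule on $\Omega(i,j)$. Then $k(Q,\mathcal B)=T(B_0,M)=\bigoplus_{n\ge0}M^{\otimes_{B_0}n}$; it is normal if all $B_i$ are simple. Let $J=\bigoplus_{n\ge1}M^{\otimes_{B_0}n}$. An ideal $I$ is admissible if $J^s\subseteq I\subseteq J^2$ for some positive integer $s$. An artinian algebra $A$ is of Gabriel-type with admissible ideal if $A\cong k(Q,\mathcal B)/I$ for a normal generalized path algebra $k(Q,\mathcal B)$ and an admissible ideal $I$. Natural quiver: let $r$ be the radical of $A$ and $A/r=\bigoplus_{i=1}^sA_i$ with $A_i$ the simple two-sided ideals. The natural quiver $\Delta_A$ has vertices $1,\dots,s$ and $t_{ij}$ arrows from $i$ to $j$, where $t_{ij}$ is the minimal number of generators of $A_i\cdot(r/r^2)\cdot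 A_j$ as an $A_i$-$A_j$-bimodule. The associated normal generalized path algebra of $A$ is $k(\Delta_A,\mathcal A)$ with $\mathcal A=\{A_1,\dots,A_s\}$. The corresponding $k$-pre-modulation of $A$ is $\mathcal M=(A_i,{}_iM_j)$, where ${}_iM_j=A_i\Omega(i,j)A_j$ is the free $A_i$-$A_j$-bimodule on the set $\Omega(i,j)$ of arrows of $\Delta_A$ from $i$ to $j$; it has an oriented edge $i\to j$ whenever ${}_iM_j\ne0$. A representation of $\mathcal M$ is $(V_i,{}_j\varphi_i)$ with a right $A_i$-module $V_i$ for each vertex $i$ and an $A_j$-homomorphism ${}_j\varphi_i:V_i\otimes_{A_i}{}_iM_j\to V_j$ for each oriented edge $i\to j$; it is finitely generated if each $V_i$ is finitely generated over $A_i$. A morphism $(V_i,{}_j\varphi_i)\to(U_i,{}_j\psi_i)$ is a family of $A_i$-homomorphisms $\alpha_i:V_i\to U_i$ with $\alpha_j\circ{}_j\varphi_i={}_j\psi_i\circ(\alpha_i\otimes\mathrm{id}_{{}_iM_j})$ for each oriented edge. $\mathrm{Rep}(\mathcal M)$ (resp. $\mathrm{rep}(\mathcal M)$) is the category of all (resp. finitely generated) representations. *)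

(* Defs.v *)
From HB Require Import structures.
From mathcomp Require Import all_boot ssralg ssrint generic_quotient ring_quotient.
From mathcomp Require Import vector falgebra.
From mathcomp Require Import boolp classical_sets.
From mathcomp Require Import freeg.

Set Implicit Arguments.
Unset Strict Implicit.
Unset Printing Implicit Defensive.

Import GRing.Theory.
Local Open Scope ring_scope.
Local Open Scope quotient_scope.
Local Open Scope classical_set_scope.

(* A right R-module is an object of [lmodType R^c], where R^c is the opposite *)
(* ring: for r : R^c, the term [r *: v] stands for the right action v r.      *)

Definition subgroup (G : zmodType) (S : set G) : Prop :=
  S 0 /\ (forall x y, S x -> S y -> S (x - y)).

Definition addspan (G : zmodType) (P : set G) : set G :=
  [set x | forall S : set G, subgroup S -> P `<=` S -> S x].

Lemma addspan_subgroup (G : zmodType) (P : set G) : subgroup (addspan P).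
Proof.
split=> [S [S0 _] _ //|x y xP yP S Sg PS].
by case: (Sg) => _; apply; [apply: xP | apply: yP].
Qed.

Lemma addspan_incl (G : zmodType) (P : set G) : P `<=` addspan P.
Proof. by move=> x Px S _; apply. Qed.

Section Presentation.
Variables (K : choiceType) (P : set {freeg K}).

Definition relspan : {pred {freeg K}} := fun x => `[< addspan P x >].

Lemma relspan_zmod_closed : zmod_closed relspan.
Proof.
have [S0 SB] := addspan_subgroup P.
split=> [|x y]; first exact: (introT (asboolP _) S0).
move=> /(elimT (asboolP _)) Px /(elimT (asboolP _)) Py.
exact: (introT (asboolP _) (SB _ _ Px Py)).
Qed.

HB.instance Definition _ :=
  GRing.isZmodClosed.Build {freeg K} relspan relspan_zmod_closed.

Definition presented := (Quotient.quot relspan).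
HB.instance Definition _ := GRing.Zmodule.on presented.

Definition fgen (z : K) : {freeg K} := Freeg [:: (1, z)].

Definition pproj (x : {freeg K}) : presented := \pi_(Quotient.quot relspan) x.

Definition pgen (z : K) : presented := pproj (fgen z).

Lemma pprojB : {morph pproj : x y / x - y}.
Proof. by move=> x y; rewrite /pproj raddfB. Qed.

Lemma pprojD : {morph pproj : x y / x + y}.
Proof. by move=> x y; rewrite /pproj raddfD. Qed.

Lemma pproj_rel x : P x -> pproj x = 0.
Proof.
move=> Px; have <- : pproj 0 = 0 by exact: raddf0.
apply/eqP; rewrite /pproj -Quotient.idealrBE subr0.
exact: (introT (asboolP _) (addspan_incl Px)).
Qed.

Lemma presented_ind (Q : presented -> Prop) :
  Q 0 -> (forall x y, Q x -> Q y -> Q (x - y)) -> (forall z, Q (pgen z)) ->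
  forall x, Q x.
Proof.
move=> Q0 QB Qg x; rewrite -[x]reprK -/(pproj (repr x)).
have QN y : Q y -> Q (- y) by rewrite -sub0r; apply: QB.
have QD y z : Q y -> Q z -> Q (y + z).
  by move=> Qy /QN Qz; rewrite -[z]opprK; apply: QB.
have QM y n : Q y -> Q (y *+ n).
  by move=> Qy; elim: n => // n IH; rewrite mulrS; apply: QD.
have QZ y (m : int) : Q y -> Q (y *~ m).
  by move=> Qy; case: m => m; rewrite ?NegzE ?mulrNz; [|apply: QN]; apply: QM.
elim/freeg_ind_dom0: (repr x) => [|n z y _ _ Qy].
  by rewrite (_ : pproj 0 = 0) //; exact: raddf0.
rewrite pprojD; apply: QD => //.
have -> : Freeg [:: (n, z)] = (fgen z) *~ n by rewrite freegU_mulz intz.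
rewrite /pproj raddfMz; exact: (QZ _ _ (Qg _)).
Qed.

Section Lift.
Variables (W : zmodType) (f : K -> W).

Definition flift (x : {freeg K}) : W := fglift (f : K -> zmodule W) x.

Lemma fliftB x y : flift (x - y) = flift x - flift y.
Proof. by rewrite /flift (lift_is_additive (M := zmodule W)). Qed.

Lemma flift0 : flift 0 = 0.
Proof. by have := fliftB 0 0; rewrite !subrr. Qed.

Lemma flift_gen z : flift (fgen z) = f z.
Proof. by rewrite /flift /fgen liftU scale1r. Qed.

Definition plift (x : presented) : W := flift (repr x).

Definition respects := forall x, P x -> flift x = 0.

Hypothesis fP : respects.

Lemma plift_proj x : plift (pproj x) = flift x.
Proof.
apply/eqP; rewrite -subr_eq0 -fliftB; apply/eqP.
have : repr (pproj x) - x \in relspan by rewrite Quotient.idealrBE reprK.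
move/(elimT (asboolP _))/(_ [set y | flift y = 0]); apply=> //.
split=> [|y z /= y0 z0].
  exact: flift0.
by rewrite fliftB y0 z0 subrr.
Qed.

Lemma plift_gen z : plift (pgen z) = f z.
Proof. by rewrite plift_proj flift_gen. Qed.

Lemma pliftB : {morph plift : x y / x - y}.
Proof.
move=> x y; rewrite -[x]reprK -[y]reprK -!/(pproj _) -pprojB !plift_proj.
exact: fliftB.
Qed.

End Lift.
End Presentation.

(* Bimodules are k-central, that is, modules over the tensor product over k   *)
(* of R and S^c.                                                              *)
Record bimod (k : fieldType) (R S : algType k) := Bimod {
  bim_sort :> lmodType S^c;
  lact : R -> bim_sort -> bim_sort;
  lactDl : forall a b x, lact (a + b) x = lact a x + lact b x;
  lactDr : forall a x y, lact a (x + y) = lact a x + lact a y;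
  lactA : forall a b x, lact a (lact b x) = lact (a * b) x;
  lact1 : forall x, lact 1 x = x;
  lact_ract : forall a (s : S^c) x, lact a (s *: x) = s *: lact a x;
  lact_central : forall (c : k) x, lact c%:A x = ((c%:A : S) : S^c) *: x
}.

Lemma lact0 (k : fieldType) (R S : algType k) (M : bimod R S) a :
  lact a (0 : M) = 0.
Proof. by apply: (addIr (lact a (0 : M))); rewrite -lactDr !add0r. Qed.

Lemma lactN (k : fieldType) (R S : algType k) (M : bimod R S) a (x : M) :
  lact a (- x) = - lact a x.
Proof. by apply: (addIr (lact a x)); rewrite -lactDr !addNr lact0. Qed.

Section Tensor.
Variables (k : fieldType) (R S : algType k) (V : lmodType R^c) (M : bimod R S).

Inductive tens_rel : set {freeg (V * M)%type} :=
| tens_relDl (v v' : V) (m : M) :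
    tens_rel (fgen (v + v', m) - fgen (v, m) - fgen (v', m))
| tens_relDr (v : V) (m m' : M) :
    tens_rel (fgen (v, m + m') - fgen (v, m) - fgen (v, m'))
| tens_relA (v : V) (a : R) (m : M) :
    tens_rel (fgen ((a : R^c) *: v, m) - fgen (v, lact a m)).

Definition tensor := presented tens_rel.
HB.instance Definition _ := GRing.Zmodule.on tensor.

Definition tens (v : V) (m : M) : tensor := pgen tens_rel (v, m).

Lemma tensDl v v' m : tens (v + v') m = tens v m + tens v' m.
Proof.
apply/eqP; rewrite -subr_eq0 opprD addrA /tens /pgen -!pprojB; apply/eqP.
exact/pproj_rel/tens_relDl.
Qed.

Lemma tensDr v m m' : tens v (m + m') = tens v m + tens v m'.
Proof.
apply/eqP; rewrite -subr_eq0 opprD addrA /tens /pgen -!pprojB; apply/eqP.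
exact/pproj_rel/tens_relDr.
Qed.

Lemma tensA v (a : R) m : tens ((a : R^c) *: v) m = tens v (lact a m).
Proof.
apply/eqP; rewrite -subr_eq0 /tens /pgen -!pprojB; apply/eqP.
exact/pproj_rel/tens_relA.
Qed.

Lemma tensor_ind (Q : tensor -> Prop) :
  Q 0 -> (forall x y, Q x -> Q y -> Q (x - y)) -> (forall v m, Q (tens v m)) ->
  forall x, Q x.
Proof. by move=> Q0 QB Qg; apply: presented_ind => // -[v m]; apply: Qg. Qed.

Section TensLift.
Variables (W : zmodType) (f : V -> M -> W).

Definition tens_lift : tensor -> W := plift (fun p : (V * M)%type => f p.1 p.2).

Hypothesis fDl : forall v v' m, f (v + v') m = f v m + f v' m.
Hypothesis fDr : forall v m m', f v (m + m') = f v m + f v m'.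
Hypothesis fA : forall v (a : R) m, f ((a : R^c) *: v) m = f v (lact a m).

Lemma tens_lift_respects :
  respects tens_rel (fun p : (V * M)%type => f p.1 p.2).
Proof.
move=> x; case=> [v v' m|v m m'|v a m]; rewrite !fliftB !flift_gen /=.
- by rewrite fDl addrAC addrK subrr.
- by rewrite fDr addrAC addrK subrr.
- by rewrite fA subrr.
Qed.

Lemma tens_liftE v m : tens_lift (tens v m) = f v m.
Proof. exact: (plift_gen tens_lift_respects). Qed.

Lemma tens_liftB x y : tens_lift (x - y) = tens_lift x - tens_lift y.
Proof. exact: (pliftB tens_lift_respects). Qed.

Lemma tens_lift0 : tens_lift 0 = 0.
Proof. by have := tens_liftB 0 0; rewrite !subrr. Qed.

Lemma tens_liftD x y : tens_lift (x + y) = tens_lift x + tens_lift y.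
Proof.
by rewrite -[y in LHS]opprK tens_liftB -[- y]sub0r tens_liftB tens_lift0 sub0r opprK.
Qed.

End TensLift.

Definition tens_scale (s : S^c) : tensor -> tensor :=
  tens_lift (fun v m => tens v (s *: m)).

Lemma tens_scaleE s v m : tens_scale s (tens v m) = tens v (s *: m).
Proof.
apply: tens_liftE => [? ? ?|? ? ?|? ? ?].
- exact: tensDl.
- by rewrite scalerDr tensDr.
- by rewrite tensA lact_ract.
Qed.

Lemma tens_scaleB s x y : tens_scale s (x - y) = tens_scale s x - tens_scale s y.
Proof.
apply: tens_liftB => [? ? ?|? ? ?|? ? ?].
- exact: tensDl.
- by rewrite scalerDr tensDr.
- by rewrite tensA lact_ract.
Qed.

Lemma tens_scale0 s : tens_scale s 0 = 0.
Proof. by have := tens_scaleB s 0 0; rewrite !subrr. Qed.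

Lemma tens_scaleA s s' x : tens_scale s (tens_scale s' x) = tens_scale (s * s') x.
Proof.
elim/tensor_ind: x => [|x y IHx IHy|v m]; first by rewrite !tens_scale0.
- by rewrite !tens_scaleB IHx IHy.
- by rewrite !tens_scaleE scalerA.
Qed.

Lemma tens_scale1 : left_id 1 tens_scale.
Proof.
move=> x; elim/tensor_ind: x => [|x y IHx IHy|v m]; first by rewrite !tens_scale0.
- by rewrite !tens_scaleB IHx IHy.
- by rewrite !tens_scaleE scale1r.
Qed.

Lemma tens_scaleDr : right_distributive tens_scale +%R.
Proof.
move=> s x y; rewrite -[y in LHS]opprK tens_scaleB.
by rewrite -[- y]sub0r tens_scaleB tens_scale0 sub0r opprK.
Qed.

Lemma tens_scaleDl x : {morph tens_scale^~ x : s s' / s + s'}.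
Proof.
move=> s s' /=; elim/tensor_ind: x => [|x y IHx IHy|v m].
- by rewrite !tens_scale0 addr0.
- by rewrite !tens_scaleB IHx IHy opprD addrACA.
- by rewrite !tens_scaleE scalerDl tensDr.
Qed.

HB.instance Definition _ := GRing.Zmodule_isLmodule.Build S^c tensor
  tens_scaleA tens_scale1 tens_scaleDr tens_scaleDl.

End Tensor.

Arguments tensor {k R S} V M.
Arguments tens {k R S V M} v m.

Section TensMap.
Variables (k : fieldType) (R S : algType k) (M : bimod R S).
Variables (V W : lmodType R^c) (f : {linear V -> W}).

Definition tens_map : tensor V M -> tensor W M :=
  tens_lift (fun v m => tens (f v) m).

Lemma tens_mapE v m : tens_map (tens v m) = tens (f v) m.
Proof.
apply: tens_liftE => [? ? ?|? ? ?|? ? ?].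
- by rewrite linearD tensDl.
- exact: tensDr.
- by rewrite linearZ_LR tensA.
Qed.

Lemma tens_mapB x y : tens_map (x - y) = tens_map x - tens_map y.
Proof.
apply: tens_liftB => [? ? ?|? ? ?|? ? ?].
- by rewrite linearD tensDl.
- exact: tensDr.
- by rewrite linearZ_LR tensA.
Qed.

End TensMap.

(* The free A-B-bimodule A X B on the set X (k acting centrally), spanned by  *)
(* the elements a x b with a in A, x in X, b in B, which are biadditive and   *)
(* k-balanced in (a, b): X copies of A (x)_k B.                               *)
Section FreeBimodule.
Variables (k : fieldType) (A B : algType k) (X : choiceType).

Inductive fbim_rel : set {freeg (A * X * B)%type} :=
| fbim_relDl (a a' : A) (x : X) (b : B) :
    fbim_rel (fgen (a + a', x, b) - fgen (a, x, b) - fgen (a', x, b))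
| fbim_relDr (a : A) (x : X) (b b' : B) :
    fbim_rel (fgen (a, x, b + b') - fgen (a, x, b) - fgen (a, x, b'))
| fbim_relA (c : k) (a : A) (x : X) (b : B) :
    fbim_rel (fgen (c *: a, x, b) - fgen (a, x, c *: b)).

Definition fbim := presented fbim_rel.
HB.instance Definition _ := GRing.Zmodule.on fbim.

Definition fbelt (a : A) (x : X) (b : B) : fbim := pgen fbim_rel (a, x, b).

Lemma fbeltDl a a' x b : fbelt (a + a') x b = fbelt a x b + fbelt a' x b.
Proof.
apply/eqP; rewrite -subr_eq0 opprD addrA /fbelt /pgen -!pprojB; apply/eqP.
exact/pproj_rel/fbim_relDl.
Qed.

Lemma fbeltDr a x b b' : fbelt a x (b + b') = fbelt a x b + fbelt a x b'.
Proof.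
apply/eqP; rewrite -subr_eq0 opprD addrA /fbelt /pgen -!pprojB; apply/eqP.
exact/pproj_rel/fbim_relDr.
Qed.

Lemma fbeltA c a x b : fbelt (c *: a) x b = fbelt a x (c *: b).
Proof.
apply/eqP; rewrite -subr_eq0 /fbelt /pgen -!pprojB; apply/eqP.
exact/pproj_rel/fbim_relA.
Qed.

Lemma fbim_ind (Q : fbim -> Prop) :
  Q 0 -> (forall x y, Q x -> Q y -> Q (x - y)) ->
  (forall a x b, Q (fbelt a x b)) -> forall x, Q x.
Proof. by move=> Q0 QB Qg; apply: presented_ind => // -[[a x] b]; apply: Qg. Qed.

Section FbimLift.
Variables (W : zmodType) (f : A -> X -> B -> W).

Definition fbim_lift : fbim -> W :=
  plift (fun p : (A * X * B)%type => f p.1.1 p.1.2 p.2).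

Hypothesis fDl : forall a a' x b, f (a + a') x b = f a x b + f a' x b.
Hypothesis fDr : forall a x b b', f a x (b + b') = f a x b + f a x b'.
Hypothesis fA : forall c a x b, f (c *: a) x b = f a x (c *: b).

Lemma fbim_lift_respects :
  respects fbim_rel (fun p : (A * X * B)%type => f p.1.1 p.1.2 p.2).
Proof.
move=> y; case=> [a a' x b|a x b b'|c a x b]; rewrite !fliftB !flift_gen /=.
- by rewrite fDl addrAC addrK subrr.
- by rewrite fDr addrAC addrK subrr.
- by rewrite fA subrr.
Qed.

Lemma fbim_liftE a x b : fbim_lift (fbelt a x b) = f a x b.
Proof. exact: (plift_gen fbim_lift_respects). Qed.

Lemma fbim_liftB x y : fbim_lift (x - y) = fbim_lift x - fbim_lift y.
Proof. exact: (pliftB fbim_lift_respects). Qed.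

End FbimLift.

Definition fbim_act (a' : A) (b' : B) : fbim -> fbim :=
  fbim_lift (fun a x b => fbelt (a' * a) x (b * b')).

Lemma fbim_actE a' b' a x b :
  fbim_act a' b' (fbelt a x b) = fbelt (a' * a) x (b * b').
Proof.
apply: fbim_liftE => *.
- by rewrite mulrDr fbeltDl.
- by rewrite mulrDl fbeltDr.
- by rewrite -scalerAr -scalerAl fbeltA.
Qed.

Lemma fbim_actB a b x y : fbim_act a b (x - y) = fbim_act a b x - fbim_act a b y.
Proof.
apply: fbim_liftB => *.
- by rewrite mulrDr fbeltDl.
- by rewrite mulrDl fbeltDr.
- by rewrite -scalerAr -scalerAl fbeltA.
Qed.

Lemma fbim_act0 a b : fbim_act a b 0 = 0.
Proof. by have := fbim_actB a b 0 0; rewrite !subrr. Qed.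

Lemma fbim_actD a b x y : fbim_act a b (x + y) = fbim_act a b x + fbim_act a b y.
Proof.
rewrite -[y in LHS]opprK fbim_actB.
by rewrite -[- y]sub0r fbim_actB fbim_act0 sub0r opprK.
Qed.

Lemma fbim_actA a b a' b' x :
  fbim_act a b (fbim_act a' b' x) = fbim_act (a * a') (b' * b) x.
Proof.
elim/fbim_ind: x => [|x y IHx IHy|c x d]; first by rewrite !fbim_act0.
- by rewrite !fbim_actB IHx IHy.
- by rewrite !fbim_actE !mulrA.
Qed.

Lemma fbim_act1 x : fbim_act 1 1 x = x.
Proof.
elim/fbim_ind: x => [|x y IHx IHy|c x d]; first by rewrite !fbim_act0.
- by rewrite !fbim_actB IHx IHy.
- by rewrite fbim_actE mul1r mulr1.
Qed.

Lemma fbim_actDl a a' x : fbim_act (a + a') 1 x = fbim_act a 1 x + fbim_act a' 1 x.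
Proof.
elim/fbim_ind: x => [|x y IHx IHy|c x d]; first by rewrite !fbim_act0 addr0.
- by rewrite !fbim_actB IHx IHy opprD addrACA.
- by rewrite !fbim_actE mulrDl fbeltDl.
Qed.

Lemma fbim_actDr b b' x : fbim_act 1 (b + b') x = fbim_act 1 b x + fbim_act 1 b' x.
Proof.
elim/fbim_ind: x => [|x y IHx IHy|c x d]; first by rewrite !fbim_act0 addr0.
- by rewrite !fbim_actB IHx IHy opprD addrACA.
- by rewrite !fbim_actE mulrDr fbeltDr.
Qed.

Definition fbim_scale (b : B^c) : fbim -> fbim := fbim_act 1 b.

Lemma fbim_scaleA b b' x : fbim_scale b (fbim_scale b' x) = fbim_scale (b * b') x.
Proof. by rewrite /fbim_scale fbim_actA mul1r. Qed.

Lemma fbim_scale1 : left_id 1 fbim_scale.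
Proof. exact: fbim_act1. Qed.

Lemma fbim_scaleDr : right_distributive fbim_scale +%R.
Proof. by move=> b x y; apply: fbim_actD. Qed.

Lemma fbim_scaleDl x : {morph fbim_scale^~ x : b b' / b + b'}.
Proof. by move=> b b'; apply: fbim_actDr. Qed.

HB.instance Definition _ := GRing.Zmodule_isLmodule.Build B^c fbim
  fbim_scaleA fbim_scale1 fbim_scaleDr fbim_scaleDl.

Definition fbim_lact (a : A) : fbim -> fbim := fbim_act a 1.

Lemma fbim_lactA a a' x : fbim_lact a (fbim_lact a' x) = fbim_lact (a * a') x.
Proof. by rewrite /fbim_lact fbim_actA mul1r. Qed.

Lemma fbim_lact_ract a (b : B^c) x : fbim_lact a (b *: x) = b *: fbim_lact a x.
Proof.
rewrite /fbim_lact -![b *: _]/(fbim_act 1 b _) !fbim_actA.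
by rewrite !mulr1 !mul1r.
Qed.

Lemma fbim_lact_central (c : k) x :
  fbim_lact c%:A x = ((c%:A : B) : B^c) *: x.
Proof.
rewrite -[RHS]/(fbim_act 1 c%:A x) /fbim_lact.
elim/fbim_ind: x => [|x y IHx IHy|a x b]; first by rewrite !fbim_act0.
- by rewrite !fbim_actB IHx IHy.
- by rewrite !fbim_actE mul1r mulr1 -scalerAl -scalerAr mul1r mulr1 fbeltA.
Qed.

Definition free_bimod : bimod A B :=
  Bimod fbim_actDl (fun a => fbim_actD a 1) fbim_lactA fbim_act1
        fbim_lact_ract fbim_lact_central.

End FreeBimodule.

Arguments free_bimod {k} A B X.

Definition dprod (I : Type) (T : I -> Type) := forall i, T i.
Identity Coercion dprod_fun : dprod >-> Funclass.

Section DprodZmodule.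
Variables (I : Type) (T : I -> zmodType).
Implicit Types x y : dprod T.

HB.instance Definition _ := gen_eqMixin (dprod T).
HB.instance Definition _ := gen_choiceMixin (dprod T).

Lemma dprodP x y : (forall i, x i = y i) -> x = y.
Proof. exact: functional_extensionality_dep. Qed.

Definition dprod0 : dprod T := fun=> 0.
Definition dprodN x : dprod T := fun i => - x i.
Definition dprodD x y : dprod T := fun i => x i + y i.

Lemma dprodDA : associative dprodD.
Proof. by move=> x y z; apply: dprodP => i; apply: addrA. Qed.
Lemma dprodDC : commutative dprodD.
Proof. by move=> x y; apply: dprodP => i; apply: addrC. Qed.
Lemma dprod0D : left_id dprod0 dprodD.
Proof. by move=> x; apply: dprodP => i; apply: add0r. Qed.
Lemma dprodND : left_inverse dprod0 dprodN dprodD.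
Proof. by move=> x; apply: dprodP => i; apply: addNr. Qed.

HB.instance Definition _ :=
  GRing.isZmodule.Build (dprod T) dprodDA dprodDC dprod0D dprodND.

Lemma dprodDE x y i : (x + y) i = x i + y i. Proof. by []. Qed.
Lemma dprodBE x y i : (x - y) i = x i - y i. Proof. by []. Qed.
Lemma dprod0E i : (0 : dprod T) i = 0. Proof. by []. Qed.

End DprodZmodule.

(* The product of a family of algebras; the element i0 witnesses that the     *)
(* index set is nonempty, hence that the product is a nonzero algebra.        *)
Definition prodalg (k : fieldType) (I : Type) (i0 : I) (B : I -> algType k) :=
  dprod B.

Section ProdAlg.
Variables (k : fieldType) (I : Type) (i0 : I) (B : I -> algType k).
Local Notation P := (prodalg i0 B).
Implicit Types x y : P.

HB.instance Definition _ := GRing.Zmodule.copy P (dprod B).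

Definition prodalg1 : P := fun=> 1.
Definition prodalgM x y : P := fun i => x i * y i.
Definition prodalgZ (c : k) x : P := fun i => c *: x i.

Lemma prodalgMA : associative prodalgM.
Proof. by move=> x y z; apply: dprodP => i; apply: mulrA. Qed.
Lemma prodalg1M : left_id prodalg1 prodalgM.
Proof. by move=> x; apply: dprodP => i; apply: mul1r. Qed.
Lemma prodalgM1 : right_id prodalg1 prodalgM.
Proof. by move=> x; apply: dprodP => i; apply: mulr1. Qed.
Lemma prodalgMDl : left_distributive prodalgM +%R.
Proof. by move=> x y z; apply: dprodP => i; apply: mulrDl. Qed.
Lemma prodalgMDr : right_distributive prodalgM +%R.
Proof. by move=> x y z; apply: dprodP => i; apply: mulrDr. Qed.
Lemma prodalg1_neq0 : prodalg1 != 0.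
Proof.
apply/eqP => /(congr1 (fun x : P => x i0)) => /eqP.
by rewrite -[_ == _]/(1 == 0 :> B i0) oner_eq0.
Qed.

HB.instance Definition _ := GRing.Zmodule_isNzRing.Build P
  prodalgMA prodalg1M prodalgM1 prodalgMDl prodalgMDr prodalg1_neq0.

Lemma prodalgZA c d x : prodalgZ c (prodalgZ d x) = prodalgZ (c * d) x.
Proof. by apply: dprodP => i; apply: scalerA. Qed.
Lemma prodalg1Z : left_id 1 prodalgZ.
Proof. by move=> x; apply: dprodP => i; apply: scale1r. Qed.
Lemma prodalgZDr : right_distributive prodalgZ +%R.
Proof. by move=> c x y; apply: dprodP => i; apply: scalerDr. Qed.
Lemma prodalgZDl x : {morph prodalgZ^~ x : c d / c + d}.
Proof. by move=> c d; apply: dprodP => i; apply: scalerDl. Qed.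

HB.instance Definition _ := GRing.Zmodule_isLmodule.Build k P
  prodalgZA prodalg1Z prodalgZDr prodalgZDl.

Lemma prodalgZAl (c : k) (x y : P) : c *: (x * y) = (c *: x) * y.
Proof. by apply: dprodP => i; apply: scalerAl. Qed.
HB.instance Definition _ := GRing.Lmodule_isLalgebra.Build k P prodalgZAl.

Lemma prodalgZAr (c : k) (x y : P) : c *: (x * y) = x * (c *: y).
Proof. by apply: dprodP => i; apply: scalerAr. Qed.
HB.instance Definition _ := GRing.Lalgebra_isAlgebra.Build k P prodalgZAr.

End ProdAlg.

(* The direct sum of a finite family M i j of B i-B j-bimodules, as a         *)
(* bimodule over the product of the algebras B i.                             *)
Section SumBimodule.
Variables (k : fieldType) (I : finType) (i0 : I) (B : I -> algType k).
Variable M : forall i j, bimod (B i) (B j).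
Local Notation B0 := (prodalg i0 B).

Definition sumbim := dprod (fun p : (I * I)%type => M p.1 p.2).
HB.instance Definition _ := GRing.Zmodule.on sumbim.
Implicit Types x y : sumbim.

Definition sumbim_scale (b : B0^c) x : sumbim :=
  fun p => ((b : B0) p.2 : (B p.2)^c) *: x p.

Lemma sumbim_scaleA b c x :
  sumbim_scale b (sumbim_scale c x) = sumbim_scale (b * c) x.
Proof. by apply: dprodP => p; apply: scalerA. Qed.
Lemma sumbim_scale1 : left_id 1 sumbim_scale.
Proof. by move=> x; apply: dprodP => p; apply: scale1r. Qed.
Lemma sumbim_scaleDr : right_distributive sumbim_scale +%R.
Proof. by move=> b x y; apply: dprodP => p; apply: scalerDr. Qed.
Lemma sumbim_scaleDl x : {morph sumbim_scale^~ x : b c / b + c}.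
Proof. by move=> b c; apply: dprodP => p; apply: scalerDl. Qed.

HB.instance Definition _ := GRing.Zmodule_isLmodule.Build B0^c sumbim
  sumbim_scaleA sumbim_scale1 sumbim_scaleDr sumbim_scaleDl.

Definition sumbim_lact (b : B0) x : sumbim := fun p => lact (b p.1) (x p).

Lemma sumbim_lactDl b c x :
  sumbim_lact (b + c) x = sumbim_lact b x + sumbim_lact c x.
Proof. by apply: dprodP => p; apply: lactDl. Qed.
Lemma sumbim_lactDr b x y :
  sumbim_lact b (x + y) = sumbim_lact b x + sumbim_lact b y.
Proof. by apply: dprodP => p; apply: lactDr. Qed.
Lemma sumbim_lactA b c x :
  sumbim_lact b (sumbim_lact c x) = sumbim_lact (b * c) x.
Proof. by apply: dprodP => p; apply: lactA. Qed.
Lemma sumbim_lact1 x : sumbim_lact 1 x = x.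
Proof. by apply: dprodP => p; apply: lact1. Qed.
Lemma sumbim_lact_ract b (c : B0^c) x :
  sumbim_lact b (c *: x) = c *: sumbim_lact b x.
Proof. by apply: dprodP => p; apply: lact_ract. Qed.
Lemma sumbim_lact_central (c : k) x :
  sumbim_lact c%:A x = ((c%:A : B0) : B0^c) *: x.
Proof. by apply: dprodP => p; apply: lact_central. Qed.

Definition sum_bimod : bimod B0 B0 :=
  Bimod sumbim_lactDl sumbim_lactDr sumbim_lactA sumbim_lact1
        sumbim_lact_ract sumbim_lact_central.

End SumBimodule.

Section TensorAlgebra.
Variables (k : fieldType) (R : algType k) (M : bimod R R).

Fixpoint tpow (n : nat) : lmodType R^c :=
  if n is n'.+1 then tensor (tpow n') M else (R^c)^o.

(* The direct sum of the M^{(x) n} is the group of families (x n)_n with x n  *)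
(* in M^{(x) n} and almost all of the x n equal to 0.                         *)
Definition almost_null : {pred dprod tpow} :=
  fun x => `[< exists N, forall n, (N <= n)%N -> x n = 0 >].

Lemma almost_null_zmod_closed : zmod_closed almost_null.
Proof.
split=> [|x y]; first by apply: (introT (asboolP _)); exists 0%N.
move=> /(elimT (asboolP _)) [N xN] /(elimT (asboolP _)) [N' yN].
apply: (introT (asboolP _)); exists (maxn N N') => n.
by rewrite geq_max dprodBE => /andP[/xN -> /yN ->]; rewrite subrr.
Qed.

HB.instance Definition _ :=
  GRing.isZmodClosed.Build (dprod tpow) almost_null almost_null_zmod_closed.

Record talg := Talg { tval :> dprod tpow; tvalP : tval \in almost_null }.
HB.instance Definition _ := [isSub for tval].
HB.instance Definition _ := [Choice of talg by <:].
HB.instance Definition _ := [SubChoice_isSubZmodule of talg by <:].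

Implicit Types x y z : talg.

Lemma talgP x y : (forall n, x n = y n) -> x = y.
Proof. by move=> xy; apply/val_inj/dprodP. Qed.

Lemma tvalDE x y n : (x + y) n = x n + y n. Proof. by []. Qed.
Lemma tvalBE x y n : (x - y) n = x n - y n. Proof. by []. Qed.
Lemma tval0E n : (0 : talg) n = 0. Proof. by []. Qed.

Lemma tval_null x : exists N, forall n, (N <= n)%N -> x n = 0.
Proof. exact: (elimT (asboolP _) (tvalP x)). Qed.

Definition tbound x : nat := sval (cid (tval_null x)).

Lemma tboundP x n : (tbound x <= n)%N -> x n = 0.
Proof. by move=> le_n; rewrite (svalP (cid (tval_null x))). Qed.

Definition tinj_fun n (y : tpow n) : dprod tpow := fun p =>
  if n =P p is ReflectT e then ecast p (tpow p) e y else 0.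

Lemma tinj_subproof n (y : tpow n) : tinj_fun y \in almost_null.
Proof.
apply: (introT (asboolP _)); exists n.+1 => p le_p.
by rewrite /tinj_fun; case: eqP => // e; rewrite e ltnn in le_p.
Qed.

Definition tinj n (y : tpow n) : talg := Talg (tinj_subproof y).

Lemma tinjE n (y : tpow n) : tinj y n = y.
Proof. by rewrite /= /tinj_fun; case: eqP => // e; rewrite eq_axiomK. Qed.

Lemma tinj_neq n (y : tpow n) p : n <> p -> tinj y p = 0.
Proof. by rewrite /= /tinj_fun; case: eqP. Qed.

Lemma talg_scale_subproof (r : R^c) x :
  (fun n => r *: x n : tpow n) \in almost_null.
Proof.
apply: (introT (asboolP _)); exists (tbound x) => n /tboundP ->.
exact: scaler0.
Qed.

Definition talg_ract (r : R^c) x : talg := Talg (talg_scale_subproof r x).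

Definition tshift_fun (m : M) x : dprod tpow := fun n =>
  if n is n'.+1 then tens (x n') m : tpow n'.+1 else 0.

Lemma tens0l (V : lmodType R^c) (m : M) : tens (0 : V) m = 0.
Proof. by apply: (addIr (tens (0 : V) m)); rewrite -tensDl !add0r. Qed.

Lemma tensNl (V : lmodType R^c) (v : V) (m : M) : tens (- v) m = - tens v m.
Proof. by apply: (addIr (tens v m)); rewrite -tensDl !addNr tens0l. Qed.

Lemma tshift_subproof m x : tshift_fun m x \in almost_null.
Proof.
apply: (introT (asboolP _)); exists (tbound x).+1 => -[//|n] le_n.
by rewrite /= tboundP // tens0l.
Qed.

Definition tshift m x : talg := Talg (tshift_subproof m x).

Local Notation tend := (dprod (fun _ : talg => talg)).

(* For y in M^{(x) n}, [tract y] is the right multiplication by y on T(R, M), *)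
(* which is the concatenation of tensors: x (y (x) m) = (x y) (x) m.          *)
Fixpoint tract (n : nat) : tpow n -> tend :=
  match n return tpow n -> tend with
  | 0 => fun (r : R^c) x => talg_ract r x
  | n'.+1 => tens_lift (fun (y : tpow n') m => (fun x => tshift m (tract y x)) : tend)
  end.

Definition tmul x y : talg := \sum_(n < tbound y) tract (y n) x.
Definition tone : talg := tinj (1 : tpow 0).

Lemma talg_ractDl r s x : talg_ract (r + s) x = talg_ract r x + talg_ract s x.
Proof. by apply: talgP => n; rewrite tvalDE /= scalerDl. Qed.

Lemma talg_ractDr r x y : talg_ract r (x + y) = talg_ract r x + talg_ract r y.
Proof. by apply: talgP => n; rewrite tvalDE /= scalerDr. Qed.

Lemma talg_ractA r s x : talg_ract r (talg_ract s x) = talg_ract (r * s) x.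
Proof. by apply: talgP => n; rewrite /= scalerA. Qed.

Lemma talg_ract1 x : talg_ract 1 x = x.
Proof. by apply: talgP => n; rewrite /= scale1r. Qed.

Lemma tshiftDr m x y : tshift m (x + y) = tshift m x + tshift m y.
Proof.
apply: talgP => -[|n]; rewrite tvalDE /=; first by rewrite addr0.
exact: tensDl.
Qed.

Lemma tshiftDl m m' x : tshift (m + m') x = tshift m x + tshift m' x.
Proof.
apply: talgP => -[|n]; rewrite tvalDE /=; first by rewrite addr0.
exact: tensDr.
Qed.

Lemma tshift_ract m r x : tshift m (talg_ract r x) = tshift (lact (r : R) m) x.
Proof. by apply: talgP => -[|n] //=; rewrite tensA. Qed.

Lemma ract_tshift m r x : talg_ract r (tshift m x) = tshift (r *: m) x.
Proof.
apply: talgP => -[|n] /=; first exact: scaler0.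
exact: tens_scaleE.
Qed.

Definition tstep n (y : tpow n) (m : M) : tend := fun x => tshift m (tract y x).

Lemma tractS n (y : tpow n.+1) : tract y = tens_lift (@tstep n) y.
Proof. by []. Qed.

Definition tract_rlinear n :=
  (forall y y' : tpow n, tract (y + y') = tract y + tract y') /\
  (forall (y : tpow n) (r : R^c) x, tract (r *: y) x = talg_ract r (tract y x)).

Section Step.
Variables (n : nat) (Hn : tract_rlinear n).

Lemma tstepDl (v v' : tpow n) m : tstep (v + v') m = tstep v m + tstep v' m.
Proof. by apply: dprodP => x; rewrite /tstep Hn.1 !dprodDE tshiftDr. Qed.

Lemma tstepDr (v : tpow n) m m' : tstep v (m + m') = tstep v m + tstep v m'.
Proof. by apply: dprodP => x; rewrite /tstep !dprodDE tshiftDl. Qed.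

Lemma tstepA (v : tpow n) (a : R) m :
  tstep ((a : R^c) *: v) m = tstep v (lact a m).
Proof. by apply: dprodP => x; rewrite /tstep Hn.2 tshift_ract. Qed.

Lemma tract_tens_step (y : tpow n) m : tract (tens y m : tpow n.+1) = tstep y m.
Proof. by rewrite tractS; apply: tens_liftE tstepDl tstepDr tstepA _ _. Qed.

Lemma tract_rlinearS : tract_rlinear n.+1.
Proof.
have HB (y y' : tpow n.+1) : tract (y - y') = tract y - tract y'.
  by rewrite !tractS; apply: tens_liftB tstepDl tstepDr tstepA _ _.
split=> [y y'|y r x].
  by rewrite !tractS; apply: tens_liftD tstepDl tstepDr tstepA _ _.
elim/tensor_ind: y x => [|y y' IH IH'|v m] x.
- rewrite scaler0 (_ : tract (0 : tpow n.+1) = 0); last first.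
    by rewrite tractS; apply: tens_lift0 tstepDl tstepDr tstepA.
  by apply: talgP => p; rewrite /= scaler0.
- rewrite scalerBr !HB !dprodBE IH IH'.
  by apply: talgP => p; rewrite /= scalerBr.
- rewrite (_ : r *: tens v m = tens v (r *: m)); last exact: tens_scaleE.
  by rewrite !tract_tens_step /tstep ract_tshift.
Qed.

End Step.

Lemma tractP n : tract_rlinear n.
Proof.
elim: n => [|n IH]; last exact: tract_rlinearS.
split=> [y y'|y r x].
  by apply: dprodP => x; rewrite dprodDE; apply: talg_ractDl.
by apply: esym; apply: talg_ractA.
Qed.

Lemma tractDl n (y y' : tpow n) x : tract (y + y') x = tract y x + tract y' x.
Proof. by rewrite (tractP n).1. Qed.

Lemma tractZ n (y : tpow n) (r : R^c) x :
  tract (r *: y) x = talg_ract r (tract y x).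
Proof. by rewrite (tractP n).2. Qed.

Lemma tract_tens n (y : tpow n) m x :
  tract (tens y m : tpow n.+1) x = tshift m (tract y x).
Proof. by rewrite tract_tens_step //; apply: tractP. Qed.

Lemma tract0l n x : tract (0 : tpow n) x = 0.
Proof. by apply: (addIr (tract (0 : tpow n) x)); rewrite -tractDl !add0r. Qed.

Lemma tractBl n (y y' : tpow n) x : tract (y - y') x = tract y x - tract y' x.
Proof. by apply/esym/eqP; rewrite subr_eq -tractDl subrK. Qed.

Lemma tractDr n (y : tpow n) x x' : tract y (x + x') = tract y x + tract y x'.
Proof.
elim: n y x x' => [|n IH] y x x'; first exact: talg_ractDr.
elim/tensor_ind: y => [|y y' IHy IHy'|v m].
- by rewrite !tract0l addr0.
- by rewrite !tractBl IHy IHy' opprD addrACA.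
- by rewrite !tract_tens IH tshiftDr.
Qed.

Lemma tmulE N x y : (tbound y <= N)%N -> tmul x y = \sum_(n < N) tract (y n) x.
Proof.
move=> le_N; rewrite /tmul (big_ord_widen _ (fun n => tract (y n) x) le_N).
rewrite big_mkcond /=; apply: eq_bigr => n _.
by case: ltnP => // /tboundP ->; rewrite tract0l.
Qed.

Lemma tmulDr x y z : tmul x (y + z) = tmul x y + tmul x z.
Proof.
pose N := maxn (tbound (y + z)) (maxn (tbound y) (tbound z)).
rewrite (@tmulE N x (y + z)) ?leq_maxl // (@tmulE N x y) ?(@tmulE N x z).
- by rewrite -big_split; apply: eq_bigr => n _; rewrite tvalDE tractDl.
- by rewrite /N !leq_max leqnn !orbT.
- by rewrite /N !leq_max leqnn !orbT.
Qed.

Lemma tmulDl x y z : tmul (x + y) z = tmul x z + tmul y z.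
Proof. by rewrite -big_split; apply: eq_bigr => n _; rewrite tractDr. Qed.

Lemma tmul0r x : tmul x 0 = 0.
Proof. by apply: (addIr (tmul x 0)); rewrite -tmulDr !add0r. Qed.

Lemma tmul0l x : tmul 0 x = 0.
Proof. by apply: (addIr (tmul 0 x)); rewrite -tmulDl !add0r. Qed.

Lemma tmul_sumr x (r : nat) (F : 'I_r -> talg) :
  tmul x (\sum_i F i) = \sum_i tmul x (F i).
Proof. exact: (big_morph (tmul x) (tmulDr x) (tmul0r x)). Qed.

Lemma tmul_inj n x (y : tpow n) : tmul x (tinj y) = tract y x.
Proof.
pose N := maxn (tbound (tinj y)) n.+1.
have lt_n : (n < N)%N by rewrite /N leq_max leqnn orbT.
rewrite (@tmulE N) ?leq_maxl // (bigD1 (Ordinal lt_n)) //= big1 ?addr0.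
  by rewrite -[tinj_fun y n]/(tinj y n) tinjE.
move=> i ne_i; rewrite -[tinj_fun y i]/(tinj y i) tinj_neq ?tract0l // => e.
by move/eqP: ne_i; apply; apply: val_inj.
Qed.

Lemma tinj_sum x : x = \sum_(n < tbound x) tinj (x n).
Proof.
apply: talgP => p.
have -> : (\sum_(n < tbound x) tinj (x n)) p = \sum_(n < tbound x) tinj (x n) p.
  exact: (big_morph (fun y : talg => y p)).
have [lt_p|le_p] := ltnP p (tbound x).
  rewrite (bigD1 (Ordinal lt_p)) //= big1 ?addr0.
    by rewrite -[tinj_fun (x p) p]/(tinj (x p) p) tinjE.
  move=> i ne_i; rewrite -[tinj_fun _ _]/(tinj (x i) p) tinj_neq // => e.
  by move/eqP: ne_i; apply; apply: val_inj.
rewrite tboundP // big1 // => i _; rewrite tinj_neq // => e.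
by rewrite -e leqNgt ltn_ord in le_p.
Qed.

Lemma tmul_ract x y (r : R^c) : tmul x (talg_ract r y) = talg_ract r (tmul x y).
Proof.
pose N := maxn (tbound (talg_ract r y)) (tbound y).
rewrite (@tmulE N) ?leq_maxl // (@tmulE N x y) ?leq_maxr //.
rewrite (big_morph (talg_ract r) (talg_ractDr r) (_ : _ = 0)).
  by apply: eq_bigr => n _; rewrite /= tractZ.
by apply: talgP => p; rewrite /= scaler0.
Qed.

Lemma tmul_shift x y m : tmul x (tshift m y) = tshift m (tmul x y).
Proof.
pose N := maxn (tbound (tshift m y)) (tbound y).
rewrite (@tmulE N.+1) ?leqW ?leq_maxl // (@tmulE N x y) ?leq_maxr //.
rewrite big_ord_recl (_ : tract (tshift m y ord0) x = 0); last exact: tract0l.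
rewrite add0r.
rewrite (big_morph (tshift m) (tshiftDr m) (_ : _ = 0)).
  by apply: eq_bigr => n _; apply: tract_tens.
by apply: talgP => -[|p] //=; rewrite tens0l.
Qed.

Lemma tmul_tract n x y (z : tpow n) : tmul x (tract z y) = tract z (tmul x y).
Proof.
elim: n z => [|n IH] z; first exact: tmul_ract.
elim/tensor_ind: z => [|z z' IHz IHz'|v m].
- by rewrite !tract0l tmul0r.
- rewrite !tractBl -IHz -IHz'; apply/eqP.
  by rewrite eq_sym subr_eq -tmulDr subrK.
- by rewrite !tract_tens tmul_shift IH.
Qed.

Lemma tmulA : associative tmul.
Proof.
move=> x y z; rewrite {2}/tmul tmul_sumr.
by apply: eq_bigr => n _; apply: tmul_tract.
Qed.

Lemma tmul1r : right_id tone tmul.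
Proof. by move=> x; rewrite tmul_inj /= talg_ract1. Qed.

Lemma tract_one n (y : tpow n) : tract y tone = tinj y.
Proof.
elim: n y => [|n IH] y.
  apply: talgP => -[|p] /=; rewrite -!/(tinj _ _).
    by rewrite -[tinj_fun _ _]/(tone 0%N) -[tinj_fun y _]/(tinj y 0%N) !tinjE
               /GRing.scale /= mulr1.
  rewrite -[tinj_fun _ _]/(tone p.+1) -[tinj_fun y _]/(tinj y p.+1).
  by rewrite !tinj_neq ?scaler0.
elim/tensor_ind: y => [|y y' IHy IHy'|v m].
- rewrite tract0l; apply: talgP => p.
  have [<-|/eqP ne_p] := eqVneq n.+1 p; first by rewrite tinjE.
  by rewrite tinj_neq.
- rewrite tractBl IHy IHy'; apply: talgP => p; rewrite tvalBE.
  have [<-|/eqP ne_p] := eqVneq n.+1 p; first by rewrite !tinjE.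
  by rewrite !tinj_neq ?subrr.
- rewrite tract_tens IH; apply: talgP => p.
  have [<-|/eqP ne_p] := eqVneq n.+1 p.
    by rewrite tinjE -[LHS]/(tens (tinj v n) m) tinjE.
  rewrite tinj_neq //; case: p ne_p => // p ne_p.
  rewrite -[LHS]/(tens (tinj v p) m) tinj_neq ?tens0l // => e.
  by apply: ne_p; rewrite e.
Qed.

Lemma tmul1l : left_id tone tmul.
Proof.
move=> x; rewrite [RHS]tinj_sum.
by apply: eq_bigr => n _; apply: tract_one.
Qed.

Lemma tone_neq0 : tone != 0.
Proof.
apply/eqP => /(congr1 (fun x : talg => x 0%N)).
by rewrite tinjE => /eqP; apply/negP/(oner_neq0 R).
Qed.

HB.instance Definition _ := GRing.Zmodule_isNzRing.Build talg
  tmulA tmul1l tmul1r tmulDl tmulDr tone_neq0.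

Definition tscale (c : k) x : talg := talg_ract ((c%:A : R) : R^c) x.

Lemma tscaleA c d x : tscale c (tscale d x) = tscale (c * d) x.
Proof.
rewrite /tscale talg_ractA; congr talg_ract.
by rewrite -[LHS]/((d%:A : R) * c%:A) -scalerAl mul1r scalerA mulrC.
Qed.

Lemma tscale1 : left_id 1 tscale.
Proof. by move=> x; rewrite /tscale scale1r talg_ract1. Qed.

Lemma tscaleDr : right_distributive tscale +%R.
Proof. by move=> c x y; apply: talg_ractDr. Qed.

Lemma tscaleDl x : {morph tscale^~ x : c d / c + d}.
Proof. by move=> c d; rewrite /tscale scalerDl talg_ractDl. Qed.

HB.instance Definition _ := GRing.Zmodule_isLmodule.Build k talg
  tscaleA tscale1 tscaleDr tscaleDl.

Lemma tract_scale n (y : tpow n) c x : tract y (tscale c x) = tscale c (tract y x).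
Proof.
elim: n y => [|n IH] y.
  rewrite /= /tscale !talg_ractA; congr talg_ract.
  rewrite -[LHS]/((c%:A : R) * (y : R)) -[RHS]/((y : R) * c%:A).
  by rewrite -scalerAl -scalerAr mul1r mulr1.
elim/tensor_ind: y => [|y y' IHy IHy'|v m].
- by rewrite !tract0l /tscale; apply/esym/talgP => p; rewrite /= scaler0.
- rewrite !tractBl IHy IHy'.
  by apply: talgP => p; rewrite /= scalerBr.
- by rewrite !tract_tens IH /tscale tshift_ract lact_central ract_tshift.
Qed.

Lemma talg_scaleAl (c : k) x y : c *: (x * y) = (c *: x) * y.
Proof.
rewrite -[LHS]/(c *: tmul x y) /tmul scaler_sumr.
by apply: eq_bigr => n _; rewrite -[LHS]/(tscale _ _) -tract_scale.
Qed.
HB.instance Definition _ := GRing.Lmodule_isLalgebra.Build k talg talg_scaleAl.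

Lemma talg_scaleAr (c : k) x y : c *: (x * y) = x * (c *: y).
Proof. by apply: esym; apply: tmul_ract. Qed.
HB.instance Definition _ := GRing.Lalgebra_isAlgebra.Build k talg talg_scaleAr.

Definition tpos : set talg := [set x | x 0%N = 0].

End TensorAlgebra.

Definition right_ideal (R : nzRingType) (I : set R) : Prop :=
  subgroup I /\ (forall x a, I x -> I (x * a)).

Definition two_sided_ideal (R : nzRingType) (I : set R) : Prop :=
  right_ideal I /\ (forall a x, I x -> I (a * x)).

Definition idmul (R : nzRingType) (I J : set R) : set R :=
  addspan [set z | exists x y, [/\ I x, J y & z = x * y]].

Definition idexp (R : nzRingType) (I : set R) (n : nat) : set R :=
  iter n (fun K => idmul K I) [set: R].

Definition simple_ring (R : nzRingType) : Prop :=
  forall I : set R, two_sided_ideal I -> I = [set 0] \/ I = [set: R].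

Definition artinian (R : nzRingType) : Prop :=
  forall I : nat -> set R, (forall n, right_ideal (I n)) ->
  (forall n, I n.+1 `<=` I n) ->
  exists N, forall n, (N <= n)%N -> I n = I N.

Definition maximal_right_ideal (R : nzRingType) (I : set R) : Prop :=
  [/\ right_ideal I, I != [set: R] &
      forall K : set R, right_ideal K -> I `<=` K -> K = I \/ K = [set: R]].

Definition radical (R : nzRingType) : set R :=
  [set x | forall I, maximal_right_ideal I -> I x].

Definition projective (R : nzRingType) (P : lmodType R) : Prop :=
  forall (X Y : lmodType R) (g : {linear X -> Y}) (f : {linear P -> Y}),
  (forall y, exists x, g x = y) -> exists h : {linear P -> X}, forall p, g (h p) = f p.

(* Every right ideal, that is, every submodule (up to isomorphism) of the     *)
(* right module R, is projective.                                             *)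
Definition hereditary (R : nzRingType) : Prop :=
  forall (P : lmodType R^c) (i : {linear P -> (R^c)^o}), injective i -> projective P.

Record quiver := Quiver {
  vertex :> finType;
  arrow : vertex -> vertex -> finType
}.

Record premodulation (k : fieldType) := Premodulation {
  pm_vertex :> finType;
  pm_alg : pm_vertex -> algType k;
  pm_bimod : forall i j, bimod (pm_alg i) (pm_alg j)
}.

Definition pm_edge (k : fieldType) (M : premodulation k) (i j : M) : bool :=
  `[< exists m : pm_bimod i j, m <> 0 >].

Section GeneralizedPathAlgebra.
Variables (k : fieldType) (Q : quiver) (B : Q -> algType k).

Definition path_premodulation : premodulation k :=
  Premodulation (fun i j => free_bimod (B i) (B j) (arrow i j)).

Definition path_bimod (q0 : Q) : bimod (prodalg q0 B) (prodalg q0 B) :=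
  sum_bimod q0 (pm_bimod (p := path_premodulation)).

(* k(Q, B); the vertex q0 only witnesses that Q is nonempty. *)
Definition gpa (q0 : Q) : algType k := talg (path_bimod q0).

Definition gpaJ (q0 : Q) : set (gpa q0) := @tpos _ _ (path_bimod q0).

Definition admissible (q0 : Q) (I : set (gpa q0)) : Prop :=
  [/\ two_sided_ideal I,
      exists2 s, (0 < s)%N & idexp (@gpaJ q0) s `<=` I
    & I `<=` idexp (@gpaJ q0) 2].

End GeneralizedPathAlgebra.

(* A is isomorphic to k(Q, B)/I with k(Q, B) normal and I admissible; the     *)
(* isomorphism is given as a surjective morphism k(Q, B) -> A with kernel I.  *)
Definition gabriel_type (k : fieldType) (A : algType k) : Prop :=
  exists (Q : quiver) (B : Q -> algType k) (q0 : Q) (I : set (gpa B q0)),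
  [/\ forall i, simple_ring (B i), admissible I &
      exists f : {lrmorphism gpa B q0 -> A},
        (forall a, exists x, f x = a) /\ (forall x, f x = 0 <-> I x)].

(* The decomposition A/r = A_1 + ... + A_s into simple two-sided ideals,      *)
(* presented by the components A -> A/r -> A_i of the projection.             *)
Record radical_quotient (k : fieldType) (A : algType k) := RadicalQuotient {
  rq_size : nat;
  rq_comp : 'I_rq_size -> falgType k;
  rq_proj : forall i, {lrmorphism A -> rq_comp i};
  rq_simple : forall i, simple_ring (rq_comp i);
  rq_surj : forall b : (forall i, rq_comp i), exists a, forall i, rq_proj i a = b i;
  rq_ker : forall a, radical a <-> (forall i, rq_proj i a = 0)
}.

Section NaturalQuiver.
Variables (k : fieldType) (A : algType k) (D : radical_quotient A).
Local Notation r := (@radical A).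
Local Notation r2 := (idmul r r).

(* [rq_ideal i] is the preimage in A of the ideal A_i of A/r. For a subset X  *)
(* of r, [rq_gen i j X] is the preimage in r of the sub-A_i-A_j-bimodule      *)
(* A_i X A_j of r/r^2 spanned by the classes of the a x b; here a, b in A act *)
(* on r/r^2 through A/r. Thus [rq_gen i j r] represents A_i (r/r^2) A_j.      *)
Definition rq_ideal (i : 'I_(rq_size D)) : set A :=
  [set a | forall j, j != i -> rq_proj j a = 0].

Definition rq_gen (i j : 'I_(rq_size D)) (X : set A) : set A :=
  addspan (r2 `|` [set y | exists a x b,
    [/\ rq_ideal i a, X x, rq_ideal j b & y = a * x * b]]).

Definition rq_generated (i j : 'I_(rq_size D)) (n : nat) : Prop :=
  exists x : 'I_n -> A,
    (forall l, rq_gen i j r (x l)) /\ rq_gen i j r `<=` rq_gen i j (range x).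

Definition natural_arrow_number (t : 'I_(rq_size D) -> 'I_(rq_size D) -> nat) :=
  forall i j, rq_generated i j (t i j) /\
              (forall n, rq_generated i j n -> (t i j <= n)%N).

Definition natural_quiver (t : 'I_(rq_size D) -> 'I_(rq_size D) -> nat) : quiver :=
  Quiver (fun i j => 'I_(t i j)).

Definition natural_premodulation (t : 'I_(rq_size D) -> 'I_(rq_size D) -> nat) :
    premodulation k :=
  path_premodulation (Q := natural_quiver t) (@rq_comp k A D).

End NaturalQuiver.

Record category := Category {
  ob :> Type;
  hom : ob -> ob -> Type;
  idm : forall X, hom X X;
  comp : forall X Y Z, hom Y Z -> hom X Y -> hom X Z;
  comp_idl : forall X Y (f : hom X Y), comp (idm Y) f = f;
  comp_idr : forall X Y (f : hom X Y), comp f (idm X) = f;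
  comp_assoc : forall X Y Z T (h : hom Z T) (g : hom Y Z) (f : hom X Y),
    comp h (comp g f) = comp (comp h g) f
}.
Arguments idm {c} X.

Record functor (C D : category) := Functor {
  fob :> C -> D;
  fhom : forall X Y, hom X Y -> hom (fob X) (fob Y);
  fhom_id : forall X, fhom (idm X) = idm (fob X);
  fhom_comp : forall X Y Z (g : hom Y Z) (f : hom X Y),
    fhom (comp g f) = comp (fhom g) (fhom f)
}.

Definition idF (C : category) : functor C C :=
  @Functor C C (fun X => X) (fun X Y f => f) (fun=> erefl) (fun _ _ _ _ _ => erefl).

Lemma compF_id (C D E : category) (G : functor D E) (F : functor C D) X :
  fhom G (fhom F (idm X)) = idm (G (F X)).
Proof. by rewrite !fhom_id. Qed.

Lemma compF_comp (C D E : category) (G : functor D E) (F : functor C D)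
    X Y Z (g : hom Y Z) (f : hom X Y) :
  fhom G (fhom F (comp g f)) = comp (fhom G (fhom F g)) (fhom G (fhom F f)).
Proof. by rewrite !fhom_comp. Qed.

Definition compF (C D E : category) (G : functor D E) (F : functor C D) :
    functor C E :=
  @Functor C E (fun X => G (F X)) (fun X Y f => fhom G (fhom F f))
    (compF_id G F) (compF_comp G F).

Definition nat_isomorphic (C D : category) (F G : functor C D) : Prop :=
  exists (u : forall X, hom (F X) (G X)) (v : forall X, hom (G X) (F X)),
  [/\ forall X Y (f : hom X Y), comp (u Y) (fhom F f) = comp (fhom G f) (u X),
      forall X, comp (v X) (u X) = idm (F X)
    & forall X, comp (u X) (v X) = idm (G X)].

Definition equivalent (C D : category) : Prop :=
  exists (F : functor C D) (G : functor D C),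
    nat_isomorphic (compF G F) (idF C) /\ nat_isomorphic (compF F G) (idF D).

Definition full_subcategory (C : category) (P : C -> Prop) : category :=
  @Category {X : C | P X} (fun X Y => hom (sval X) (sval Y)) (fun X => idm (sval X))
    (fun X Y Z g f => comp g f) (fun X Y f => comp_idl f)
    (fun X Y f => comp_idr f) (fun X Y Z T h g f => comp_assoc h g f).

Definition finitely_generated (R : pzRingType) (V : lmodType R) : Prop :=
  exists (n : nat) (g : 'I_n -> V),
  forall v, exists c : 'I_n -> R, v = \sum_i c i *: g i.

Section ModuleCategory.
Variable R : pzRingType.

Lemma linear_ext (U V : lmodType R) (f g : {linear U -> V}) : f =1 g -> f = g.
Proof.
case: f g => [f [[fa] [fs]]] [g [[ga] [gs]]] /= /funext fg.
case: _ / fg in ga gs *.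
by congr GRing.Linear.Pack; congr GRing.Linear.Class; f_equal; apply: Prop_irrelevance.
Qed.

Lemma linear_idl (U V : lmodType R) (f : {linear U -> V}) :
  (idfun \o f : {linear U -> V}) = f.
Proof. exact: linear_ext. Qed.

Lemma linear_idr (U V : lmodType R) (f : {linear U -> V}) :
  (f \o idfun : {linear U -> V}) = f.
Proof. exact: linear_ext. Qed.

Lemma linear_assoc (U V W X : lmodType R)
    (h : {linear W -> X}) (g : {linear V -> W}) (f : {linear U -> V}) :
  (h \o (g \o f) : {linear U -> X}) = ((h \o g) \o f : {linear U -> X}).
Proof. exact: linear_ext. Qed.

Definition lmod_category : category :=
  @Category (lmodType R) (fun U V => {linear U -> V}) (fun U => idfun)
    (fun U V W g f => (g \o f)%FUN) linear_idl linear_idr linear_assoc.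

End ModuleCategory.

Definition ModCat (R : nzRingType) : category := lmod_category R^c.

Definition modCat (R : nzRingType) : category :=
  full_subcategory (C := ModCat R) (fun V : lmodType R^c => finitely_generated V).

Section Representations.
Variables (k : fieldType) (M : premodulation k).

Record representation := Representation {
  rep_mod :> forall i : M, lmodType (pm_alg i)^c;
  rep_map : forall i j, pm_edge i j ->
    {linear tensor (rep_mod i) (pm_bimod i j) -> rep_mod j}
}.

Definition rep_morphism (V U : representation)
    (alpha : forall i, {linear V i -> U i}) : Prop :=
  forall i j (e : pm_edge i j) (x : tensor (V i) (pm_bimod i j)),
  alpha j (rep_map V e x) = rep_map U e (tens_map (alpha i) x).

Definition rep_hom (V U : representation) :=
  {alpha : forall i, {linear V i -> U i} | rep_morphism alpha}.

Lemma rep_hom_ext (V U : representation) (f g : rep_hom V U) :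
  (forall i, sval f i =1 sval g i) -> f = g.
Proof.
case: f g => [f fP] [g gP] /= fg.
have {}fg : f = g.
  by apply: functional_extensionality_dep => i; apply: linear_ext; apply: fg.
by case: _ / fg in gP *; congr exist; apply: Prop_irrelevance.
Qed.

Lemma rep_id_subproof (V : representation) :
  rep_morphism (fun i => idfun : {linear V i -> V i}).
Proof.
move=> i j e x /=; congr (rep_map V e _); apply/esym.
elim/tensor_ind: x => [|x y IHx IHy|v m].
- by have := tens_mapB idfun (0 : tensor (V i) (pm_bimod i j)) 0; rewrite !subrr.
- by rewrite tens_mapB IHx IHy.
- by rewrite tens_mapE.
Qed.

Definition rep_id (V : representation) : rep_hom V V :=
  exist _ _ (@rep_id_subproof V).

Lemma rep_comp_subproof (V U W : representation)
    (g : rep_hom U W) (f : rep_hom V U) :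
  rep_morphism (fun i => (sval g i \o sval f i)%FUN : {linear V i -> W i}).
Proof.
move=> i j e x /=; rewrite (svalP f) (svalP g); congr (rep_map W e _).
elim/tensor_ind: x => [|x y IHx IHy|v m].
- have H (X Y : lmodType (pm_alg i)^c) (h : {linear X -> Y}) :
      tens_map h (0 : tensor X (pm_bimod i j)) = 0.
    by have := tens_mapB h (0 : tensor X (pm_bimod i j)) 0; rewrite !subrr.
  by rewrite !H.
- by rewrite !tens_mapB IHx IHy.
- by rewrite !tens_mapE.
Qed.

Definition rep_comp (V U W : representation) (g : rep_hom U W) (f : rep_hom V U) :
  rep_hom V W := exist _ _ (rep_comp_subproof g f).

Lemma rep_idl (V U : representation) (f : rep_hom V U) :
  rep_comp (rep_id U) f = f.
Proof. exact: rep_hom_ext. Qed.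

Lemma rep_idr (V U : representation) (f : rep_hom V U) :
  rep_comp f (rep_id V) = f.
Proof. exact: rep_hom_ext. Qed.

Lemma rep_assoc (V U W X : representation)
    (h : rep_hom W X) (g : rep_hom U W) (f : rep_hom V U) :
  rep_comp h (rep_comp g f) = rep_comp (rep_comp h g) f.
Proof. exact: rep_hom_ext. Qed.

Definition RepCat : category := Category rep_idl rep_idr rep_assoc.

Definition repCat : category :=
  full_subcategory (C := RepCat)
    (fun V : representation => forall i, finitely_generated (V i)).

End Representations.

(* Main.v *)
(* Let T = k(Q, B) and f : T -> A be the surjection with kernel I. Since A is *)
(* hereditary, r = J/I is projective, so M (x) A -> J/I, m (x) a |-> m a, is a *)
(* split surjection; its kernel lies in (M (x) A)r because I is in J^2, hence *)
(* vanishes as r is nilpotent. Comparing degrees, M (x) A = J/I forces I = 0, *)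
(* and A is isomorphic to T.                                                  *)
(*                                                                            *)
(* The radical of A is then f(J), so that A/r = B_0 identifies the vertices   *)
(* and algebras of Q with those of the natural quiver, and r/r^2 = M          *)
(* identifies the arrows: a free bimodule of rank n needs n generators, by    *)
(* counting dimensions over k.                                                *)
(*                                                                            *)
(* Finally, a representation V of the pre-modulation is the same thing as an  *)
(* action of the tensor algebra on the direct sum of the V_i. The functor     *)
(* V |-> V_1 + ... + V_s is fully faithful because A is generated by the A_i  *)
(* and the arrows, and an A-module W comes from the representation (W e_i).   *)
(* Finite generation passes through, as A is finite-dimensional over k.       *)

Require Import Defs.
From HB Require Import structures.
From mathcomp Require Import all_boot ssralg vector falgebra zmodp matrix mxalgebra.
From mathcomp Require Import boolp classical_sets.

Set Implicit Arguments.
Unset Strict Implicit.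
Unset Printing Implicit Defensive.

Import GRing.Theory.
Local Open Scope ring_scope.

(** Write T = k(Q, B), M for its arrow bimodule, J for its positive part and f : T -> A for the
    given surjection, whose kernel I contains J^s and lies in J^2. Three facts carry the proof.

    Heredity forces I = 0 ([hereditary_quotient_inj]). The right ideal f(J) is projective, so the
    multiplication [tpos_mul] from M (x) A onto f(J) splits. As I lies in J^2, its kernel K lies in
    (M (x) A)f(J), and the splitting improves this to K = K f(J); since f(J) is nilpotent, K = 0. An
    element of I with a component in the least possible degree would then yield a nonzero element of
    K.

    Q is the natural quiver of A. Now f is an isomorphism, the radical is f(J) ([radicalE]), and
    simplicity matches the B_p with the A_j one to one ([vertex_of], [theta]). The bimodule r/r^2 is
    M, whose block at (i, j) is free on the arrows from i to j; a dimension count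
    ([free_bimod_rank]) shows that it needs as many generators as there are arrows
    ([natural_arrowE]).

    Representations are modules over T ([presented_equivalent]). By the universal property of the
    tensor algebra, a representation V makes the sum of the V_i a T-module ([talg_act]). This
    functor is fully faithful because vertices and arrows generate A, and an A-module W comes from
    its corners W e_i. Finite generation passes to the corners because A is finite-dimensional
    ([finite_span_all]). *)

Lemma subrACA (G : zmodType) (x y z t : G) : x - y - (z - t) = x - z - (y - t).
Proof. by rewrite !opprB [X in _ + X = _]addrC addrACA (addrC (- y)). Qed.

(** * Additive subgroups, spans and tensors *)

Section Subgroups.
Variables (G : zmodType) (S : set G).
Hypothesis S_subgroup : subgroup S.

Lemma subgroup0 : S 0. Proof. exact: S_subgroup.1. Qed.

Lemma subgroupB x y : S x -> S y -> S (x - y).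
Proof. exact: S_subgroup.2. Qed.

Lemma subgroupN x : S x -> S (- x).
Proof. by move=> Sx; rewrite -sub0r; apply: subgroupB => //; apply: subgroup0. Qed.

Lemma subgroupD x y : S x -> S y -> S (x + y).
Proof. by move=> Sx Sy; rewrite -[y]opprK; apply/subgroupB/subgroupN. Qed.

Lemma subgroup_sum (I : Type) (s : seq I) (P : pred I) (F : I -> G) :
  (forall i, P i -> S (F i)) -> S (\sum_(i <- s | P i) F i).
Proof.
by move=> SF; apply: (big_ind S) => //; [exact: subgroup0|exact: subgroupD].
Qed.

End Subgroups.

Lemma addspan_sub (G : zmodType) (P S : set G) :
  subgroup S -> (forall x, P x -> S x) -> forall x, addspan P x -> S x.
Proof. by move=> Sg PS x Px; apply: Px. Qed.

Lemma addspan_mono (G : zmodType) (P P' : set G) :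
  (forall x, P x -> addspan P' x) -> forall x, addspan P x -> addspan P' x.
Proof. by move=> PP; apply: addspan_sub => //; apply: addspan_subgroup. Qed.

Lemma additive_subgroup (G H : zmodType) (f : G -> H) (S : set H) :
  {morph f : x y / x - y} -> subgroup S -> subgroup (fun x => S (f x)).
Proof.
move=> fB Sg; split=> [|x y]; last by rewrite fB; apply: subgroupB.
suff -> : f 0 = 0 by apply: subgroup0.
by have := fB 0 0; rewrite !subrr.
Qed.

Section TensorTheory.
Variables (k : fieldType) (R S : algType k) (V : lmodType R^c) (M : bimod R S).

Lemma tensBl (v w : V) (m : M) : tens (v - w) m = tens v m - tens w m.
Proof. by apply: (addIr (tens w m)); rewrite -tensDl !subrK. Qed.

Lemma tensBr (v : V) (m n : M) : tens v (m - n) = tens v m - tens v n.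
Proof. by apply: (addIr (tens v n)); rewrite -tensDr !subrK. Qed.

Lemma tens_0l (m : M) : tens (0 : V) m = 0.
Proof. by have := tensBl 0 0 m; rewrite !subrr. Qed.

End TensorTheory.

(** * Degrees in the tensor algebra *)

Section TensorAlgebraTheory.
Variables (k : fieldType) (R : algType k) (M : bimod R R).
Local Notation T := (talg M).
Implicit Types (x y : T) (r : R) (m : M).

(** The inclusions of R and M in T. Encoding the second one as a shift of 1 makes right
    multiplication by [tin1 m] equal to [tshift m]. *)
Definition tin0 r : T := tinj (r : tpow M 0).
Definition tin1 m : T := tshift m 1.

Lemma mul_tin0 x r : x * tin0 r = talg_ract (r : R^c) x.
Proof. exact: tmul_inj. Qed.

Lemma mul_tin1 x m : x * tin1 m = tshift m x.
Proof. by rewrite -[LHS]/(tmul x (tshift m 1)) tmul_shift -[tmul x 1]/(x * 1) mulr1. Qed.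

Lemma tin0_1 : tin0 1 = 1. Proof. by []. Qed.

Lemma tin0B : {morph tin0 : r s / r - s}.
Proof.
move=> r s; rewrite -[LHS]mul1r -[tin0 r]mul1r -[tin0 s]mul1r !mul_tin0.
by apply: talgP => n; rewrite tvalBE /= -scalerBl.
Qed.

Lemma tin0D : {morph tin0 : r s / r + s}.
Proof. by move=> r s; apply: (addIr (- tin0 s)); rewrite -tin0B !addrK. Qed.

Lemma tin0_0 : tin0 0 = 0.
Proof. by have := tin0B 0 0; rewrite !subrr. Qed.

Lemma tin0M : {morph tin0 : r s / r * s}.
Proof.
move=> r s; rewrite -[LHS]mul1r -[tin0 r]mul1r !mul_tin0 talg_ractA.
by [].
Qed.

Lemma tin0Z c : {morph tin0 : r / c *: r}.
Proof.
have c1 : tin0 c%:A = c *: 1 by rewrite -[tin0 _]mul1r mul_tin0.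
by move=> r; rewrite -[r in LHS]mul1r scalerAl tin0M c1 -scalerAl mul1r.
Qed.

Lemma tin1B : {morph tin1 : m m' / m - m'}.
Proof.
move=> m m'; apply: (addIr (tin1 m')).
by rewrite /tin1 subrK -tshiftDl subrK.
Qed.

Lemma tin1D : {morph tin1 : m m' / m + m'}.
Proof. by move=> m m'; apply: (addIr (- tin1 m')); rewrite -tin1B !addrK. Qed.

Lemma tin1_0 : tin1 0 = 0.
Proof. by have := tin1B 0 0; rewrite !subrr. Qed.

Lemma tin0_tin1 r m : tin0 r * tin1 m = tin1 (lact r m).
Proof. by rewrite mul_tin1 -[tin0 r]mul1r mul_tin0 tshift_ract. Qed.

Lemma tin1_tin0 m r : tin1 m * tin0 r = tin1 ((r : R^c) *: m).
Proof. by rewrite mul_tin0 ract_tshift. Qed.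

Lemma tinj_tens n (y : tpow M n) m :
  tinj (tens y m : tpow M n.+1) = tinj y * tin1 m.
Proof. by rewrite mul_tin1 -tract_one tract_tens tract_one. Qed.

Lemma tinjB n (y z : tpow M n) : tinj (y - z) = tinj y - tinj z.
Proof. by rewrite -!tract_one tractBl. Qed.

(** By [tinj_tens], a pure tensor of degree n+1 is one of degree n times an element of M, so right
    multiplication by M reaches every degree from R. *)
Lemma talg_ind (S : set T) : subgroup S -> (forall r, S (tin0 r)) ->
  (forall x m, S x -> S (x * tin1 m)) -> forall x, S x.
Proof.
move=> Sg S0 S1 x; rewrite [x]tinj_sum; apply: subgroup_sum => // i _.
elim: {i}(nat_of_ord i) (x i) => [|n IH] y; first exact: S0.
elim/tensor_ind: y => [|y z Sy Sz|v m].
- rewrite (_ : tinj _ = 0); first exact: subgroup0.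
  by have := tinjB (0 : tpow M n.+1) 0; rewrite !subrr.
- by rewrite tinjB; apply: subgroupB.
- by rewrite tinj_tens; apply: S1.
Qed.

(** The filtration of T by degree, a componentwise substitute for the powers of J; [tlow 1] is J. *)
Definition tlow d : set T := [set x | forall q, (q < d)%N -> x q = 0].

Lemma tlow_subgroup d : subgroup (tlow d).
Proof. by split=> // x y xd yd q lt_q; rewrite tvalBE xd ?yd ?subrr. Qed.

Lemma tlow_tract d n (y : tpow M n) x : tlow d x -> tlow (d + n) (tract y x).
Proof.
move=> xd; elim: n y => [|n IH] y.
  by rewrite addn0 => q lt_q; rewrite /= xd ?scaler0.
elim/tensor_ind: y => [|y z IHy IHz|v m].
- by rewrite tract0l.
- by rewrite tractBl; apply: subgroupB (tlow_subgroup _) _ _ _ _.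
- by rewrite tract_tens addnS => -[|q] //= lt_q; rewrite IH // tens0l.
Qed.

Lemma tlowM d e x y : tlow d x -> tlow e y -> tlow (d + e) (x * y).
Proof.
move=> xd ye; apply: subgroup_sum => [|n _]; first exact: tlow_subgroup.
have [lt_n|le_n] := ltnP n e; first by rewrite ye ?tract0l.
move=> q lt_q; apply: (tlow_tract _ xd); apply: leq_trans lt_q _.
by rewrite leq_add2l.
Qed.

Lemma tlow1P x : tlow 1 x <-> tpos x.
Proof. by split=> [|x0 [|]//]; apply. Qed.

Lemma tlow_tin1 m : tlow 1 (tin1 m).
Proof. by case. Qed.

Lemma tlow_le d e x : (e <= d)%N -> tlow d x -> tlow e x.
Proof. by move=> le_e xd q lt_q; apply: xd; apply: leq_trans le_e. Qed.

Lemma idexp_tpos_tlow n x : idexp (@tpos _ _ M) n x -> tlow n x.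
Proof.
elim: n x => [//|n IH] x; apply: addspan_sub; first exact: tlow_subgroup.
move=> _ [u [v [un v1 ->]]]; rewrite -addn1; apply: tlowM; first exact: IH.
exact/tlow1P.
Qed.

Lemma tinj_idexp n (y : tpow M n) : idexp (@tpos _ _ M) n (tinj y).
Proof.
elim: n y => [//|n IH] y; have Sg : subgroup (idexp (@tpos _ _ M) n.+1).
  exact: addspan_subgroup.
elim/tensor_ind: y => [|y z Sy Sz|y m].
- have -> : tinj (0 : tpow M n.+1) = 0.
    by have := tinjB (0 : tpow M n.+1) 0; rewrite !subrr.
  exact: subgroup0.
- by rewrite tinjB; apply: (subgroupB Sg).
- rewrite tinj_tens; apply: addspan_incl; exists (tinj y), (tin1 m).
  by split=> //; apply: IH.
Qed.

Lemma tlow1_ind (S : set T) : subgroup S -> (forall x m, S (x * tin1 m)) ->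
  forall x, tlow 1 x -> S x.
Proof.
move=> Sg S1 x x1; suff : S (x - tin0 (x 0%N)).
  by rewrite x1 // tin0_0 subr0.
apply: (talg_ind (S := fun x => S (x - tin0 (x 0%N)))) => [||{x1}z m _].
- apply: (additive_subgroup _ Sg) => {x1}y z.
  by rewrite tvalBE tin0B subrACA.
- by move=> r; rewrite /tin0 tinjE subrr; apply: subgroup0.
- rewrite (_ : (z * tin1 m) 0%N = 0) ?mul_tin1 //.
  by rewrite tin0_0 subr0 -mul_tin1.
Qed.

(** J = TM is also MT: the span [L] of MT contains every r m with r in R, and it is stable under
    right multiplication by M. The form MT is the one that presents J as a right module. *)
Lemma tlow1_left_ind (S : set T) : subgroup S -> (forall m x, S (tin1 m * x)) ->
  forall x, tlow 1 x -> S x.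
Proof.
move=> Sg S1 x x1.
pose L := addspan (fun y => exists m z, y = tin1 m * z).
have Lg : subgroup L by apply: addspan_subgroup.
suff : L x by move: x {x1}; apply: addspan_sub => // _ [m [z ->]].
apply: (tlow1_ind Lg _ x1) => {x x1}x m; move: m.
apply: (talg_ind (S := fun x => forall m, L (x * tin1 m))) => [|r m|{}x m Lx m'].
- split=> [m|y z yS zS m]; first by rewrite mul0r; apply: subgroup0.
  by rewrite mulrBl; apply: (subgroupB Lg).
- by apply: addspan_incl; exists (lact r m), 1; rewrite tin0_tin1 mulr1.
- move: (x * tin1 m) (Lx m); apply: addspan_sub => [|_ [m'' [z ->]]].
    by apply: additive_subgroup Lg => y z; rewrite mulrBl.
  by apply: addspan_incl; exists m'', (z * tin1 m'); rewrite mulrA.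
Qed.

(* The component of degree 1, read in M through R (x) M = M.                   *)
Definition tdeg1 x : M := tens_lift (fun (r : (R^c)^o) m => lact (r : R) m) (x 1%N).

Lemma tdeg1B : {morph tdeg1 : x y / x - y}.
Proof.
move=> x y; apply: tens_liftB => [r s m|r m m'|r a m]; first exact: lactDl.
- exact: lactDr.
- by rewrite lactA.
Qed.

Lemma tdeg1D : {morph tdeg1 : x y / x + y}.
Proof. by move=> x y; apply: (addIr (- tdeg1 y)); rewrite -tdeg1B !addrK. Qed.

Lemma tdeg1_tin1 m : tdeg1 (tin1 m) = m.
Proof.
have e : tin1 m 1%N = tens (1 : tpow M 0) m :> tpow M 1.
  by rewrite -[LHS]/(tens (tinj (1 : tpow M 0) 0%N) m) tinjE.
rewrite /tdeg1 e -[RHS]lact1; apply: tens_liftE => [r s m1|r m1 m'|r a m1].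
- exact: lactDl.
- exact: lactDr.
- by rewrite lactA.
Qed.

Lemma tlow1_sub_deg0 x : tlow 1 (x - tin0 (x 0%N)).
Proof. by case=> [_|//]; rewrite tvalBE /tin0 tinjE subrr. Qed.

Lemma tdeg1_tlow2 x : tlow 2 x -> tdeg1 x = 0.
Proof.
move=> x2; rewrite /tdeg1 x2 // ; apply: tens_lift0 => [r s m|r m m'|r a m].
- exact: lactDl.
- exact: lactDr.
- by rewrite lactA.
Qed.

Definition tpos2 : set T :=
  addspan (fun z => exists x y, [/\ tlow 1 x, tlow 1 y & z = x * y]).

Lemma tpos2_tlow2 x : tpos2 x -> tlow 2 x.
Proof.
move: x; apply: addspan_sub => [|_ [x [y [x1 y1 ->]]]]; first exact: tlow_subgroup.
exact: tlowM x1 y1.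
Qed.

(** J = M + J^2: in m x, replacing x by its component of degree 0 changes the product by an element
    of MJ. *)
Lemma tlow1_sub_deg1 x : tlow 1 x -> tpos2 (x - tin1 (tdeg1 x)).
Proof.
have Sg : subgroup tpos2 by apply: addspan_subgroup.
move: x; apply: tlow1_left_ind => [|m x].
  by apply: (additive_subgroup _ Sg) => x y; rewrite tdeg1B tin1B subrACA.
pose x' := x - tin0 (x 0%N); have x'P : tpos2 (tin1 m * x').
  apply: addspan_incl; exists (tin1 m), x'; split=> //; first exact: tlow_tin1.
  exact: tlow1_sub_deg0.
have -> : tin1 m * x = tin1 m * x' + tin1 ((x 0%N : R^c) *: m).
  by rewrite -tin1_tin0 -mulrDr subrK.
by rewrite tdeg1D tdeg1_tin1 (tdeg1_tlow2 (tpos2_tlow2 x'P)) add0r addrK.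
Qed.

(** This is J/J^2 = M as a bimodule over T/J = R: in degree 1 only the lowest components of the
    three factors count. *)
Lemma tdeg1_mul x y z : tlow 1 y ->
  tdeg1 (x * y * z) = lact (x 0%N : R) ((z 0%N : R^c) *: tdeg1 y).
Proof.
move=> y1; pose m := tdeg1 y; pose r : R := x 0%N; pose s : R := z 0%N.
have d : tdeg1 (x * y * z - tin0 r * tin1 m * tin0 s) = 0.
  (* Telescoping: each of the three terms contains one factor replaced by its higher-degree part,
     hence has degree at least 2. *)
  rewrite (_ : _ - _ = (x - tin0 r) * y * z + tin0 r * (y - tin1 m) * z
                       + tin0 r * tin1 m * (z - tin0 s)); last first.
    have -> : (x - tin0 r) * y * z = x * y * z - tin0 r * y * z.
      by rewrite !mulrBl.
    have -> : tin0 r * (y - tin1 m) * z = tin0 r * y * z - tin0 r * tin1 m * z.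
      by rewrite mulrBr mulrBl.
    by rewrite mulrBr !addrA !subrK.
  have low0 w : tlow 0 w by [].
  have x1 := tlow1_sub_deg0 x; have z1 := tlow1_sub_deg0 z.
  have y2 := tpos2_tlow2 (tlow1_sub_deg1 y1).
  have mz := tlowM (tlowM (low0 (tin0 r)) (tlow_tin1 m)) z1.
  apply: tdeg1_tlow2; apply: (subgroupD (tlow_subgroup _)) mz.
  apply: (subgroupD (tlow_subgroup _)); first exact: tlowM (tlowM x1 y1) (low0 z).
  exact: tlowM (tlowM (low0 _) y2) (low0 z).
move/eqP: d; rewrite tdeg1B subr_eq0 => /eqP ->.
by rewrite -mulrA tin1_tin0 tin0_tin1 tdeg1_tin1.
Qed.

End TensorAlgebraTheory.

(** * Admissible quotients that are hereditary *)

Section PositivePartProjective.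
Variables (k : fieldType) (R : algType k) (M : bimod R R) (A : algType k).
Variable f : {lrmorphism talg M -> A}.
Hypothesis f_surj : forall a, exists x, f x = a.

Let fD x y : f (x + y) = f x + f y. Proof. exact: rmorphD. Qed.
Let fB x y : f (x - y) = f x - f y. Proof. exact: rmorphB. Qed.
Let fM x y : f (x * y) = f x * f y. Proof. exact: rmorphM. Qed.

Definition tpos_image : {pred (A^c)^o} :=
  fun a => `[< exists2 x, tlow 1 x & f x = a >].

Lemma tpos_imageP a : reflect (exists2 x, tlow 1 x & f x = a) (a \in tpos_image).
Proof. exact: asboolP. Qed.

Lemma tpos_image_submod_closed : submod_closed tpos_image.
Proof.
split=> [|c a b /tpos_imageP[x x1 <-] /tpos_imageP[y y1 <-]].
  by apply/tpos_imageP; exists 0; rewrite ?rmorph0.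
have [z zc] := f_surj c; apply/tpos_imageP; exists (x * z + y).
  apply: (subgroupD (tlow_subgroup _ _)) => //.
  by rewrite -[1%N]addn0; apply: tlowM.
by rewrite rmorphD rmorphM -zc.
Qed.

HB.instance Definition _ :=
  GRing.isSubmodClosed.Build A^c (A^c)^o tpos_image tpos_image_submod_closed.

(** f(J) as a right A-module of its own, so that [hereditary] applies to its embedding in A. *)
Record tpos_ideal := TposIdeal { tpos_val : (A^c)^o; _ : tpos_val \in tpos_image }.
HB.instance Definition _ := [isSub for tpos_val].
HB.instance Definition _ := [Choice of tpos_ideal by <:].
HB.instance Definition _ := [SubChoice_isSubLmodule of tpos_ideal by <:].

(** R acts on A from the left through f; with this R-A-bimodule structure, M (x) A is a module that
    covers f(J). *)
Definition alg_lact (r : R) (a : (A^c)^o) : (A^c)^o := f (tin0 M r) * (a : A).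

Lemma alg_lactDl r s a : alg_lact (r + s) a = alg_lact r a + alg_lact s a.
Proof.
rewrite /alg_lact; suff -> : tin0 M (r + s) = tin0 M r + tin0 M s.
  by rewrite rmorphD mulrDl.
by apply: (addIr (- tin0 M s)); rewrite -tin0B !addrK.
Qed.

Lemma alg_lactDr r a b : alg_lact r (a + b) = alg_lact r a + alg_lact r b.
Proof. exact: (@mulrDr A _ (a : A) (b : A)). Qed.

Lemma alg_lactA r s a : alg_lact r (alg_lact s a) = alg_lact (r * s) a.
Proof. by rewrite /alg_lact tin0M rmorphM mulrA. Qed.

Lemma alg_lact1 a : alg_lact 1 a = a.
Proof. by rewrite /alg_lact tin0_1 rmorph1 mul1r. Qed.

Lemma alg_lact_ract r (c : A^c) a : alg_lact r (c *: a) = c *: alg_lact r a.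
Proof. exact: (@mulrA A _ (a : A) (c : A)). Qed.

Lemma alg_lact_central (c : k) a : alg_lact c%:A a = ((c%:A : A) : A^c) *: a.
Proof.
rewrite /alg_lact tin0Z tin0_1 linearZ rmorph1 -[RHS]/((a : A) * c%:A).
by rewrite -scalerAl mul1r -scalerAr mulr1.
Qed.

Definition alg_bimod : bimod R A :=
  Bimod alg_lactDl alg_lactDr alg_lactA alg_lact1 alg_lact_ract alg_lact_central.

Local Notation X := (tensor (M : lmodType R^c) alg_bimod).
Local Notation mtens := (@tens k R A M alg_bimod).

Lemma tpos_mul_subproof (m : M) (a : A) : f (tin1 m) * a \in tpos_image.
Proof.
have [y ya] := f_surj a; apply/tpos_imageP; exists (tin1 m * y).
  by rewrite -[1%N]addn0; apply: tlowM => //; apply: tlow_tin1.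
by rewrite -ya rmorphM.
Qed.

Definition tpos_mul_elt (m : M) (a : alg_bimod) : tpos_ideal :=
  TposIdeal (tpos_mul_subproof m a).

Lemma tpos_mul_eltDl m m' a :
  tpos_mul_elt (m + m') a = tpos_mul_elt m a + tpos_mul_elt m' a.
Proof. by apply: val_inj; rewrite /= /tin1 tshiftDl rmorphD mulrDl. Qed.

Lemma tpos_mul_eltDr m a b :
  tpos_mul_elt m (a + b) = tpos_mul_elt m a + tpos_mul_elt m b.
Proof. by apply: val_inj; apply: (@mulrDr A _ (a : A) (b : A)). Qed.

Lemma tpos_mul_eltA m (r : R) a :
  tpos_mul_elt ((r : R^c) *: m) a = tpos_mul_elt m (lact r a).
Proof.
apply: val_inj; rewrite /= -tin1_tin0 rmorphM.
exact: esym (@mulrA A _ _ (a : A)).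
Qed.

Definition tpos_mul : X -> tpos_ideal := tens_lift tpos_mul_elt.

Lemma tpos_mul_tens m a : tpos_val (tpos_mul (tens m a)) = f (tin1 m) * (a : A).
Proof.
rewrite /tpos_mul tens_liftE //; first exact: tpos_mul_eltDl.
- exact: tpos_mul_eltDr.
- exact: tpos_mul_eltA.
Qed.

Lemma tpos_mulB : {morph tpos_mul : x y / x - y}.
Proof.
apply: tens_liftB; first exact: tpos_mul_eltDl.
- exact: tpos_mul_eltDr.
- exact: tpos_mul_eltA.
Qed.

Lemma tpos_mulZ : scalable tpos_mul.
Proof.
have t0 : tpos_mul 0 = 0 by have := tpos_mulB 0 0; rewrite !subrr.
move=> c; elim/tensor_ind => [|x y IHx IHy|m a]; first by rewrite t0 !scaler0 t0.
- by rewrite scalerBr !tpos_mulB IHx IHy scalerBr.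
- rewrite (_ : c *: tens m a = tens m (c *: a)); last exact: tens_scaleE.
  apply: val_inj; rewrite -[LHS]/(tpos_val _).
  rewrite -[RHS]/(c *: tpos_val (tpos_mul (tens m a))) !tpos_mul_tens.
  exact: (@mulrA A _ (a : A) (c : A)).
Qed.

HB.instance Definition _ :=
  GRing.isZmodMorphism.Build X tpos_ideal tpos_mul tpos_mulB.
HB.instance Definition _ :=
  GRing.isScalable.Build A^c X tpos_ideal *:%R tpos_mul tpos_mulZ.

(** f(J) = f(MT) = f(M)A, by [tlow1_left_ind]. *)
Lemma tpos_mul_surj p : exists x, tpos_mul x = p.
Proof.
have im_subgroup : subgroup (fun a : A => exists x, tpos_val (tpos_mul x) = a).
  split=> [|_ _ [x <-] [y <-]]; first by exists 0; rewrite !linear0.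
  by exists (x - y); rewrite !linearB.
case: p => a a_im; suff [x xa] : exists x, tpos_val (tpos_mul x) = a.
  by exists x; apply: val_inj.
move: a_im => /tpos_imageP[y y1 <-].
apply: (tlow1_left_ind (additive_subgroup _ im_subgroup)) y1 => [? ?|m z].
  by rewrite rmorphB.
by exists (mtens m (f z)); rewrite tpos_mul_tens rmorphM.
Qed.

(** The submodule (M (x) A)r, with f(J) in the role of r. *)
Definition tpos_span : set X :=
  addspan (fun y => exists z a, y = (a : A^c) *: z /\ a \in tpos_image).

(* M (x) A / (M (x) A)r = M (x) A/r = M, as A/r = T/J = R.                    *)
Lemma tens_decomp (x : X) : exists m, tpos_span (x - mtens m (1 : A)).
Proof.
have Sg : subgroup tpos_span by apply: addspan_subgroup.
elim/tensor_ind: x => [|x y [m xm] [m' ym']|m a].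
- by exists 0; rewrite tens_0l subr0; apply: subgroup0.
- exists (m - m'); rewrite tensBl; move: (subgroupB Sg xm ym').
  by rewrite subrACA.
have [y ya] := f_surj a; pose y0 : R := y 0%N.
exists ((y0 : R^c) *: m); rewrite tensA; apply: addspan_incl.
exists (mtens m (1 : A)), (f (y - tin0 M y0)); split; last first.
  apply/tpos_imageP; exists (y - tin0 M y0) => // -[|//] _.
  by rewrite tvalBE /tin0 tinjE subrr.
rewrite [RHS]tens_scaleE -tensBr; congr tens.
rewrite -[RHS]/((1 : A) * f (y - tin0 M y0)) mul1r.
rewrite -[LHS]/(a - f (tin0 M y0) * (1 : A)) mulr1 -ya.
by rewrite rmorphB.
Qed.

Hypothesis f_low : forall x, f x = 0 -> tlow 2 x.
Hypothesis f_nil : exists s, forall x, idexp (@tpos _ _ M) s x -> f x = 0.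
Hypothesis A_hereditary : hereditary A.

(** Multiplication sends M (x) A into f(J), hence (M (x) A)f(J) into f(J)f(J), which is represented
    in degrees at least 2. *)
Lemma tpos_span_tlow2 x : tpos_span x ->
  exists2 w, tlow 2 w & f w = tpos_val (tpos_mul x).
Proof.
move: x; apply: addspan_sub => [|_ [z [a [-> /tpos_imageP[w w1 <-]]]]].
  split=> [|x y [w w2 wE] [v v2 vE]].
    by exists 0; rewrite ?linear0 ?rmorph0.
  exists (w - v); first exact: (subgroupB (tlow_subgroup _ _) w2 v2).
  by rewrite tpos_mulB -[RHS]/(tpos_val _ - tpos_val _) -wE -vE; apply: rmorphB.
case E: (tpos_mul z) => [b b_im]; have /tpos_imageP[v v1 vE] := b_im.
exists (v * w); first exact: tlowM v1 w1.
rewrite tpos_mulZ -[RHS]/((tpos_val (tpos_mul z) : A) * f w) E /= -vE.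
exact: rmorphM.
Qed.

(** By [tens_decomp], x is m (x) 1 modulo (M (x) A)f(J). If x maps to 0, then f(m) is also the image
    of an element of degree at least 2; as ker f lives in degrees at least 2, so does m, which
    forces m = 0. *)
Lemma tpos_mul_kernel x : tpos_mul x = 0 -> tpos_span x.
Proof.
move=> x0; have [m xm] := tens_decomp x.
suff m0 : m = 0 by move: xm; rewrite m0 tens_0l subr0.
have [w w2 wE] := tpos_span_tlow2 xm.
have mw : f (w - tin1 (- m)) = 0.
  rewrite rmorphB; apply/eqP; rewrite subr_eq0; apply/eqP.
  rewrite -[LHS]/(f w) wE tpos_mulB x0 sub0r.
  rewrite -[LHS]/(- tpos_val (tpos_mul (mtens m (1 : A)))) tpos_mul_tens mulr1.
  rewrite -[LHS]/(- f (tin1 m)) -[RHS]/(f (tin1 (- m))) -[- m]sub0r tin1B.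
  by rewrite -(subrr m) tin1B subrr sub0r; apply: esym; apply: rmorphN.
apply: oppr_inj; rewrite oppr0 -(tdeg1_tin1 (- m)).
by rewrite -[tin1 _](subKr w) tdeg1B !tdeg1_tlow2 ?subrr //; apply: f_low.
Qed.

Let K : set X := [set x | tpos_mul x = 0].

(* J/I is projective, so that the kernel K of M (x) A -> J/I is a direct      *)
(* summand; since it lies in (M (x) A)r, it satisfies K = Kr.                 *)
Lemma tpos_mul_kernel_rad x : K x ->
  addspan (fun y => exists w z, [/\ tlow 1 w, K z & y = (f w : A^c) *: z]) x.
Proof.
move=> Kx; have val_inj' : injective (\val : {linear tpos_ideal -> (A^c)^o}).
  exact: val_inj.
(* Lifting the identity of f(J) through [tpos_mul] gives a section h; [rho] is the projection onto K
   along h. *)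
have [h hK] := A_hereditary val_inj' (g := tpos_mul) idfun tpos_mul_surj.
pose rho y : X := y - h (tpos_mul y).
have rhoB : {morph rho : y z / y - z}.
  by move=> y z; rewrite /rho tpos_mulB linearB subrACA.
have rhoZ (c : A^c) y : rho (c *: y) = c *: rho y.
  by rewrite /rho tpos_mulZ linearZ scalerBr.
have rhoK y : K (rho y) by rewrite /K /= /rho tpos_mulB hK subrr.
(* On K the map [rho] is the identity. Applied to an expression of x as a sum of z a with a in f(J),
   it moves every z into K. *)
rewrite -[x]subr0 -[0](linear0 h) -[in h _]Kx -/(rho x).
move: x Kx (tpos_mul_kernel Kx) => x _; move: x.
apply: addspan_sub => [|_ [z [a [-> /tpos_imageP[w w1 <-]]]]].
  exact/additive_subgroup/addspan_subgroup.
by apply: addspan_incl; exists w, (rho z); split; rewrite ?rhoZ.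
Qed.

(** Iterates K = Kr up to a power of J that f kills. *)
Lemma tpos_mul_kernel_radX n x : K x ->
  addspan (fun y => exists w z,
    [/\ idexp (@tpos _ _ M) n w, K z & y = (f w : A^c) *: z]) x.
Proof.
elim: n x => [|n IH] x Kx.
  by apply: addspan_incl; exists 1, x; split=> //; rewrite rmorph1 scale1r.
move: x {Kx}(tpos_mul_kernel_rad Kx); apply: addspan_mono => _ [w [z [w1 Kz ->]]].
move: z {Kz}(IH z Kz); apply: addspan_sub => [|_ [v [z [vn Kz ->]]]].
  by apply: additive_subgroup (addspan_subgroup _) => y z; rewrite scalerBr.
apply: addspan_incl; exists (v * w), z; split=> //.
  by apply: addspan_incl; exists v, w; split=> //; apply/tlow1P.
by rewrite scalerA rmorphM.
Qed.

Lemma tpos_mul_inj : injective tpos_mul.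
Proof.
suff K0 x : K x -> x = 0.
  move=> x y xy; apply/eqP; rewrite -subr_eq0; apply/eqP/K0.
  by rewrite /K /= tpos_mulB xy subrr.
have [s s0] := f_nil; move=> /(@tpos_mul_kernel_radX s); move: x.
apply: addspan_sub => [|_ [w [z [/s0 w0 _ ->]]]]; last by rewrite w0 scale0r.
by split=> // x y -> ->; rewrite subrr.
Qed.

(* If I has no component of degree < n, then m (x) f(y) |-> (m y)_n is well   *)
(* defined on M (x) A, and M (x) A = J/I gives I_n = 0.                        *)
Lemma hereditary_quotient_inj x : f x = 0 -> x = 0.
Proof.
have [y yE] : {y : A -> talg M | forall a, f (y a) = a}.
  exists (fun a => sval (cid (f_surj a))) => a; exact: svalP (cid (f_surj a)).
suff low n z : f z = 0 -> tlow n z.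
  by move=> x0; apply: talgP => n; apply: (low n.+1 x x0).
elim: n z => [//|n IH] z z0.
(* The ambiguity u - v lies in I, hence in degrees at least n by [IH], and multiplication by m
   pushes it past degree n. *)
have cong m u v : f u = f v -> (tin1 m * u) n = (tin1 m * v) n.
  move=> uv; apply/eqP; rewrite -subr_eq0 -tvalBE -mulrBr; apply/eqP.
  apply: (tlowM (tlow_tin1 m) (IH (u - v) _)) => //.
  by rewrite fB uv subrr.
pose F m (a : alg_bimod) : tpow M n := (tin1 m * y a) n.
have FDl m m' a : F (m + m') a = F m a + F m' a.
  by rewrite /F /tin1 tshiftDl mulrDl.
have FDr m a b : F m (a + b) = F m a + F m b.
  by rewrite -tvalDE -mulrDr; apply: cong; rewrite fD !yE.
have FA m (r : R) a : F ((r : R^c) *: m) a = F m (lact r a).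
  by rewrite /F -tin1_tin0 -mulrA; apply: cong; rewrite fM !yE.
(* As z lies in J = MT, f z lifts to some t in M (x) A from which [F] recovers the component of z in
   degree n. But f z = 0 and [tpos_mul] is injective, so t = 0. *)
have [t tz tn] : exists2 t, tpos_val (tpos_mul t) = f z & tens_lift F t = z n.
  apply: (tlow1_left_ind (S := fun z => exists2 t,
    tpos_val (tpos_mul t) = f z & tens_lift F t = z n)) => [|m u|].
  - split=> [|u u' [t tz tn] [t' tz' tn']].
      by exists 0; rewrite ?linear0 //; apply: tens_lift0.
    exists (t - t'); last by rewrite tens_liftB // tn tn'.
    by rewrite tpos_mulB fB -tz -tz'.
  - exists (mtens m (f u)); last by rewrite tens_liftE //; apply: cong.
    by rewrite tpos_mul_tens fM.
  - exact: tlow_le (f_low z0).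
have t0 : t = 0.
  by apply: tpos_mul_inj; apply: val_inj; rewrite linear0 -[LHS]/(tpos_val _) tz z0.
move=> q; rewrite ltnS leq_eqVlt => /orP[/eqP ->|]; last exact: IH.
by rewrite -tn t0; apply: tens_lift0.
Qed.

End PositivePartProjective.

(** * Equivalences of categories *)

Local Notation hom := Defs.hom.
Local Notation comp := Defs.comp.

Definition full_functor (C D : category) (G : functor C D) : Prop :=
  forall X Y (h : hom (G X) (G Y)), exists f, fhom G f = h.

Definition faithful_functor (C D : category) (G : functor C D) : Prop :=
  forall X Y (f g : hom X Y), fhom G f = fhom G g -> f = g.

Definition isomorphic (C : category) (X Y : C) : Prop :=
  exists (u : hom X Y) (v : hom Y X), comp v u = idm X /\ comp u v = idm Y.

Section EssentiallySurjective.
Variables (C D : category) (G : functor C D) (F : D -> C).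
Hypotheses (G_full : full_functor G) (G_faithful : faithful_functor G).
Hypothesis G_ess_surj : forall Y, isomorphic Y (G (F Y)).

Let pre X Y (h : hom (G X) (G Y)) : hom X Y := sval (cid (G_full h)).

Let preE X Y (h : hom (G X) (G Y)) : fhom G (pre h) = h.
Proof. exact: svalP (cid (G_full h)). Qed.

Let u Y : hom Y (G (F Y)) := sval (cid (G_ess_surj Y)).
Let v Y : hom (G (F Y)) Y := sval (cid (svalP (cid (G_ess_surj Y)))).

Let vu Y : comp (v Y) (u Y) = idm Y.
Proof. by have [] := svalP (cid (svalP (cid (G_ess_surj Y)))). Qed.

Let uv Y : comp (u Y) (v Y) = idm (G (F Y)).
Proof. by have [] := svalP (cid (svalP (cid (G_ess_surj Y)))). Qed.

Let Fhom X Y (h : hom X Y) : hom (F X) (F Y) := pre (comp (u Y) (comp h (v X))).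

Let Fhom_id X : Fhom (idm X) = idm (F X).
Proof. by apply: G_faithful; rewrite preE comp_idl uv fhom_id. Qed.

Let Fhom_comp X Y Z (g : hom Y Z) (f : hom X Y) :
  Fhom (comp g f) = comp (Fhom g) (Fhom f).
Proof.
apply: G_faithful; rewrite fhom_comp !preE !comp_assoc; congr (comp (comp _ f) _).
by rewrite -[RHS]comp_assoc vu comp_idr.
Qed.

(** The quasi-inverse is given on morphisms by conjugation with the chosen isomorphisms, pulled back
    through G; since G is faithful, the functor laws can be checked in D. *)
Lemma equivalent_of_fully_faithful : equivalent C D.
Proof.
pose H := Functor Fhom_id Fhom_comp; exists G, H; split.
  exists (fun X => pre (v (G X))), (fun X => pre (u (G X))).
  split=> [X Y f|X|X]; apply: G_faithful; rewrite ?fhom_comp ?fhom_id !preE.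
  - by rewrite !comp_assoc vu comp_idl.
  - exact: uv.
  - exact: vu.
exists (fun X => v X), (fun X => u X); split=> [X Y f|X|X]; [|exact: uv|exact: vu].
by rewrite /= preE !comp_assoc vu comp_idl.
Qed.

End EssentiallySurjective.

Section FullSubcategories.
Variables (C D : category) (G : functor C D) (F : D -> C).
Hypotheses (G_full : full_functor G) (G_faithful : faithful_functor G).
Hypothesis G_ess_surj : forall Y, isomorphic Y (G (F Y)).
Variables (P : C -> Prop) (Q : D -> Prop).
Hypotheses (GP : forall X, P X -> Q (G X)) (FQ : forall Y, Q Y -> P (F Y)).

Let GQ : functor (full_subcategory P) (full_subcategory Q) :=
  @Functor (full_subcategory P) (full_subcategory Q)
    (fun X => exist Q (G (sval X)) (GP (svalP X)))
    (fun X Y f => fhom G f) (fun X => fhom_id G (sval X))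
    (fun X Y Z g f => fhom_comp G g f).

(** Reduces the finitely generated statement to the preservation of finite generation by the two
    object maps. *)
Lemma equivalent_full_subcategory :
  equivalent (full_subcategory P) (full_subcategory Q).
Proof.
apply: (@equivalent_of_fully_faithful _ _ GQ
  (fun Y => exist P (F (sval Y)) (FQ (svalP Y)))) => [X Y h|X Y f g|Y].
- exact: G_full.
- exact: G_faithful.
- exact: G_ess_surj.
Qed.

End FullSubcategories.

(** * Modules over an algebra presented by vertices and arrows *)

Section RightAction.
Variables (R : pzRingType) (V : lmodType R^c).
Implicit Types (v w : V) (a b : R).

(** Writing the action of [R^c] on the right lets products act in their order in R, the order of
    composition along a path. *)
Definition ract v a : V := (a : R^c) *: v.

Lemma ractM v a b : ract v (a * b) = ract (ract v a) b.
Proof. by rewrite /ract scalerA. Qed.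

Lemma ract1 v : ract v 1 = v. Proof. exact: scale1r. Qed.

Lemma ractDl v w a : ract (v + w) a = ract v a + ract w a.
Proof. exact: scalerDr. Qed.

Lemma ractDr v a b : ract v (a + b) = ract v a + ract v b.
Proof. exact: scalerDl. Qed.

Lemma ractBl v w a : ract (v - w) a = ract v a - ract w a.
Proof. exact: scalerBr. Qed.

Lemma ractBr v a b : ract v (a - b) = ract v a - ract v b.
Proof. exact: scalerBl. Qed.

Lemma ract0l a : ract 0 a = 0. Proof. exact: scaler0. Qed.

Lemma ract0r v : ract v 0 = 0. Proof. exact: scale0r. Qed.

Lemma ract_suml (I : finType) (F : I -> V) a : ract (\sum_i F i) a = \sum_i ract (F i) a.
Proof. exact: scaler_sumr. Qed.

Lemma ract_sumr (I : finType) v (F : I -> R) : ract v (\sum_i F i) = \sum_i ract v (F i).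
Proof. exact: scaler_suml. Qed.

End RightAction.

Lemma linear_ract (R : pzRingType) (V W : lmodType R^c) (f : {linear V -> W}) v a :
  f (ract v a) = ract (f v) a.
Proof. exact: linearZ_LR. Qed.

Section SingleEntry.
Variables (I : finType) (T : I -> zmodType).

Definition dsingle i (x : T i) : dprod T := fun j =>
  if i =P j is ReflectT e then ecast j (T j) e x else 0.

Lemma dsingleE i (x : T i) : dsingle x i = x.
Proof. by rewrite /dsingle; case: eqP => // e; rewrite eq_axiomK. Qed.

Lemma dsingle_neq i (x : T i) j : i != j -> dsingle x j = 0.
Proof. by rewrite /dsingle; case: eqP. Qed.

Lemma dsingleB i : {morph @dsingle i : x y / x - y}.
Proof.
move=> x y; apply: dprodP => j; rewrite dprodBE.
have [e|ne_ij] := eqVneq i j; first by case: j / e; rewrite !dsingleE.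
by rewrite !dsingle_neq ?subrr.
Qed.

Lemma dsingle0 i : @dsingle i 0 = 0.
Proof. by have := dsingleB (0 : T i) 0; rewrite !subrr. Qed.

Lemma dsingleD i : {morph @dsingle i : x y / x + y}.
Proof. by move=> x y; apply: (addIr (- dsingle y)); rewrite -dsingleB !addrK. Qed.

Lemma dprod_sumE (J : finType) (F : J -> dprod T) i : (\sum_j F j) i = \sum_j F j i.
Proof. exact: (big_morph (fun x : dprod T => x i)). Qed.

Lemma sum_dsingle_at (F : forall i, T i) j : (\sum_i dsingle (F i)) j = F j.
Proof.
rewrite dprod_sumE (bigD1 j) //= dsingleE big1 ?addr0 // => i ne_ij.
exact: dsingle_neq.
Qed.

Lemma sum_dsingle (x : dprod T) : \sum_i dsingle (x i) = x.
Proof. by apply: dprodP => j; rewrite sum_dsingle_at. Qed.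

End SingleEntry.

Section FinitelyGenerated.
Variables (R : pzRingType) (V : lmodType R).

Lemma finitely_generated_fintype (I : finType) (g : I -> V) :
  (forall v, exists c : I -> R, v = \sum_i c i *: g i) -> finitely_generated V.
Proof.
move=> gP; exists #|I|, (fun i => g (enum_val i)) => v; have [c ->] := gP v.
exists (fun i => c (enum_val i)).
by rewrite (reindex (@enum_val I predT)) //; apply/onW_bij/enum_val_bij.
Qed.

End FinitelyGenerated.

Section RepresentationAction.
Variables (k : fieldType) (M : premodulation k).

(* Extended by 0 when i -> j is not an edge, in which case M i j = 0 anyway.   *)
Definition rep_act (V : representation M) (i j : M) (v : V i) (m : pm_bimod i j) : V j :=
  if pselect (pm_edge i j) is left e then rep_map V e (tens v m) else 0.

Lemma rep_actDl (V : representation M) i j (v w : V i) (m : pm_bimod i j) :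
  rep_act (v + w) m = rep_act v m + rep_act w m.
Proof.
by rewrite /rep_act; case: pselect => [e|_]; rewrite ?addr0 // tensDl linearD.
Qed.

Lemma rep_actDr (V : representation M) i j (v : V i) (m n : pm_bimod i j) :
  rep_act v (m + n) = rep_act v m + rep_act v n.
Proof.
by rewrite /rep_act; case: pselect => [e|_]; rewrite ?addr0 // tensDr linearD.
Qed.

Lemma rep_act0r (V : representation M) i j (v : V i) :
  rep_act v (0 : pm_bimod i j) = 0.
Proof. by apply: (addIr (rep_act v (0 : pm_bimod i j))); rewrite -rep_actDr !add0r. Qed.

Lemma rep_actBr (V : representation M) i j (v : V i) (m n : pm_bimod i j) :
  rep_act v (m - n) = rep_act v m - rep_act v n.
Proof. by apply: (addIr (rep_act v n)); rewrite -rep_actDr !subrK. Qed.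

Lemma rep_actA (V : representation M) i j (v : V i) a (m : pm_bimod i j) :
  rep_act (ract v a) m = rep_act v (lact a m).
Proof. by rewrite /rep_act; case: pselect => [e|//]; rewrite tensA. Qed.

Lemma rep_act_ract (V : representation M) i j (v : V i) (m : pm_bimod i j) b :
  rep_act v (ract m b) = ract (rep_act v m) b.
Proof.
rewrite /rep_act; case: pselect => [e|_]; last by rewrite ract0l.
by rewrite -linear_ract; congr (rep_map V e _); apply: esym; apply: tens_scaleE.
Qed.

Lemma rep_hom_act (V U : representation M) (f : rep_hom V U) i j (v : V i)
    (m : pm_bimod i j) :
  sval f j (rep_act v m) = rep_act (sval f i v) m.
Proof.
rewrite /rep_act; case: pselect => [e|_]; last exact: linear0.
by rewrite (svalP f) tens_mapE.
Qed.

End RepresentationAction.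

Lemma fbelt_gen (k : fieldType) (B C : algType k) (X : choiceType) a (x : X) b :
  fbelt a x b = ract (lact a (fbelt 1 x 1 : free_bimod B C X)) b.
Proof.
rewrite -[RHS]/(fbim_act 1 b (fbim_act a 1 (fbelt 1 x 1))) !fbim_actE.
by rewrite !mulr1 !mul1r.
Qed.

Section PresentedAlgebra.
Variables (k : fieldType) (A : algType k) (Q : quiver) (C : Q -> algType k).
Local Notation P := (path_premodulation C).
Variables (vert : forall i, C i -> A) (arr : forall i j : Q, arrow i j -> A).
Arguments vert : clear implicits.
Arguments arr {i j}.

Hypothesis vertB : forall i, {morph vert i : a b / a - b}.
Hypothesis vertM : forall i, {morph vert i : a b / a * b}.
Hypothesis vertZ : forall i c, {morph vert i : a / c *: a}.
Hypothesis vert_orth : forall i j a b, i != j -> vert i a * vert j b = 0.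
Hypothesis vert_sum1 : \sum_i vert i 1 = 1.
Hypothesis vert_arr : forall (i j : Q) (x : arrow i j), vert i 1 * arr x = arr x.
Hypothesis arr_vert : forall (i j : Q) (x : arrow i j), arr x * vert j 1 = arr x.
Hypothesis generation : forall S : set A, subgroup S ->
  (forall a b, S a -> S b -> S (a * b)) -> (forall i a, S (vert i a)) ->
  (forall (i j : Q) (x : arrow i j), S (arr x)) -> forall a, S a.

Definition rep_sum (V : representation P) := dprod (fun i : Q => V i).
HB.instance Definition _ V := GRing.Zmodule.on (rep_sum V).

Definition acts_through V (act : rep_sum V -> A -> rep_sum V) :=
  [/\ forall v w a, act (v + w) a = act v a + act w a,
      forall v a b, act v (a + b) = act v a + act v b,
      forall v a b, act v (a * b) = act (act v a) b,
      forall v i a, act v (vert i a) = dsingle (ract (v i) a)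
    & forall v (i j : Q) (x : arrow i j),
        act v (arr x) = dsingle (rep_act (v i) (fbelt 1 x 1 : pm_bimod (p := P) i j))].

(** Takes the place of a list of defining relations: every representation extends to an action of A,
    while [generation] makes A-linearity a matter of vertices and arrows. *)
Hypothesis freeness : forall V, exists act, @acts_through V act.

Section SumModule.
Variable V : representation P.

Local Notation rep_sum := (rep_sum V).

Definition rep_sum_act : rep_sum -> A -> rep_sum := sval (cid (freeness V)).

Let actP : acts_through rep_sum_act. Proof. exact: svalP (cid (freeness V)). Qed.

Definition rep_sum_scale (a : A^c) (v : rep_sum) : rep_sum := rep_sum_act v a.

Lemma rep_sum_scaleA a b v :
  rep_sum_scale a (rep_sum_scale b v) = rep_sum_scale (a * b) v.
Proof. by case: actP => _ _ AM _ _; rewrite /rep_sum_scale -AM. Qed.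

Lemma rep_sum_scaleDr : right_distributive rep_sum_scale +%R.
Proof. by case: actP => AD _ _ _ _ a v w; apply: AD. Qed.

Lemma rep_sum_scaleDl v : {morph rep_sum_scale^~ v : a b / a + b}.
Proof. by case: actP => _ AD _ _ _ a w; apply: AD. Qed.

(** The unit law is not part of [acts_through]: 1 is the sum of the e_i, and each e_i acts as the
    projection onto a summand. *)
Lemma rep_sum_scale1 : left_id 1 rep_sum_scale.
Proof.
move=> v; case: actP => _ AD _ Av _.
have act0 : rep_sum_act v 0 = 0.
  by apply: (addIr (rep_sum_act v 0)); rewrite -AD !add0r.
rewrite /rep_sum_scale -[1]/(1 : A) -vert_sum1.
rewrite (big_morph (rep_sum_act v) (AD v) act0) -[RHS]sum_dsingle.
by apply: eq_bigr => i _; rewrite Av ract1.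
Qed.

HB.instance Definition _ := GRing.Zmodule_isLmodule.Build A^c rep_sum
  rep_sum_scaleA rep_sum_scale1 rep_sum_scaleDr rep_sum_scaleDl.

Lemma rep_sum_vert (v : rep_sum) i a : ract v (vert i a) = dsingle (ract (v i) a).
Proof. by case: actP. Qed.

Lemma rep_sum_arr (v : rep_sum) (i j : Q) (x : arrow i j) :
  ract v (arr x) = dsingle (rep_act (v i) (fbelt 1 x 1 : pm_bimod (p := P) i j)).
Proof. by case: actP. Qed.

End SumModule.

(** The elements of A whose action commutes with f form a subring, so [generation] applies. *)
Lemma linear_on_generators (V W : lmodType A^c) (f : V -> W) :
  {morph f : v w / v - w} ->
  (forall v i a, f (ract v (vert i a)) = ract (f v) (vert i a)) ->
  (forall v (i j : Q) (x : arrow i j), f (ract v (arr x)) = ract (f v) (arr x)) ->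
  scalable f.
Proof.
move=> fB fvert farr a v; move: a v.
apply: (generation (S := fun a => forall v, f (ract v a) = ract (f v) a)) => //.
  split=> [v|a b fa fb v]; last by rewrite !ractBr fB fa fb.
  by rewrite !ract0r; have := fB 0 0; rewrite !subrr.
by move=> a b fa fb v; rewrite !ractM fb fa.
Qed.

Section SumMap.
Variables (V W : representation P) (f : rep_hom V W).

Definition rep_sum_map (v : rep_sum V) : rep_sum W := fun i => sval f i (v i).

Lemma rep_sum_mapB : {morph rep_sum_map : v w / v - w}.
Proof. by move=> v w; apply: dprodP => i; apply: linearB. Qed.

Lemma rep_sum_map_single i (v : V i) :
  rep_sum_map (dsingle v) = dsingle (sval f i v).
Proof.
apply: dprodP => j; rewrite /rep_sum_map.
have [e|ne_ij] := eqVneq i j; first by case: j / e; rewrite !dsingleE.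
by rewrite !dsingle_neq ?linear0.
Qed.

Lemma rep_sum_mapZ : scalable rep_sum_map.
Proof.
apply: linear_on_generators; first exact: rep_sum_mapB.
  by move=> v i a; rewrite !rep_sum_vert rep_sum_map_single linear_ract.
by move=> v i j x; rewrite !rep_sum_arr rep_sum_map_single rep_hom_act.
Qed.

HB.instance Definition _ :=
  GRing.isZmodMorphism.Build (rep_sum V) (rep_sum W) rep_sum_map rep_sum_mapB.
HB.instance Definition _ :=
  GRing.isScalable.Build A^c (rep_sum V) (rep_sum W) *:%R rep_sum_map rep_sum_mapZ.

End SumMap.

Lemma rep_sum_map_id (V : representation P) :
  (rep_sum_map (rep_id V) : {linear _ -> _}) = idfun :> {linear rep_sum V -> rep_sum V}.
Proof. exact: linear_ext. Qed.

Lemma rep_sum_map_comp (U V W : representation P) (g : rep_hom V W) (f : rep_hom U V) :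
  (rep_sum_map (rep_comp g f) : {linear _ -> _}) =
  (rep_sum_map g \o rep_sum_map f)%FUN :> {linear rep_sum U -> rep_sum W}.
Proof. exact: linear_ext. Qed.

Definition rep_sum_functor : functor (RepCat P) (ModCat A) :=
  @Functor (RepCat P) (ModCat A) (fun V => rep_sum V) (fun V W f => rep_sum_map f)
    rep_sum_map_id rep_sum_map_comp.

Lemma rep_sum_faithful : faithful_functor rep_sum_functor.
Proof.
move=> V W f g fg; apply: rep_hom_ext => i v.
have /(congr1 (fun h : {linear rep_sum V -> rep_sum W} => h (dsingle v) i)) := fg.
by rewrite /= /rep_sum_map dsingleE.
Qed.

Section Fullness.
Variables (V W : representation P) (h : {linear rep_sum V -> rep_sum W}).

Definition rep_component i (v : V i) : W i := h (dsingle v) i.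

(** h commutes with the idempotent e_i, whose image is the i-th summand. *)
Lemma rep_component_single i (v : V i) : h (dsingle v) = dsingle (rep_component v).
Proof.
have -> : dsingle v = ract (dsingle v : rep_sum V) (vert i 1).
  by rewrite rep_sum_vert ract1 dsingleE.
by rewrite linear_ract rep_sum_vert ract1.
Qed.

Lemma rep_componentB i : {morph @rep_component i : v w / v - w}.
Proof. by move=> v w; rewrite /rep_component dsingleB linearB. Qed.

Lemma rep_componentZ i : scalable (@rep_component i).
Proof.
move=> a v; have -> : a *: v = ract v a by [].
have vE : dsingle (ract v a) = ract (dsingle v : rep_sum V) (vert i a).
  by rewrite rep_sum_vert dsingleE.
by rewrite /rep_component vE linear_ract rep_sum_vert dsingleE.
Qed.

HB.instance Definition _ i :=
  GRing.isZmodMorphism.Build (V i) (W i) (@rep_component i) (@rep_componentB i).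
HB.instance Definition _ i :=
  GRing.isScalable.Build (C i)^c (V i) (W i) *:%R (@rep_component i) (@rep_componentZ i).

(** Linearity of h over each [arr x] gives the compatibility for 1 x 1; these elements generate the
    free bimodule ([fbelt_gen]). *)
Lemma rep_component_morphism :
  rep_morphism (fun i : P => @rep_component i : {linear V i -> W i}).
Proof.
have comp_act (i j : Q) (v : V i) (x : arrow i j) :
    rep_component (rep_act v (fbelt 1 x 1 : pm_bimod (p := P) i j)) =
    rep_act (rep_component v) (fbelt 1 x 1 : pm_bimod (p := P) i j).
  have : h (ract (dsingle v : rep_sum V) (arr x)) = ract (h (dsingle v)) (arr x).
    exact: linear_ract.
  rewrite !rep_sum_arr rep_component_single dsingleE => /(congr1 (fun w => w j)).
  by rewrite !dsingleE.
move=> i j e z; have rep_mapE (U : representation P) (v : U i) m :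
    rep_map U e (tens v m) = rep_act v m.
  by rewrite /rep_act; case: pselect => // e'; rewrite (eq_irrelevance e' e).
elim/tensor_ind: z => [|z z' IHz IHz'|v m].
- have -> : tens_map (@rep_component i : {linear V i -> W i}) 0 =
      (0 : tensor _ (pm_bimod i j)).
    have := tens_mapB (@rep_component i : {linear V i -> W i})
      (0 : tensor _ (pm_bimod i j)) 0.
    by rewrite !subrr.
  by rewrite !linear0.
- by rewrite tens_mapB !linearB IHz IHz'.
rewrite tens_mapE !rep_mapE.
elim/fbim_ind: m => [|m m' IHm IHm'|a x b].
- by rewrite !rep_act0r linear0.
- by rewrite !rep_actBr linearB IHm IHm'.
rewrite fbelt_gen !rep_act_ract -!rep_actA linear_ract; congr ract.
apply: etrans (comp_act i j (ract v a) x) _; congr rep_act.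
exact: linear_ract.
Qed.

End Fullness.

Lemma rep_sum_full : full_functor rep_sum_functor.
Proof.
move=> V W h; exists (exist _ _ (rep_component_morphism h)).
apply: linear_ext => v; rewrite -[v in RHS]sum_dsingle linear_sum.
apply: dprodP => j; rewrite dprod_sumE (bigD1 j) //= big1 ?addr0 // => i ne_ij.
by rewrite rep_component_single dsingle_neq.
Qed.

Section Corner.
Variable V : lmodType A^c.

(** The corner W e_i, described as the fixed points of the idempotent e_i. *)
Definition corner_pred (i : Q) : {pred V} := fun v => ract v (vert i 1) == v.

Lemma corner_zmod_closed i : zmod_closed (corner_pred i).
Proof.
split=> [|v w /eqP vi /eqP wi]; apply/eqP; first exact: ract0l.
by rewrite ractBl vi wi.
Qed.

HB.instance Definition _ i :=
  GRing.isZmodClosed.Build V (corner_pred i) (corner_zmod_closed i).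

Record corner i := Corner { cval :> V; cvalP : cval \in corner_pred i }.
HB.instance Definition _ i := [isSub for @cval i].
HB.instance Definition _ i := [Choice of corner i by <:].
HB.instance Definition _ i := [SubChoice_isSubZmodule of corner i by <:].

Lemma corner_ract_subproof i (v : V) (a : A) :
  a * vert i 1 = a -> ract v a \in corner_pred i.
Proof. by move=> ai; apply/eqP; rewrite -ractM ai. Qed.

Definition corner_ract i (v : V) (a : A) (ai : a * vert i 1 = a) : corner i :=
  Corner (corner_ract_subproof v ai).

Lemma vert_mul1 i a : vert i a * vert i 1 = vert i a.
Proof. by rewrite -vertM mulr1. Qed.

Definition corner_scale i (a : (C i)^c) (v : corner i) : corner i :=
  corner_ract v (vert_mul1 (a : C i)).

Lemma corner_scaleA i a b (v : corner i) :
  corner_scale a (corner_scale b v) = corner_scale (a * b) v.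
Proof. by apply: val_inj; rewrite /= -ractM -vertM. Qed.

Lemma corner_scale1 i : left_id 1 (@corner_scale i).
Proof. by move=> v; apply: val_inj; rewrite /= (eqP (cvalP v)). Qed.

Lemma corner_scaleDr i : right_distributive (@corner_scale i) +%R.
Proof. by move=> a v w; apply: val_inj; rewrite /= ractDl. Qed.

Lemma vertD i : {morph vert i : a b / a + b}.
Proof. by move=> a b; apply: (addIr (- vert i b)); rewrite -vertB !addrK. Qed.

Lemma corner_scaleDl i (v : corner i) : {morph (@corner_scale i)^~ v : a b / a + b}.
Proof. by move=> a b; apply: val_inj; rewrite /= vertD ractDr. Qed.

HB.instance Definition _ i := GRing.Zmodule_isLmodule.Build (C i)^c (corner i)
  (@corner_scaleA i) (@corner_scale1 i) (@corner_scaleDr i) (@corner_scaleDl i).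

End Corner.

Section Arrows.
Variables i j : Q.
Local Notation M := (fbim (C i) (C j) (arrow i j)).

(** The bimodule map from the free bimodule on the arrows to e_i A e_j that extends [arr]. *)
Definition arrow_elt : M -> A := fbim_lift (fun a x b => vert i a * arr x * vert j b).

Let eltDl a a' (x : arrow i j) b :
  vert i (a + a') * arr x * vert j b =
  vert i a * arr x * vert j b + vert i a' * arr x * vert j b.
Proof. by rewrite vertD !mulrDl. Qed.

Let eltDr a (x : arrow i j) b b' :
  vert i a * arr x * vert j (b + b') =
  vert i a * arr x * vert j b + vert i a * arr x * vert j b'.
Proof. by rewrite vertD mulrDr. Qed.

Let eltZ c a (x : arrow i j) b :
  vert i (c *: a) * arr x * vert j b = vert i a * arr x * vert j (c *: b).
Proof. by rewrite !vertZ -!scalerAl -scalerAr. Qed.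

Lemma arrow_eltE a x b : arrow_elt (fbelt a x b) = vert i a * arr x * vert j b.
Proof. exact: fbim_liftE eltDl eltDr eltZ _ _ _. Qed.

Lemma arrow_eltB : {morph arrow_elt : m n / m - n}.
Proof. exact: fbim_liftB eltDl eltDr eltZ. Qed.

Lemma arrow_elt0 : arrow_elt 0 = 0.
Proof. by have := arrow_eltB 0 0; rewrite !subrr. Qed.

Lemma arrow_eltD : {morph arrow_elt : m n / m + n}.
Proof. by move=> m n; apply: (addIr (- arrow_elt n)); rewrite -arrow_eltB !addrK. Qed.

Lemma arrow_elt_act a b m :
  arrow_elt (fbim_act a b m) = vert i a * arrow_elt m * vert j b.
Proof.
elim/fbim_ind: m => [|m n IHm IHn|c x d].
- by rewrite fbim_act0 arrow_elt0 mulr0 mul0r.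
- by rewrite fbim_actB !arrow_eltB IHm IHn mulrBr mulrBl.
- by rewrite fbim_actE !arrow_eltE !vertM !mulrA.
Qed.

Lemma arrow_elt_right m : arrow_elt m * vert j 1 = arrow_elt m.
Proof.
elim/fbim_ind: m => [|m n IHm IHn|c x d]; first by rewrite arrow_elt0 mul0r.
- by rewrite arrow_eltB mulrBl IHm IHn.
- by rewrite arrow_eltE -mulrA vert_mul1.
Qed.

Lemma arrow_elt_left m : vert i 1 * arrow_elt m = arrow_elt m.
Proof.
elim/fbim_ind: m => [|m n IHm IHn|c x d]; first by rewrite arrow_elt0 mulr0.
- by rewrite arrow_eltB mulrBr IHm IHn.
- by rewrite arrow_eltE !mulrA -vertM mul1r.
Qed.

Local Notation B := (pm_bimod (p := P) i j).

Lemma arrow_elt_lact a (m : B) : arrow_elt (lact a m) = vert i a * arrow_elt m.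
Proof.
by rewrite -[LHS]/(arrow_elt (fbim_act a 1 m)) arrow_elt_act -mulrA arrow_elt_right.
Qed.

Lemma arrow_elt_ract (m : B) b : arrow_elt (ract m b) = arrow_elt m * vert j b.
Proof.
by rewrite -[LHS]/(arrow_elt (fbim_act 1 b m)) arrow_elt_act arrow_elt_left.
Qed.

End Arrows.

Section CornerRepresentation.
Variable V : lmodType A^c.
Local Notation F := (@corner V).

Section Map.
Variables i j : Q.
Local Notation M := (pm_bimod (p := P) i j).

Definition corner_mul (v : F i) (m : M) : F j := corner_ract (cval v) (arrow_elt_right m).

Definition corner_map : tensor (F i) M -> F j := tens_lift corner_mul.

Let mulDl (v w : F i) m : corner_mul (v + w) m = corner_mul v m + corner_mul w m.
Proof. by apply: val_inj; rewrite /= ractDl. Qed.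

Let mulDr (v : F i) m n : corner_mul v (m + n) = corner_mul v m + corner_mul v n.
Proof. by apply: val_inj; rewrite /= arrow_eltD ractDr. Qed.

Let mulA (v : F i) a m : corner_mul (ract v a) m = corner_mul v (lact a m).
Proof.
apply: val_inj; rewrite -[RHS]/(ract (cval v) (arrow_elt (lact a m))).
by rewrite arrow_elt_lact ractM.
Qed.

Lemma corner_map_tens v m : corner_map (tens v m) = corner_mul v m.
Proof. exact: tens_liftE mulDl mulDr mulA _ _. Qed.

Lemma corner_mapB : {morph corner_map : x y / x - y}.
Proof. exact: tens_liftB mulDl mulDr mulA. Qed.

Lemma corner_mapZ : scalable corner_map.
Proof.
have map0 : corner_map 0 = 0 by have := corner_mapB 0 0; rewrite !subrr.
move=> b; elim/tensor_ind => [|x y IHx IHy|v m]; first by rewrite map0 !scaler0 map0.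
- by rewrite scalerBr !corner_mapB IHx IHy scalerBr.
rewrite [b *: _]tens_scaleE !corner_map_tens; apply: val_inj.
rewrite -[LHS]/(ract (cval v) (arrow_elt (ract m b))).
by rewrite arrow_elt_ract ractM.
Qed.

HB.instance Definition _ :=
  GRing.isZmodMorphism.Build (tensor (F i) M) (F j) corner_map corner_mapB.
HB.instance Definition _ :=
  GRing.isScalable.Build (C j)^c (tensor (F i) M) (F j) *:%R corner_map corner_mapZ.

End Map.

Definition corner_rep : representation P :=
  @Representation k P (fun i => F i) (fun i j _ => @corner_map i j).

Lemma corner_rep_act (i j : Q) (v : corner_rep i) (m : pm_bimod (p := P) i j) :
  cval (rep_act v m) = ract (cval v) (arrow_elt m).
Proof.
rewrite /rep_act; case: pselect => [e|no_edge].
  by rewrite -[rep_map _ _ _]/(corner_map (tens v m)) corner_map_tens.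
(* Without an edge the bimodule is zero, so the default value 0 of [rep_act] is the right one. *)
have -> : m = 0.
  apply: contrapT => m0; apply: no_edge.
  by apply: (introT (asboolP _)); exists m.
by rewrite arrow_elt0 ract0r.
Qed.

Definition corner_sum (w : rep_sum corner_rep) : V := \sum_i cval (w i).

Lemma corner_sumB : {morph corner_sum : v w / v - w}.
Proof. by move=> v w; rewrite /corner_sum -sumrB. Qed.

Lemma corner_sum_single (i : Q) (v : corner_rep i) : corner_sum (dsingle v) = cval v.
Proof.
rewrite /corner_sum (bigD1 i) //= dsingleE big1 ?addr0 // => j ne_ji.
by rewrite dsingle_neq // eq_sym.
Qed.

(** Orthogonality: for j different from i, w_j a = w_j e_j e_i a = 0. *)
Lemma corner_sum_ract w i a : vert i 1 * a = a ->
  ract (corner_sum w) a = ract (cval (w i)) a.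
Proof.
move=> ia; rewrite /corner_sum ract_suml (bigD1 i) //= big1 ?addr0 // => j ne_ji.
by rewrite -(eqP (cvalP (w j))) -ractM -ia mulrA vert_orth // mul0r ract0r.
Qed.

Lemma corner_sumZ : scalable corner_sum.
Proof.
apply: linear_on_generators; first exact: corner_sumB.
  move=> w i a; rewrite rep_sum_vert corner_sum_single (corner_sum_ract w (i := i)) //.
  by rewrite -vertM mul1r.
move=> w i j x; rewrite rep_sum_arr corner_sum_single corner_rep_act.
rewrite (corner_sum_ract w (i := i)) ?vert_arr //.
by rewrite arrow_eltE vert_arr arr_vert.
Qed.

HB.instance Definition _ :=
  GRing.isZmodMorphism.Build (rep_sum corner_rep) V corner_sum corner_sumB.
HB.instance Definition _ :=
  GRing.isScalable.Build A^c (rep_sum corner_rep) V *:%R corner_sum corner_sumZ.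

Definition corner_decomp (v : V) : rep_sum corner_rep := fun i =>
  corner_ract v (vert_mul1 (1 : C i)).

Lemma corner_decompK : cancel corner_decomp corner_sum.
Proof. by move=> v; rewrite /corner_sum /= -ract_sumr vert_sum1 ract1. Qed.

Lemma corner_sumK : cancel corner_sum corner_decomp.
Proof.
move=> w; apply: dprodP => i; apply: val_inj => /=.
rewrite (corner_sum_ract w (i := i)) ?vert_mul1 //.
exact/eqP/cvalP.
Qed.

Lemma corner_decomp_linear : linear corner_decomp.
Proof. exact: can2_linear corner_sumK corner_decompK. Qed.

HB.instance Definition _ := GRing.isLinear.Build A^c V (rep_sum corner_rep) *:%R
  corner_decomp corner_decomp_linear.

(** W is the direct sum of the W e_i, as the e_i are orthogonal idempotents of sum 1. *)
Lemma corner_iso : isomorphic (V : ModCat A) (rep_sum_functor corner_rep).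
Proof.
exists (corner_decomp : {linear V -> rep_sum corner_rep}).
exists (corner_sum : {linear rep_sum corner_rep -> V}).
by split; apply: linear_ext => v /=; [apply: corner_decompK|apply: corner_sumK].
Qed.

Hypothesis A_fin : exists n (g : 'I_n -> A),
  forall a, exists c : 'I_n -> k, a = \sum_l c l *: g l.

(** If the h_l generate W over A and the g_l' span A over k, then the h_l g_l' e_i span W e_i
    already over k. *)
Lemma corner_rep_fg : finitely_generated V -> forall i, finitely_generated (corner_rep i).
Proof.
move=> [n [h hP]] i; have [m [g gP]] := A_fin.
have gE (l : 'I_m) : g l * vert i 1 * vert i 1 = g l * vert i 1 by rewrite -mulrA vert_mul1.
apply: (@finitely_generated_fintype _ _ ('I_n * 'I_m)%type
  (fun p => corner_ract (h p.1) (gE p.2) : corner_rep i)) => v.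
have [a vE] := hP (cval v).
have ag l : exists c : 'I_m -> k, a l = \sum_l' c l' *: g l' by apply: gP.
pose c l := sval (cid (ag l)).
have cE l : a l = \sum_l' c l l' *: g l' := svalP (cid (ag l)).
exists (fun p => ((c p.1 p.2)%:A : C i)); apply: val_inj.
rewrite -[LHS]/(cval v) -(eqP (cvalP v)) vE.
rewrite -[RHS]/(cval _) (big_morph (@cval V i) (id1 := 0) (op1 := +%R)) //.
rewrite ract_suml.
rewrite (eq_bigr (fun l => \sum_l' ract (h l) (c l l' *: (g l' * vert i 1)))) => [|l _].
  rewrite pair_bigA; apply: eq_bigr => -[l l'] _ /=.
  by rewrite -ractM vertZ -scalerAr gE.
rewrite -[a l *: h l]/(ract (h l) (a l)) -ractM cE mulr_suml ract_sumr.
by apply: eq_bigr => l' _; rewrite -scalerAl.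
Qed.

End CornerRepresentation.

Lemma rep_sum_fg (V : representation P) :
  (forall i, finitely_generated (V i)) -> finitely_generated (rep_sum V : lmodType A^c).
Proof.
move=> V_fg; pose n i := sval (cid (V_fg i)).
pose g i : 'I_(n i) -> V i := sval (cid (svalP (cid (V_fg i)))).
have gP i (v : V i) : exists c : 'I_(n i) -> (C i)^c, v = \sum_l c l *: g i l.
  exact: svalP (cid (svalP (cid (V_fg i)))) v.
apply: (@finitely_generated_fintype _ _ {i : Q & 'I_(n i)}
  (fun p => dsingle (g (tag p) (tagged p)) : rep_sum V)) => v.
pose c i := sval (cid (gP i (v i))).
have cE i : v i = \sum_l c i l *: g i l := svalP (cid (gP i (v i))).
exists (fun p => vert (tag p) (c (tag p) (tagged p) : C _)).
rewrite -[LHS]sum_dsingle.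
rewrite (eq_bigr (fun i => \sum_l dsingle (c i l *: g i l))) => [|i _].
  rewrite sig_big_dep /=; apply: eq_bigr => -[i l] _ /=.
  rewrite -[RHS]/(ract (dsingle (g i l) : rep_sum V) (vert i (c i l))).
  by rewrite rep_sum_vert dsingleE.
rewrite cE; apply: (big_morph _ (@dsingleD _ _ i) (@dsingle0 _ _ i)).
Qed.

Lemma presented_equivalent :
  (exists n (g : 'I_n -> A), forall a, exists c : 'I_n -> k, a = \sum_l c l *: g l) ->
  equivalent (RepCat P) (ModCat A) /\ equivalent (repCat P) (modCat A).
Proof.
move=> A_fin; split.
  exact: equivalent_of_fully_faithful rep_sum_full rep_sum_faithful corner_iso.
apply: (equivalent_full_subcategory rep_sum_full rep_sum_faithful corner_iso).
  exact: rep_sum_fg.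
move=> V; exact: (corner_rep_fg A_fin).
Qed.

End PresentedAlgebra.

(** * Modules over a tensor algebra *)

Section TensorAlgebraAction.
Variables (k : fieldType) (R : algType k) (M : bimod R R) (V : lmodType R^c).
Variable mu : V -> M -> V.
Hypothesis muDl : forall v w m, mu (v + w) m = mu v m + mu w m.
Hypothesis muDr : forall v m n, mu v (m + n) = mu v m + mu v n.
Hypothesis muA : forall v (r : R) m, mu (ract v r) m = mu v (lact r m).
Hypothesis mu_ract : forall v m (r : R), mu v ((r : R^c) *: m) = ract (mu v m) r.
Local Notation T := (talg M).
Local Notation vend := (dprod (fun _ : V => V)).

Fixpoint tact (n : nat) : tpow M n -> vend :=
  match n return tpow M n -> vend with
  | 0 => fun (r : R^c) v => r *: v
  | n'.+1 => tens_lift (fun (y : tpow M n') m => (fun v => mu (tact y v) m) : vend)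
  end.

(** The three properties are proved together by induction: those in degree n make the action in
    degree n+1 well defined on the tensor product. *)
Definition tact_linear n :=
  [/\ forall y z : tpow M n, tact (y - z) = tact y - tact z,
      forall (y : tpow M n) (r : R) v, tact (ract y r) v = ract (tact y v) r
    & forall (y : tpow M n) v w, tact y (v + w) = tact y v + tact y w].

Section Step.
Variable n : nat.
Hypothesis IHn : tact_linear n.

Let step (y : tpow M n) m : vend := fun v => mu (tact y v) m.

Let stepDl y z m : step (y + z) m = step y m + step z m.
Proof.
case: IHn => B _ _; have D : tact (y + z) = tact y + tact z.
  by apply: (addIr (- tact z)); rewrite -B !addrK.
by apply: dprodP => v; rewrite /step D !dprodDE muDl.
Qed.

Let stepDr y m m' : step y (m + m') = step y m + step y m'.
Proof. by apply: dprodP => v; rewrite !dprodDE -muDr. Qed.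

Let stepA y (r : R) m : step ((r : R^c) *: y) m = step y (lact r m).
Proof. by apply: dprodP => v; case: IHn => _ A _; rewrite /step A muA. Qed.

Lemma tact_step (y : tpow M n) m v : tact (tens y m : tpow M n.+1) v = mu (tact y v) m.
Proof. by rewrite -[tact _]/(tens_lift step _) (tens_liftE stepDl stepDr stepA). Qed.

Lemma tact_linearS : tact_linear n.+1.
Proof.
have B (y z : tpow M n.+1) : tact (y - z) = tact y - tact z.
  exact: (tens_liftB stepDl stepDr stepA).
have T0 v : tact (0 : tpow M n.+1) v = 0.
  by have := B 0 0; rewrite !subrr => ->.
split=> [//|y r v|y v w]; elim/tensor_ind: y => [|y z IHy IHz|y m].
- by rewrite ract0l !T0 ract0l.
- by rewrite ractBl !B !dprodBE IHy IHz ractBl.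
- have -> : ract (tens y m : tpow M n.+1) r = tens y ((r : R^c) *: m).
    exact: tens_scaleE.
  by rewrite !tact_step mu_ract.
- by rewrite !T0 addr0.
- by rewrite !B !dprodBE IHy IHz opprD addrACA.
- by case: IHn => _ _ D; rewrite !tact_step D muDl.
Qed.

End Step.

Lemma tactP n : tact_linear n.
Proof.
elim: n => [|n IHn]; last exact: tact_linearS.
split=> [y z|y r v|y v w].
- by apply: dprodP => v; apply: scalerBl.
- exact: ractM.
- exact: scalerDr.
Qed.

Lemma tact_tens n (y : tpow M n) m v :
  tact (tens y m : tpow M n.+1) v = mu (tact y v) m.
Proof. exact/tact_step/tactP. Qed.

Lemma tactBl n (y z : tpow M n) v : tact (y - z) v = tact y v - tact z v.
Proof. by have [-> _ _] := tactP n. Qed.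

Lemma tact0l n v : tact (0 : tpow M n) v = 0.
Proof. by have := tactBl (0 : tpow M n) 0 v; rewrite !subrr. Qed.

Lemma tact_ract n (y : tpow M n) r v : tact (ract y r) v = ract (tact y v) r.
Proof. by have [_ -> _] := tactP n. Qed.

Lemma tactDr n (y : tpow M n) v w : tact y (v + w) = tact y v + tact y w.
Proof. by have [_ _ ->] := tactP n. Qed.

Definition talg_act (v : V) (x : T) : V := \sum_(n < tbound x) tact (x n) v.

Lemma talg_actE N v x : (tbound x <= N)%N -> talg_act v x = \sum_(n < N) tact (x n) v.
Proof.
move=> le_N; rewrite /talg_act (big_ord_widen _ (fun n => tact (x n) v) le_N).
rewrite big_mkcond; apply: eq_bigr => n _.
by case: ltnP => // /tboundP ->; rewrite tact0l.
Qed.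

Lemma talg_actDl v w x : talg_act (v + w) x = talg_act v x + talg_act w x.
Proof. by rewrite -big_split; apply: eq_bigr => n _; apply: tactDr. Qed.

Lemma talg_actBr v x y : talg_act v (x - y) = talg_act v x - talg_act v y.
Proof.
pose N := maxn (tbound (x - y)) (maxn (tbound x) (tbound y)).
rewrite (@talg_actE N v (x - y)) ?(@talg_actE N v x) ?(@talg_actE N v y);
  rewrite ?leq_max ?leqnn ?orbT //.
by rewrite -sumrB; apply: eq_bigr => n _; rewrite tvalBE tactBl.
Qed.

Lemma talg_actDr v x y : talg_act v (x + y) = talg_act v x + talg_act v y.
Proof. by apply: (addIr (- talg_act v y)); rewrite -talg_actBr !addrK. Qed.

Lemma talg_act_tinj v n (y : tpow M n) : talg_act v (tinj y) = tact y v.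
Proof.
pose N := maxn (tbound (tinj y)) n.+1.
have lt_n : (n < N)%N by rewrite leq_max leqnn orbT.
rewrite (@talg_actE N) ?leq_maxl // (bigD1 (Ordinal lt_n)) //= big1 ?addr0.
  by rewrite -[tinj_fun y n]/(tinj y n) tinjE.
move=> i ne_i; rewrite -[tinj_fun y i]/(tinj y i) tinj_neq ?tact0l // => e.
by move/eqP: ne_i; apply; apply: val_inj.
Qed.

Lemma talg_act_tin0 v (r : R) : talg_act v (tin0 M r) = ract v r.
Proof. exact: talg_act_tinj. Qed.

Lemma talg_act_tin1 v x m : talg_act v (x * tin1 m) = mu (talg_act v x) m.
Proof.
have mu0 : mu 0 m = 0 by apply: (addIr (mu 0 m)); rewrite -muDl !add0r.
rewrite mul_tin1; pose N := maxn (tbound (tshift m x)) (tbound x).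
rewrite (@talg_actE N.+1) ?leqW ?leq_maxl // (@talg_actE N v x) ?leq_maxr //.
rewrite big_ord_recl [X in X + _](@tact0l 0) add0r.
rewrite (big_morph (mu^~ m) (fun v w => muDl v w m) mu0).
by apply: eq_bigr => n _; apply: tact_tens.
Qed.

Lemma talg_actM v x y : talg_act v (x * y) = talg_act (talg_act v x) y.
Proof.
apply: (talg_ind (S := fun y => talg_act v (x * y) = talg_act (talg_act v x) y))
  => [|r|{}y m IHy].
- have act0 w : talg_act w 0 = 0 by have := talg_actBr w 0 0; rewrite !subrr.
  split=> [|y1 y2 IH1 IH2]; first by rewrite mulr0 !act0.
  by rewrite mulrBr !talg_actBr IH1 IH2.
- rewrite talg_act_tin0 mul_tin0.
  pose N := maxn (tbound (talg_ract (r : R^c) x)) (tbound x).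
  rewrite (@talg_actE N) ?leq_maxl // (@talg_actE N v x) ?leq_maxr //.
  by rewrite ract_suml; apply: eq_bigr => n _; apply: tact_ract.
- by rewrite mulrA !talg_act_tin1 IHy.
Qed.

End TensorAlgebraAction.

(** * The Jacobson radical *)

Section Radical.
Variable R : nzRingType.
Implicit Types (I N : set R) (x e : R).

Lemma right_ideal1 I : right_ideal I -> I 1 -> I = [set: R]%classic.
Proof.
move=> [_ IM] I1; apply/funext => x; apply/propext; split=> // _.
by rewrite -[x]mul1r; apply: IM.
Qed.

(** If a maximal right ideal I did not contain N, then 1 = i + n with i in I and n in N nilpotent.
    The geometric series inverts i = 1 - n, so I would contain 1. *)
Lemma nil_right_ideal_radical N : right_ideal N ->
  (forall x, N x -> exists n, x ^+ n = 0) -> forall x, N x -> radical x.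
Proof.
move=> [Ng NM] Nnil x Nx I [[Ig IM] /eqP IT Imax].
pose K := (fun y => exists i n, [/\ I i, N n & y = i + n]) : set R.
have Kideal : right_ideal K.
  split=> [|_ a [i [n [Ii Nn ->]]]].
    split=> [|_ _ [i [n [Ii Nn ->]]] [i' [n' [Ii' Nn' ->]]]].
      by exists 0, 0; split; rewrite ?addr0 //; apply: subgroup0.
    exists (i - i'), (n - n'); split; last by rewrite opprD addrACA.
      exact: (subgroupB Ig).
    exact: (subgroupB Ng).
  by exists (i * a), (n * a); rewrite -mulrDl; split; [apply: IM|apply: NM|].
have IK : (I `<=` K)%classic.
  by move=> i Ii; exists i, 0; rewrite addr0; split=> //; apply: subgroup0.
have [KI|KT] := Imax K Kideal IK.
  rewrite -KI; exists 0, x; rewrite add0r; split=> //; exact: subgroup0.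
have [i [n [Ii Nn n1]]] : K 1 by rewrite KT.
have [s ns0] := Nnil n Nn; case: IT; apply: right_ideal1 => //.
have : I (i * \sum_(j < s) n ^+ j) by apply: IM.
have -> : i = - (n - 1) by rewrite n1 opprB addrK.
by rewrite mulNr -subrX1 ns0 sub0r opprK.
Qed.

(* Zorn gives a right ideal maximal among those that contain 1 - e and not e; *)
(* it is a maximal right ideal.                                               *)
Lemma radical_idempotent e : e * e = e -> radical e -> e = 0.
Proof.
move=> ee rad_e; apply: contrapT => e0.
pose good I := [/\ right_ideal I, I (1 - e) & ~ I e].
pose P := (fun I => I = set0 \/ good I) : set (set R).
have [F FP Ftot|I [PI Imax]] := @Zorn_bigcup R P.
  have [[J [FJ [JR J1e Je]]]|noF] := pselect (exists J, F J /\ good J); last first.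
    left; rewrite -subset0 => x [J FJ Jx].
    have [J0|gJ] := FP J FJ; first by rewrite J0 in Jx.
    by apply: noF; exists J.
  have Fgood K x : F K -> K x -> good K.
    by move=> FK Kx; have [K0|//] := FP K FK; rewrite K0 in Kx.
  right; split; [split; [split|]| |].
  - by exists J => //; apply: subgroup0 JR.1.
  - move=> x y [K FK Kx] [L FL Ly]; have [KL|LK] := Ftot K L FK FL.
      have [[Lg _] _ _] := Fgood L y FL Ly.
      by exists L => //; apply: (subgroupB Lg) => //; apply: KL.
    have [[Kg _] _ _] := Fgood K x FK Kx.
    by exists K => //; apply: (subgroupB Kg) => //; apply: LK.
  - move=> x a [K FK Kx]; have [[_ KM] _ _] := Fgood K x FK Kx.
    by exists K => //; apply: KM.
  - by exists J.
  - by move=> [K FK Ke]; have [_ _] := Fgood K e FK Ke.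
have principal : good (fun x => exists a, x = (1 - e) * a).
  split; [split; [split|]| |].
  - by exists 0; rewrite mulr0.
  - by move=> _ _ [a ->] [b ->]; exists (a - b); rewrite mulrBr.
  - by move=> _ b [a ->]; exists (a * b); rewrite mulrA.
  - by exists 1; rewrite mulr1.
  - move=> [a ea]; apply: e0; rewrite -ee [X in _ * X]ea mulrA mulrBr mulr1.
    by rewrite ee subrr mul0r.
have [I0|[IR I1e Ie]] := PI.
  apply: (Imax _ _ (or_intror principal)); rewrite I0; split=> // /(_ (1 - e)).
  by apply; exists 1; rewrite mulr1.
apply: (Ie); apply: rad_e; split=> //.
  by apply/eqP => IT; apply: Ie; rewrite IT.
move=> K KR IK; have [->|/eqP KI] := eqVneq K I; [by left|right].
(* If K misses 1, then it misses e, because 1 = (1 - e) + e; K is then good and contradicts the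
   maximality of I. *)
apply: right_ideal1 => //; apply: contrapT => K1.
apply: (Imax K); last first.
  right; split=> // [|Ke]; first exact: IK.
  by apply: K1; rewrite -[1](subrK e); apply: (subgroupD KR.1) => //; apply: IK.
split=> // KI'; apply: KI; apply/seteqP; split=> //.
Qed.

End Radical.

(** * The rank of a free bimodule *)

(** A basis with its dual coordinates, as data that can be transported: the B_p carry no vector
    space structure with dimension, and receive a basis from the A_j. *)
Record kbasis (k : fieldType) (A : lmodType k) := KBasis {
  kb_dim : nat;
  kb_elt : 'I_kb_dim -> A;
  kb_coord : 'I_kb_dim -> A -> k;
  kb_dim_gt0 : (0 < kb_dim)%N;
  kb_coordD : forall i, {morph kb_coord i : a b / a + b};
  kb_coordZ : forall i c, {morph kb_coord i : a / c *: a >-> c * a};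
  kb_coordE : forall i j, kb_coord i (kb_elt j) = (i == j)%:R;
  kb_sum : forall a, a = \sum_i kb_coord i a *: kb_elt i
}.

Arguments kb_elt {k A} _ _.
Arguments kb_coord {k A} _ _ _.

Section TransportBasis.
Variables (k : fieldType) (A B : lmodType k) (u : kbasis A).
Variables (f : B -> A) (g : A -> B).
Hypotheses (fD : {morph f : a b / a + b}) (fZ : forall c, {morph f : a / c *: a}).
Hypotheses (fK : cancel f g) (gK : cancel g f).

Let coordD i : {morph (fun b => kb_coord u i (f b)) : a b / a + b}.
Proof. by move=> a b; rewrite fD kb_coordD. Qed.

Let coordZ i c : {morph (fun b => kb_coord u i (f b)) : a / c *: a >-> c * a}.
Proof. by move=> a; rewrite fZ kb_coordZ. Qed.

Let coordE i j : kb_coord u i (f (g (kb_elt u j))) = (i == j)%:R.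
Proof. by rewrite gK kb_coordE. Qed.

Let sum_coord b : b = \sum_i kb_coord u i (f b) *: g (kb_elt u i).
Proof.
apply: (can_inj fK); have f0 : f 0 = 0 by apply: (addIr (f 0)); rewrite -fD !add0r.
rewrite (big_morph f fD f0) [LHS](kb_sum u).
by apply: eq_bigr => i _; rewrite fZ gK.
Qed.

Definition transport_kbasis : kbasis B :=
  KBasis (kb_dim_gt0 u) coordD coordZ coordE sum_coord.

End TransportBasis.

Section FalgBasis.
Variables (k : fieldType) (E : falgType k).
Let b := vbasis {:E}.

Let coordD i : {morph coord b i : x y / x + y}. Proof. exact: linearD. Qed.
Let coordZ i c : {morph coord b i : x / c *: x >-> c * x}. Proof. exact: linearZ. Qed.
Let coordE i (j : 'I_(\dim {:E})) : coord b i b`_j = (i == j)%:R.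
Proof. by rewrite coord_free ?(basis_free (vbasisP _)) // eq_sym. Qed.
Let sum_coord x : x = \sum_(i < \dim {:E}) coord b i x *: b`_i.
Proof. exact: coord_vbasis (memvf x). Qed.

Definition falg_kbasis : kbasis E :=
  KBasis (adim_gt0 {:E}%AS) coordD coordZ coordE sum_coord.

End FalgBasis.

Section BasisOfAlgebra.
Variables (k : fieldType) (A : algType k) (u : kbasis A).

Lemma kb_coord_sum (J : finType) i (F : J -> A) :
  kb_coord u i (\sum_j F j) = \sum_j kb_coord u i (F j).
Proof.
apply: (big_morph _ (@kb_coordD _ _ u i)).
by apply: (addIr (kb_coord u i 0)); rewrite -kb_coordD !add0r.
Qed.

Lemma kb_coord_mull i a b :
  kb_coord u i (a * b) = \sum_j kb_coord u j a * kb_coord u i (kb_elt u j * b).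
Proof.
rewrite {1}(kb_sum u a) mulr_suml kb_coord_sum.
by apply: eq_bigr => j _; rewrite -scalerAl kb_coordZ.
Qed.

Lemma kb_coord_mulr i a b :
  kb_coord u i (a * b) = \sum_j kb_coord u j b * kb_coord u i (a * kb_elt u j).
Proof.
rewrite {1}(kb_sum u b) mulr_sumr kb_coord_sum.
by apply: eq_bigr => j _; rewrite -scalerAr kb_coordZ.
Qed.

End BasisOfAlgebra.

Section FreeBimoduleRank.
Variables (k : fieldType) (A B : algType k) (u : kbasis A) (w : kbasis B).
Variable X : finType.
Local Notation F := (fbim A B X).
Local Notation I := (X * 'I_(kb_dim u) * 'I_(kb_dim w))%type.

(** The coordinates with respect to the elements u_i x w_j, for the given bases u of A and w of
    B. *)
Let entry (e : I) (a : A) (x : X) (b : B) : k :=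
  (x == e.1.1)%:R * (kb_coord u e.1.2 a * kb_coord w e.2 b).

Let entryDl e a a' x b : entry e (a + a') x b = entry e a x b + entry e a' x b.
Proof. by rewrite /entry kb_coordD mulrDl mulrDr. Qed.

Let entryDr e a x b b' : entry e a x (b + b') = entry e a x b + entry e a x b'.
Proof. by rewrite /entry kb_coordD !mulrDr. Qed.

Let entryZ e c a x b : entry e (c *: a) x b = entry e a x (c *: b).
Proof. by rewrite /entry !kb_coordZ -!mulrA (mulrCA c). Qed.

Definition fbim_coord (e : I) : F -> k := fbim_lift (entry e).

Lemma fbim_coordE e a x b :
  fbim_coord e (fbelt a x b) = (x == e.1.1)%:R * (kb_coord u e.1.2 a * kb_coord w e.2 b).
Proof. exact: fbim_liftE (@entryDl e) (@entryDr e) (@entryZ e) _ _ _. Qed.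

Lemma fbim_coordB e : {morph fbim_coord e : y z / y - z}.
Proof. exact: fbim_liftB (@entryDl e) (@entryDr e) (@entryZ e). Qed.

Definition fbim_row (z : F) : 'rV[k]_#|{: I}| := \row_i fbim_coord (enum_val i) z.

Lemma fbim_rowB : {morph fbim_row : y z / y - z}.
Proof. by move=> y z; apply/rowP => i; rewrite !mxE fbim_coordB. Qed.

Lemma fbim_row0 : fbim_row 0 = 0.
Proof. by have := fbim_rowB 0 0; rewrite !subrr. Qed.

Lemma fbim_row_act a b z :
  fbim_row (fbim_act a b z) =
  \sum_i \sum_j (kb_coord u i a * kb_coord w j b) *:
    fbim_row (fbim_act (kb_elt u i) (kb_elt w j) z).
Proof.
elim/fbim_ind: z => [|y z IHy IHz|a' x b'].
- rewrite fbim_act0 fbim_row0 big1 // => i _; rewrite big1 // => j _.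
  by rewrite fbim_act0 fbim_row0 scaler0.
- rewrite fbim_actB fbim_rowB IHy IHz -sumrB; apply: eq_bigr => i _.
  by rewrite -sumrB; apply: eq_bigr => j _; rewrite fbim_actB fbim_rowB scalerBr.
apply/rowP => e; rewrite mxE fbim_actE fbim_coordE summxE.
rewrite kb_coord_mull kb_coord_mulr mulr_suml mulr_sumr; apply: eq_bigr => i _.
rewrite !mulr_sumr summxE; apply: eq_bigr => j _.
by rewrite !mxE fbim_actE fbim_coordE [RHS]mulrCA; congr (_ * _); rewrite mulrACA.
Qed.

Lemma fbim_row_basis (e : 'I_#|{: I}|) :
  fbim_row (fbelt (kb_elt u (enum_val e).1.2) (enum_val e).1.1 (kb_elt w (enum_val e).2))
  = delta_mx ord0 e.
Proof.
apply/rowP => e'; rewrite !mxE fbim_coordE !kb_coordE eqxx /= -!natrM !mulnb.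
congr (_%:R); congr nat_of_bool.
rewrite -(inj_eq enum_val_inj) (eq_sym (enum_val e).1.1) andbA.
by rewrite -!pair_eqE.
Qed.

(** The u_i y_l w_j span the bimodule over k, so its dimension #|X| dim A dim B is at most n dim A
    dim B, and the two dimensions are positive. *)
Lemma free_bimod_rank n (y : 'I_n -> F) :
  (forall z, addspan (fun z => exists a l b, z = fbim_act a b (y l)) z) ->
  (#|X| <= n)%N.
Proof.
move=> gen; pose J := ('I_n * 'I_(kb_dim u) * 'I_(kb_dim w))%type.
pose G := \matrix_(i < #|{: J}|) fbim_row
  (let e := enum_val i in fbim_act (kb_elt u e.1.2) (kb_elt w e.2) (y e.1.1)).
have sub_G z : (fbim_row z <= G)%MS.
  move: z (gen z); apply: addspan_sub => [|_ [a [l [b ->]]]].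
    split=> [|y1 y2 s1 s2]; first by rewrite fbim_row0 sub0mx.
    by rewrite fbim_rowB addmx_sub ?eqmx_opp.
  rewrite fbim_row_act; apply: summx_sub => i _; apply: summx_sub => j _.
  apply: scalemx_sub; have := row_sub (enum_rank (l, i, j) : 'I_#|{: J}|) G.
  by rewrite rowK enum_rankK.
have : (1%:M <= G)%MS.
  by apply/row_subP => e; rewrite row1 -fbim_row_basis.
move/mxrankS; rewrite mxrank1 => /leq_trans/(_ (rank_leq_row G)).
by rewrite !card_prod !card_ord -!mulnA leq_pmul2r // muln_gt0 !kb_dim_gt0.
Qed.

End FreeBimoduleRank.

(** * Finite-dimensional subspaces *)

Section FinitelySpanned.
Variables (k : fieldType) (A : algType k).
Implicit Types (S : set A).

Definition kspan (I : finType) (g : I -> A) : set A :=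
  fun a => exists c : I -> k, a = \sum_i c i *: g i.

Lemma kspan_subgroup (I : finType) (g : I -> A) : subgroup (kspan g).
Proof.
split=> [|_ _ [c ->] [d ->]].
  by exists (fun=> 0); rewrite big1 // => i _; rewrite scale0r.
by exists (fun i => c i - d i); rewrite -sumrB; apply: eq_bigr => i _; rewrite scalerBl.
Qed.

Lemma kspanZ (I : finType) (g : I -> A) c a : kspan g a -> kspan g (c *: a).
Proof.
move=> [d ->]; exists (fun i => c * d i); rewrite scaler_sumr.
by apply: eq_bigr => i _; rewrite scalerA.
Qed.

Lemma kspan_gen (I : finType) (g : I -> A) i : kspan g (g i).
Proof.
exists (fun j => (j == i)%:R); rewrite (bigD1 i) //= eqxx scale1r big1 ?addr0 //.
by move=> j /negPf ->; rewrite scale0r.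
Qed.

Definition finite_span S := exists (I : finType) (g : I -> A), forall a, S a -> kspan g a.

Lemma finite_span_addspan S : finite_span S -> finite_span (addspan S).
Proof.
move=> [I [g gS]]; exists I, g; apply: addspan_sub => //; exact: kspan_subgroup.
Qed.

Lemma finite_span_sub S S' :
  finite_span S -> (forall a, S' a -> addspan S a) -> finite_span S'.
Proof. by move=> /finite_span_addspan[I [g gS]] sub; exists I, g => a /sub; apply: gS. Qed.

Lemma finite_span_bigU (J : finType) (S : J -> set A) :
  (forall j, finite_span (S j)) -> finite_span (fun a => exists j, S j a).
Proof.
move=> Sfin; pose I j := sval (cid (Sfin j)).
pose g j : I j -> A := sval (cid (svalP (cid (Sfin j)))).
have gS j a : S j a -> kspan (@g j) a by apply: (svalP (cid (svalP (cid (Sfin j))))).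
exists {j : J & I j}, (fun p => g (tag p) (tagged p)) => _ [j /gS[c ->]].
apply: (subgroup_sum (kspan_subgroup _)) => i _; apply: kspanZ.
exact: (kspan_gen (fun p : {j & I j} => g (tag p) (tagged p)) (Tagged I i)).
Qed.

Lemma finite_span_fin (I : finType) (g : I -> A) :
  finite_span (fun a => exists i, a = g i).
Proof. by exists I, g => _ [i ->]; apply: kspan_gen. Qed.

Lemma finite_span_mul S S' : finite_span S -> finite_span S' ->
  finite_span (fun c => exists a b, [/\ S a, S' b & c = a * b]).
Proof.
move=> [I [g gS]] [J [h hS]]; exists (I * J)%type, (fun p => g p.1 * h p.2).
move=> _ [_ [_ [/gS[c ->] /hS[d ->] ->]]]; rewrite mulr_suml.
apply: (subgroup_sum (kspan_subgroup _)) => i _; rewrite mulr_sumr.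
apply: (subgroup_sum (kspan_subgroup _)) => j _.
rewrite -scalerAl -scalerAr; do 2 apply: kspanZ.
exact: (kspan_gen (fun p => g p.1 * h p.2) (i, j)).
Qed.

Lemma finite_spanT : (exists2 S, finite_span S & forall a, addspan S a) ->
  exists n (g : 'I_n -> A), forall a, exists c : 'I_n -> k, a = \sum_l c l *: g l.
Proof.
move=> [S /finite_span_addspan[I [g gS]] ST].
exists #|I|, (fun l => g (enum_val l)) => a; have [c ->] := gS a (ST a).
exists (fun l => c (enum_val l)).
by rewrite (reindex (@enum_val I predT)) //; apply/onW_bij/enum_val_bij.
Qed.

End FinitelySpanned.

(** * The natural quiver of a finite-dimensional tensor algebra *)

Lemma simple_ring_ideal (R : nzRingType) (I : set R) : simple_ring R ->
  subgroup I -> (forall x a, I x -> I (x * a)) -> (forall a x, I x -> I (a * x)) ->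
  forall x, I x -> x <> 0 -> I 1.
Proof.
move=> R_simple Ig Ir Il x Ix x0.
by have [|I0|->//] := R_simple I; last by case: x0; rewrite I0 in Ix.
Qed.

Lemma fbim_act_0l (k : fieldType) (A B : algType k) (X : choiceType) b (z : fbim A B X) :
  fbim_act 0 b z = 0.
Proof.
have -> : fbim_act 0 b z = fbim_act 0 1 (fbim_act 1 b z).
  by rewrite fbim_actA !mulr1.
by apply: (addIr (fbim_act 0 1 (fbim_act 1 b z))); rewrite -fbim_actDl !add0r.
Qed.

Lemma fbim_act_0r (k : fieldType) (A B : algType k) (X : choiceType) a (z : fbim A B X) :
  fbim_act a 0 z = 0.
Proof.
have -> : fbim_act a 0 z = fbim_act 1 0 (fbim_act a 1 z).
  by rewrite fbim_actA !mul1r.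
by apply: (addIr (fbim_act 1 0 (fbim_act a 1 z))); rewrite -fbim_actDr !add0r.
Qed.

Section RadicalOfQuotient.
Variables (k : fieldType) (A : algType k) (Q : quiver) (B : Q -> algType k) (q0 : Q).
Local Notation R := (prodalg q0 B).
Local Notation M := (path_bimod B q0).
Local Notation T := (gpa B q0).
Variable f : {lrmorphism T -> A}.
Hypothesis f_surj : forall a, exists x, f x = a.
Hypothesis f_inj : injective f.
Hypothesis f_nil : exists s, forall x, idexp (@gpaJ k Q B q0) s x -> f x = 0.
Hypothesis B_simple : forall i, simple_ring (B i).
Variable D : radical_quotient A.
Local Notation n := (rq_size D).
Local Notation C := (@rq_comp k A D).
Implicit Types (x y : talg M) (a : A) (r : R).

Let fB x y : f (x - y) = f x - f y. Proof. exact: rmorphB. Qed.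
Let fD x y : f (x + y) = f x + f y. Proof. exact: rmorphD. Qed.
Let fM x y : f (x * y) = f x * f y. Proof. exact: rmorphM. Qed.
Let f1 : f (1 : talg M) = 1. Proof. exact: rmorph1. Qed.
Let f0 : f (0 : talg M) = 0. Proof. exact: rmorph0. Qed.
Let fZ c x : f (c *: x) = c *: f x. Proof. exact: linearZ_LR. Qed.
Let f_sum (I : finType) (F : I -> talg M) : f (\sum_i F i) = \sum_i f (F i).
Proof. exact: raddf_sum. Qed.

Let pB (j : 'I_n) a b : rq_proj j (a - b) = rq_proj j a - rq_proj j b.
Proof. exact: rmorphB. Qed.
Let pM (j : 'I_n) a b : rq_proj j (a * b) = rq_proj j a * rq_proj j b.
Proof. exact: rmorphM. Qed.

(** * The radical of A and the vertices of its natural quiver *)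

Lemma radical_subgroup : subgroup (@radical A).
Proof.
split=> [|a b /(rq_ker D) ra /(rq_ker D) rb]; apply/(rq_ker D) => i.
  exact: rmorph0.
by rewrite pB ra rb subrr.
Qed.

Lemma radicalM a b c : radical b -> radical (a * b * c).
Proof. by move=> /(rq_ker D) rb; apply/(rq_ker D) => i; rewrite !pM rb mulr0 mul0r. Qed.

(** f(J) is a right ideal whose elements are nilpotent, as f kills J^s. *)
Lemma tlow1_radical x : tlow 1 x -> radical (f x).
Proof.
move=> x1; pose N := (fun a => exists2 x, tlow 1 x & f x = a) : set A.
apply: (nil_right_ideal_radical (N := N)); last by exists x.
- split=> [|_ a [y y1 <-]]; first split.
  + by exists 0; rewrite ?f0.
  + move=> _ _ [y y1 <-] [z z1 <-]; exists (y - z); rewrite ?fB //.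
    exact: (subgroupB (tlow_subgroup _ _)).
  + have [z <-] := f_surj a; exists (y * z); rewrite ?fM //.
    exact: (@tlowM _ _ _ 1 0).
- move=> _ [y y1 <-]; have [s s0] := f_nil; exists s.
  have <- : f (y ^+ s) = f y ^+ s by exact: rmorphXn.
  apply: s0.
  elim: s => [//|s IHs]; apply: addspan_incl; exists (y ^+ s), y.
  by rewrite exprSr; split=> //; apply/tlow1P.
Qed.

Definition single p (b : B p) : R := dsingle b.
(** The map that the projection A -> A_j induces on R = T/J; by [rq_projE] it determines that
    projection. *)
Definition vproj (j : 'I_n) r : C j := rq_proj j (f (tin0 M r)).

Lemma singleB p : {morph @single p : b c / b - c}.
Proof. exact: dsingleB. Qed.

Lemma singleE p (b : B p) : single b p = b.
Proof. exact: dsingleE. Qed.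

Lemma single_neq p q (b : B p) : p != q -> single b q = 0.
Proof. exact: dsingle_neq. Qed.

Lemma mul_single p (b : B p) r : single b * r = single (b * r p).
Proof.
apply: dprodP => q; rewrite -[LHS]/(single b q * r q).
have [e|ne] := eqVneq p q; first by case: q / e; rewrite !singleE.
by rewrite !single_neq ?mul0r.
Qed.

Lemma single_mul p (b : B p) r : r * single b = single (r p * b).
Proof.
apply: dprodP => q; rewrite -[LHS]/(r q * single b q).
have [e|ne] := eqVneq p q; first by case: q / e; rewrite !singleE.
by rewrite !single_neq ?mulr0.
Qed.

Lemma singleZ p c (b : B p) : single (c *: b) = c *: single b.
Proof.
apply: dprodP => q; rewrite -[RHS]/(c *: single b q).
have [e|ne] := eqVneq p q; first by case: q / e; rewrite !singleE.
by rewrite !single_neq ?scaler0.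
Qed.

Lemma vprojB j : {morph vproj j : r s / r - s}.
Proof. by move=> r s; rewrite /vproj tin0B fB pB. Qed.

Lemma vprojM j : {morph vproj j : r s / r * s}.
Proof. by move=> r s; rewrite /vproj tin0M fM pM. Qed.

Lemma vproj1 j : vproj j 1 = 1.
Proof. by rewrite /vproj tin0_1 f1 rmorph1. Qed.

Lemma vprojZ j c : {morph vproj j : r / c *: r}.
Proof. by move=> r; rewrite /vproj tin0Z fZ linearZ_LR. Qed.

Lemma rq_projE (j : 'I_n) x : rq_proj j (f x) = vproj j (x 0%N).
Proof.
have /(rq_ker D)/(_ j) := tlow1_radical (tlow1_sub_deg0 x).
by rewrite fB pB => /eqP; rewrite subr_eq0 => /eqP.
Qed.

Lemma vproj_surj (c : forall j, C j) : exists r, forall j, vproj j r = c j.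
Proof.
have [a aE] := rq_surj c; have [x xa] := f_surj a.
by exists (x 0%N) => j; rewrite -rq_projE xa aE.
Qed.

(** If r p were nonzero, simplicity of B p would put the idempotent e_p in the common kernel. Then
    f(e_p) is an idempotent of the radical, hence 0, against the injectivity of f. *)
Lemma vproj_inj r : (forall j, vproj j r = 0) -> r = 0.
Proof.
move=> r0; apply: dprodP => p; apply: contrapT => rp0.
have rad b : radical (f (tin0 M b)) <-> (forall j, vproj j b = 0).
  exact: (rq_ker D).
pose I := (fun b => forall j, vproj j (single b) = 0) : set (B p).
have I1 : I 1.
  apply: (simple_ring_ideal (I := I) (@B_simple p) _ _ _ _ rp0).
  - split=> [|b c Ib Ic] j.
      have -> : single (0 : B p) = 0 by apply: dsingle0.
      by rewrite -[0](subrr (0 : R)) vprojB subrr.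
    by rewrite singleB vprojB Ib Ic subrr.
  - move=> b c Ib j; have -> : single (b * c) = single b * single c.
      by rewrite mul_single singleE.
    by rewrite vprojM Ib mul0r.
  - move=> c b Ib j; have -> : single (c * b) = single c * single b.
      by rewrite mul_single singleE.
    by rewrite vprojM Ib mulr0.
  - by move=> j; rewrite -[r p]mulr1 -single_mul vprojM r0 mul0r.
have /radical_idempotent : f (tin0 M (single (1 : B p))) * f (tin0 M (single (1 : B p)))
    = f (tin0 M (single (1 : B p))).
  by rewrite -fM -tin0M mul_single singleE mulr1.
move/(_ (proj2 (rad _) I1)); rewrite -f0 => /f_inj.
move/(congr1 (fun x : talg M => x 0%N)); rewrite /tin0 tinjE.
move/(congr1 (fun r : R => r p)); rewrite singleE => /eqP.
by rewrite -[_ == _]/((1 : B p) == 0) oner_eq0.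
Qed.

Lemma radicalE a : radical a <-> exists2 x, tlow 1 x & f x = a.
Proof.
split=> [|[x x1 <-]]; last exact: tlow1_radical.
have [x <-] := f_surj a => /(rq_ker D) xr; exists x => // -[|//] _.
by apply: (@vproj_inj (x 0%N)) => j; rewrite -rq_projE xr.
Qed.

Lemma vproj_onto j (c : C j) : exists r, vproj j r = c.
Proof. by have [r rE] := vproj_surj (dsingle c); exists r; rewrite rE dsingleE. Qed.

Lemma vproj_single_central j p (c : C j) :
  c * vproj j (single (1 : B p)) = vproj j (single (1 : B p)) * c.
Proof.
by have [r <-] := vproj_onto c; rewrite -!vprojM mul_single single_mul mulr1 mul1r.
Qed.

Lemma vproj_single_idem j p :
  vproj j (single (1 : B p)) * vproj j (single (1 : B p)) = vproj j (single (1 : B p)).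
Proof. by rewrite -vprojM mul_single singleE mulr1. Qed.

(** The images of the e_p in A_j are central idempotents of sum 1. One of them is nonzero; the ideal
    it generates is A_j, so it is invertible and equals 1. *)
Lemma vproj_vertex j : exists p, vproj j (single (1 : B p)) = 1.
Proof.
have [p zp0] : exists p, vproj j (single (1 : B p)) <> 0.
  apply: contrapT => no_p; move/eqP: (oner_neq0 (C j)); apply.
  have v0 : vproj j 0 = 0 by rewrite -(subrr (0 : R)) vprojB subrr.
  have vD : {morph vproj j : r s / r + s}.
    by move=> r s; apply: (addIr (- vproj j s)); rewrite -vprojB !addrK.
  rewrite -(vproj1 j) -[1 in LHS](sum_dsingle (1 : R)) (big_morph (vproj j) vD v0).
  by apply: big1 => p _; apply: contrapT => zp0; apply: no_p; exists p.
exists p; set z := vproj j _ in zp0 *.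
have [c zc] : exists c, 1 = z * c.
  apply: (simple_ring_ideal (I := fun c => exists c', c = z * c')
           (@rq_simple _ _ D j) _ _ _ _ zp0).
  - split=> [|_ _ [c ->] [d ->]]; first by exists 0; rewrite mulr0.
    by exists (c - d); rewrite mulrBr.
  - by move=> _ d [c ->]; exists (c * d); rewrite mulrA.
  - by move=> d _ [c ->]; exists (d * c); rewrite !mulrA vproj_single_central.
  - by exists 1; rewrite mulr1.
by rewrite -[LHS]mulr1 zc mulrA vproj_single_idem.
Qed.

Definition vertex_of j : Q := sval (cid (vproj_vertex j)).

Lemma vproj_vertex_of j : vproj j (single (1 : B (vertex_of j))) = 1.
Proof. exact: svalP (cid (vproj_vertex j)). Qed.

(** The isomorphism of B (vertex_of j) with A_j: injective because the source is simple, surjective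
    because [vproj j] factors through it ([vprojE]). *)
Definition theta j (b : B (vertex_of j)) : C j := vproj j (single b).

Lemma thetaB j : {morph @theta j : b c / b - c}.
Proof. by move=> b c; rewrite /theta singleB vprojB. Qed.

Lemma thetaM j : {morph @theta j : b c / b * c}.
Proof. by move=> b c; rewrite /theta -vprojM mul_single singleE. Qed.

Lemma theta1 j : theta (1 : B (vertex_of j)) = 1.
Proof. exact: vproj_vertex_of. Qed.

Lemma thetaZ j c : {morph @theta j : b / c *: b}.
Proof. by move=> b; rewrite /theta singleZ vprojZ. Qed.

Lemma theta0 j : theta (0 : B (vertex_of j)) = 0.
Proof. by have := thetaB (0 : B (vertex_of j)) 0; rewrite !subrr. Qed.

Lemma thetaD j : {morph @theta j : b c / b + c}.
Proof. by move=> b c; apply: (addIr (- theta c)); rewrite -thetaB !addrK. Qed.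

Lemma vprojE j r : vproj j r = theta (r (vertex_of j)).
Proof.
rewrite /theta -[r (vertex_of j)]mulr1 -single_mul vprojM vproj_vertex_of.
by rewrite mulr1.
Qed.

Lemma theta_inj j : injective (@theta j).
Proof.
move=> b c bc; apply/eqP; rewrite -subr_eq0; apply/eqP; apply: contrapT => bc0.
move/eqP: (oner_neq0 (C j)); apply; rewrite -theta1.
apply: (simple_ring_ideal (I := fun b => theta b = 0) (@B_simple (vertex_of j)) _ _ _ _ bc0).
- split=> [|b1 b2 b10 b20]; first exact: theta0.
  by rewrite thetaB b10 b20 subrr.
- by move=> b1 b2 b10; rewrite thetaM b10 mul0r.
- by move=> b1 b2 b20; rewrite thetaM b20 mulr0.
- by rewrite thetaB bc subrr.
Qed.

Lemma theta_surj j c : exists b, @theta j b = c.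
Proof.
by have [r rE] := vproj_onto c; exists (r (vertex_of j)); rewrite -vprojE.
Qed.

Definition thetaV j (c : C j) := sval (cid (theta_surj c)).

Lemma thetaVK j : cancel (@thetaV j) (@theta j).
Proof. by move=> c; apply: svalP (cid (theta_surj c)). Qed.

Lemma thetaK j : cancel (@theta j) (@thetaV j).
Proof. by move=> b; apply: theta_inj; rewrite thetaVK. Qed.

(** A maps onto the product of the A_i, so some element is 1 in A_i and 0 in A_j; this excludes that
    both depend on the same component of R. *)
Lemma vertex_of_inj : injective vertex_of.
Proof.
move=> i j ij; apply/eqP; apply: contrapT => /negP ne_ij.
have [r rE] := vproj_surj (dsingle (1 : C i)).
have rj0 : r (vertex_of j) = 0.
  by apply: theta_inj; rewrite -vprojE rE dsingle_neq // theta0.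
have ri0 : r (vertex_of i) = 0 by rewrite ij.
move/eqP: (oner_neq0 (C i)); apply; have := rE i.
by rewrite dsingleE => <-; rewrite vprojE ri0 theta0.
Qed.

(** Otherwise e_p would be killed by every [vproj j], against [vproj_inj]. *)
Lemma vertex_of_onto p : exists j, vertex_of j = p.
Proof.
apply: contrapT => no_j.
have /(congr1 (fun r : R => r p)) : single (1 : B p) = 0.
  apply: vproj_inj => j; rewrite vprojE single_neq ?theta0 //.
  by apply/eqP => pj; apply: no_j; exists j.
by rewrite singleE => /eqP; rewrite -[_ == _]/((1 : B p) == 0) oner_eq0.
Qed.

Definition vertex_kbasis j : kbasis (B (vertex_of j)) :=
  transport_kbasis (falg_kbasis (C j)) (@thetaD j) (fun c => @thetaZ j c)
    (@thetaK j) (@thetaVK j).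

(** * The arrows of the natural quiver *)

Let path_part (pq : Q * Q) : zmodType :=
  pm_bimod (p := path_premodulation B) pq.1 pq.2.

Definition single_path p q (z : fbim (B p) (B q) (arrow p q)) : M :=
  @dsingle _ path_part (p, q) z.

Lemma single_pathE p q z : @single_path p q z (p, q) = z.
Proof. exact: dsingleE. Qed.

Lemma single_path_neq p q z pq : (p, q) != pq -> @single_path p q z pq = 0.
Proof. exact: dsingle_neq. Qed.

Lemma single_pathB p q : {morph @single_path p q : y z / y - z}.
Proof. exact: (@dsingleB _ path_part (p, q)). Qed.

Lemma single_path0 p q : @single_path p q 0 = 0.
Proof. exact: (@dsingle0 _ path_part (p, q)). Qed.

Lemma path_actE (r s : R) (m : M) pq :
  (lact r ((s : R^c) *: m) : M) pq = fbim_act (r pq.1) (s pq.2) (m pq).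
Proof.
rewrite -[LHS]/(fbim_act (r pq.1) 1 (fbim_act 1 (s pq.2) (m pq))) fbim_actA.
by rewrite !mulr1.
Qed.

Lemma single_path_act (r s : R) p q z :
  lact r ((s : R^c) *: @single_path p q z) = single_path (fbim_act (r p) (s q) z).
Proof.
apply: dprodP => pq; rewrite path_actE.
have [e|ne] := eqVneq (p, q) pq; first by case: pq / e; rewrite !single_pathE.
by rewrite !single_path_neq ?fbim_act0.
Qed.

Definition finv a : talg M := sval (cid (f_surj a)).

Lemma finvK a : f (finv a) = a. Proof. exact: svalP (cid (f_surj a)). Qed.

Lemma finvfK x : finv (f x) = x. Proof. by apply: f_inj; rewrite finvK. Qed.

Lemma finvB : {morph finv : a b / a - b}.
Proof. by move=> a b; apply: f_inj; rewrite fB !finvK. Qed.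

Lemma finvD : {morph finv : a b / a + b}.
Proof. by move=> a b; apply: f_inj; rewrite fD !finvK. Qed.

Lemma finvM : {morph finv : a b / a * b}.
Proof. by move=> a b; apply: f_inj; rewrite fM !finvK. Qed.

Lemma radical2E a : idmul (@radical A) (@radical A) a <-> tpos2 (finv a).
Proof.
split=> [|ta].
  move: a; apply: addspan_sub => [|_ [_ [_ [/radicalE[x x1 <-] /radicalE[y y1 <-] ->]]]].
    by apply: (additive_subgroup finvB); apply: addspan_subgroup.
  by apply: addspan_incl; exists x, y; rewrite finvM !finvfK.
rewrite -[a]finvK; move: (finv a) ta.
apply: addspan_sub => [|_ [x [y [x1 y1 ->]]]].
  by apply: (additive_subgroup fB); apply: addspan_subgroup.
apply: addspan_incl; exists (f x), (f y); rewrite fM.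
by split=> //; apply: tlow1_radical.
Qed.

Lemma rq_ideal_vertex (j : 'I_n) a : rq_ideal j a ->
  forall p, p != vertex_of j -> finv a 0%N p = 0 :> B p.
Proof.
move=> ja p; have [i <-] := vertex_of_onto p => ne.
have ne_ij : i != j by apply: contraNneq ne => ->.
apply: theta_inj; rewrite -vprojE -rq_projE finvK theta0.
exact: ja.
Qed.

Lemma vertex_rq_ideal j (b : B (vertex_of j)) : rq_ideal j (f (tin0 M (single b))).
Proof.
move=> i ne_ij; rewrite -[LHS]/(vproj i _) vprojE single_neq ?theta0 //.
by apply: contraNneq ne_ij => /vertex_of_inj ->.
Qed.

Local Notation F i j := (fbim (B (vertex_of i)) (B (vertex_of j))
                              (arrow (vertex_of i) (vertex_of j))).

(** For a in the radical, the block at (i, j) of its class in r/r^2 = M. *)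
Definition arrow_part i j a : F i j := tdeg1 (finv a) (vertex_of i, vertex_of j).

Lemma arrow_partB i j : {morph arrow_part i j : a b / a - b}.
Proof. by move=> a b; rewrite /arrow_part finvB tdeg1B. Qed.

Lemma arrow_part_tin1 i j (z : F i j) :
  arrow_part i j (f (tin1 (single_path z))) = z.
Proof. by rewrite /arrow_part finvfK tdeg1_tin1 single_pathE. Qed.

Lemma arrow_part_mul i j a b c : radical b ->
  arrow_part i j (a * b * c) =
  fbim_act (finv a 0%N (vertex_of i)) (finv c 0%N (vertex_of j)) (arrow_part i j b).
Proof.
move=> /radicalE[x x1 <-]; rewrite /arrow_part !finvM tdeg1_mul ?finvfK //.
exact: (path_actE (finv a 0%N) (finv c 0%N) (tdeg1 x) (_, _)).
Qed.

Lemma rq_gen_radical (i j : 'I_n) (X : set A) : (forall a, X a -> radical a) ->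
  forall a, rq_gen i j X a -> radical a.
Proof.
move=> Xr; apply: addspan_sub => [|a [|[b [c [d [_ /Xr rc _ ->]]]]]].
- exact: radical_subgroup.
- apply: addspan_sub => [|_ [b [c [_ rc ->]]]]; first exact: radical_subgroup.
  by rewrite -[b * c]mulr1; apply: radicalM.
- exact: radicalM.
Qed.

Lemma rq_gen_single_path i j (z : F i j) :
  rq_gen i j (@radical A) (f (tin1 (single_path z))).
Proof.
apply: addspan_incl; right.
exists (f (tin0 M (single (1 : B (vertex_of i))))), (f (tin1 (single_path z))),
  (f (tin0 M (single (1 : B (vertex_of j))))).
split; [exact: vertex_rq_ideal| |exact: vertex_rq_ideal|].
  by apply: tlow1_radical; apply: tlow_tin1.
by rewrite -!fM -mulrA tin1_tin0 tin0_tin1 single_path_act !singleE fbim_act1.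
Qed.

(** [arrow_part] kills r^2 and turns generators of A_i (r/r^2) A_j into generators of the free
    bimodule on the arrows, to which [free_bimod_rank] applies. *)
Lemma rq_generated_lower (i j : 'I_n) m : rq_generated i j m ->
  (#|arrow (vertex_of i) (vertex_of j)| <= m)%N.
Proof.
move=> [y [y_gen y_span]].
have y_rad l : radical (y l) by apply: rq_gen_radical (y_gen l).
apply: (free_bimod_rank (vertex_kbasis i) (vertex_kbasis j)
  (y := fun l => arrow_part i j (y l))) => z.
rewrite -[z]arrow_part_tin1; move: (f _) (y_span _ (rq_gen_single_path z)).
apply: addspan_sub => [|a [/radical2E a2|[b [_ [c [_ [l _ <-] _ ->]]]]]].
- by apply: (additive_subgroup (@arrow_partB i j)); apply: addspan_subgroup.
- rewrite /arrow_part tdeg1_tlow2; last exact: tpos2_tlow2.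
  exact: subgroup0 (addspan_subgroup _).
- apply: addspan_incl; rewrite arrow_part_mul //.
  by exists (finv b 0%N (vertex_of i)), l, (finv c 0%N (vertex_of j)).
Qed.

Lemma rq_generated_upper (i j : 'I_n) :
  rq_generated i j #|arrow (vertex_of i) (vertex_of j)|.
Proof.
pose gen (x : arrow (vertex_of i) (vertex_of j)) : F i j := fbelt 1 x 1.
pose y (l : 'I_#|arrow (vertex_of i) (vertex_of j)|) :=
  f (tin1 (single_path (gen (enum_val l)))).
exists y; split=> [l|]; first exact: rq_gen_single_path.
have Sg : subgroup (rq_gen i j (range y)) by apply: addspan_subgroup.
have S_tin1 z : rq_gen i j (range y) (f (tin1 (@single_path (vertex_of i) (vertex_of j) z))).
  elim/fbim_ind: z => [|z z' IHz IHz'|b x c].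
  - by rewrite single_path0 tin1_0 f0; apply: subgroup0.
  - by rewrite single_pathB tin1B fB; apply: (subgroupB Sg).
  apply: addspan_incl; right.
  exists (f (tin0 M (single b))), (y (enum_rank x)), (f (tin0 M (single c))).
  split; [exact: vertex_rq_ideal|by exists (enum_rank x)|exact: vertex_rq_ideal|].
  rewrite /y enum_rankK -!fM -mulrA tin1_tin0 tin0_tin1 single_path_act !singleE.
  by rewrite /gen fbim_actE mulr1 mul1r.
apply: addspan_sub => [//|a [a2|[b [_ [c [ib /radicalE[x x1 <-] jc ->]]]]]].
  by apply: addspan_incl; left.
rewrite -[_ * _ * _]finvK; set w := finv _.
have w1 : tlow 1 w.
  rewrite /w !finvM finvfK; apply: (@tlowM _ _ _ 1 0) => //.
  exact: (@tlowM _ _ _ 0 1).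
rewrite -[w](subrK (tin1 (tdeg1 w))) fD; apply: (subgroupD Sg).
  by apply: addspan_incl; left; apply/radical2E; rewrite finvfK; apply: tlow1_sub_deg1.
(* The outer factors b and c have components of degree 0 only at the vertices i and j, so the
   degree-1 part of w is concentrated in one block. *)
suff -> : tdeg1 w = single_path (tdeg1 w (vertex_of i, vertex_of j)) by apply: S_tin1.
apply: dprodP => pq; have [<-|ne] := eqVneq (vertex_of i, vertex_of j) pq.
  by rewrite single_pathE.
rewrite single_path_neq // /w !finvM tdeg1_mul ?finvfK // path_actE.
case: pq ne => p q /=; rewrite xpair_eqE negb_and => /orP[ne|ne].
  by rewrite (rq_ideal_vertex ib) 1?eq_sym // fbim_act_0l.
by rewrite (rq_ideal_vertex jc) 1?eq_sym // fbim_act_0r.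
Qed.

Lemma natural_arrowE t : natural_arrow_number t ->
  forall i j : 'I_n, t i j = #|arrow (vertex_of i) (vertex_of j)|.
Proof.
move=> t_nat i j; have [t_gen t_min] := t_nat i j.
by apply/eqP; rewrite eqn_leq rq_generated_lower // t_min //; apply: rq_generated_upper.
Qed.

(** * The presentation of A by its natural quiver *)

Section NaturalPresentation.
Variable t : 'I_n -> 'I_n -> nat.
Hypothesis t_natural : natural_arrow_number t.
Local Notation P := (natural_premodulation t).
Local Notation G i j := (fbim (C i) (C j) 'I_(t i j)).

Definition arrow_code i j (x : arrow (vertex_of i) (vertex_of j)) : 'I_(t i j) :=
  cast_ord (esym (natural_arrowE t_natural i j)) (enum_rank x).

Definition arrow_decode i j (l : 'I_(t i j)) : arrow (vertex_of i) (vertex_of j) :=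
  enum_val (cast_ord (natural_arrowE t_natural i j) l).

Lemma arrow_decodeK i j : cancel (@arrow_decode i j) (@arrow_code i j).
Proof. by move=> l; rewrite /arrow_code enum_valK cast_ordK. Qed.

Lemma arrow_codeK i j : cancel (@arrow_code i j) (@arrow_decode i j).
Proof. by move=> z; rewrite /arrow_decode cast_ordKV enum_rankK. Qed.

Lemma thetaVB j : {morph @thetaV j : b c / b - c}.
Proof. by move=> b c; apply: theta_inj; rewrite thetaB !thetaVK. Qed.

Lemma thetaVM j : {morph @thetaV j : b c / b * c}.
Proof. by move=> b c; apply: theta_inj; rewrite thetaM !thetaVK. Qed.

Lemma thetaVZ j c : {morph @thetaV j : b / c *: b}.
Proof. by move=> b; apply: theta_inj; rewrite thetaZ !thetaVK. Qed.

Lemma thetaV1 j : thetaV (1 : C j) = 1.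
Proof. by apply: theta_inj; rewrite thetaVK theta1. Qed.

Definition vert j (c : C j) : A := f (tin0 M (single (thetaV c))).

Definition arr i j (l : 'I_(t i j)) : A :=
  f (tin1 (single_path (fbelt 1 (arrow_decode l) 1 : F i j))).

Lemma vertB j : {morph @vert j : b c / b - c}.
Proof. by move=> b c; rewrite /vert thetaVB singleB tin0B fB. Qed.

Lemma vertM j : {morph @vert j : b c / b * c}.
Proof. by move=> b c; rewrite /vert -fM -tin0M mul_single singleE thetaVM. Qed.

Lemma vertZ j c : {morph @vert j : b / c *: b}.
Proof. by move=> b; rewrite /vert thetaVZ singleZ tin0Z fZ. Qed.

Lemma vert_orth i j (b : C i) (c : C j) : i != j -> vert b * vert c = 0.
Proof.
move=> ne_ij; rewrite /vert -fM -tin0M mul_single single_neq ?mulr0.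
  by rewrite (_ : single 0 = 0) ?tin0_0 ?f0 //; apply: dsingle0.
by apply: contraNneq ne_ij => /vertex_of_inj ->.
Qed.

Lemma sum_vertex (r : R) : \sum_j single (r (vertex_of j)) = r.
Proof.
have [g vg gv] : bijective vertex_of.
  exists (fun p => sval (cid (vertex_of_onto p))) => [j|p].
    by apply: vertex_of_inj; apply: svalP (cid (vertex_of_onto _)).
  exact: svalP (cid (vertex_of_onto p)).
rewrite -[RHS]sum_dsingle (reindex vertex_of) //.
by exists g => p _; [apply: vg|apply: gv].
Qed.

Lemma tin0_sum (r : R) : tin0 M r = \sum_j tin0 M (single (r (vertex_of j))).
Proof.
by rewrite -[r in LHS]sum_vertex (big_morph _ (@tin0D _ _ M) (tin0_0 M)).
Qed.

Lemma vert_sum1 : \sum_j vert (1 : C j) = 1.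
Proof.
rewrite -f1 -(tin0_1 M) tin0_sum f_sum; apply: eq_bigr => j _.
by rewrite /vert thetaV1.
Qed.

Lemma vert_arr i j (l : 'I_(t i j)) : vert (1 : C i) * arr l = arr l.
Proof.
rewrite /vert /arr thetaV1 -fM -[tin1 _ in LHS]mulr1 -(tin0_1 M) tin1_tin0 tin0_tin1.
by rewrite single_path_act singleE fbim_act1.
Qed.

Lemma arr_vert i j (l : 'I_(t i j)) : arr l * vert (1 : C j) = arr l.
Proof.
rewrite /vert /arr thetaV1 -fM tin1_tin0 -[tin1 _ in LHS]mul1r -(tin0_1 M) tin0_tin1.
by rewrite single_path_act singleE fbim_act1.
Qed.

Lemma arrowsE i j b (x : arrow _ _) c : f (tin1 (single_path (fbelt b x c : F i j))) =
  vert (theta b) * arr (arrow_code x) * vert (theta c).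
Proof.
rewrite /vert /arr !thetaK arrow_codeK -!fM -mulrA tin1_tin0 tin0_tin1.
by rewrite single_path_act !singleE fbim_actE mulr1 mul1r.
Qed.

Lemma vert_arr_generate (S : set A) : subgroup S ->
  (forall a b, S a -> S b -> S (a * b)) -> (forall j (c : C j), S (vert c)) ->
  (forall i j (l : 'I_(t i j)), S (arr l)) -> forall a, S a.
Proof.
move=> Sg SM Svert Sarr a; rewrite -[a]finvK; move: (finv a) => {a}.
apply: (talg_ind (additive_subgroup fB Sg)) => [r|z m Sz].
  rewrite tin0_sum f_sum; apply: (subgroup_sum Sg) => j _.
  by rewrite -[r _]thetaK; apply: Svert.
rewrite fM; apply: (SM) => //; rewrite -[m](sum_dsingle (m : dprod path_part)).
rewrite (big_morph _ (@tin1D _ _ M) (tin1_0 M)) f_sum; apply: (subgroup_sum Sg) => -[p q] _.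
have [[i <-] [j <-]] := (vertex_of_onto p, vertex_of_onto q).
move: (m _) => {z Sz}z; rewrite -[dsingle _]/(@single_path (vertex_of i) (vertex_of j) z).
elim/fbim_ind: z => [|z z' IHz IHz'|b x c].
- by rewrite single_path0 tin1_0 f0; apply: subgroup0.
- by rewrite single_pathB tin1B fB; apply: (subgroupB Sg).
- by rewrite arrowsE; apply: (SM) => //; apply: SM.
Qed.

Section Transport.
Variables i j : 'I_n.

Let arrow_image (b : B (vertex_of i)) (z : arrow (vertex_of i) (vertex_of j))
  (c : B (vertex_of j)) : G i j := fbelt (theta b) (arrow_code z) (theta c).

(** Identifies the block of M at (i, j) with the bimodule of the natural pre-modulation,
    semilinearly along [theta]. *)
Definition arrow_map : F i j -> G i j := fbim_lift arrow_image.

Let imageDl b b' z c :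
  arrow_image (b + b') z c = arrow_image b z c + arrow_image b' z c.
Proof. by rewrite /arrow_image thetaD fbeltDl. Qed.

Let imageDr b z c c' :
  arrow_image b z (c + c') = arrow_image b z c + arrow_image b z c'.
Proof. by rewrite /arrow_image thetaD fbeltDr. Qed.

Let imageZ d b z c : arrow_image (d *: b) z c = arrow_image b z (d *: c).
Proof. by rewrite /arrow_image !thetaZ fbeltA. Qed.

Lemma arrow_mapE b z c :
  arrow_map (fbelt b z c) = fbelt (theta b) (arrow_code z) (theta c).
Proof. exact: fbim_liftE imageDl imageDr imageZ _ _ _. Qed.

Lemma arrow_mapB : {morph arrow_map : y z / y - z}.
Proof. exact: fbim_liftB imageDl imageDr imageZ. Qed.

Lemma arrow_map0 : arrow_map 0 = 0.
Proof. by have := arrow_mapB 0 0; rewrite !subrr. Qed.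

Lemma arrow_mapD : {morph arrow_map : y z / y + z}.
Proof. by move=> y z; apply: (addIr (- arrow_map z)); rewrite -arrow_mapB !addrK. Qed.

Lemma arrow_map_act b c z :
  arrow_map (fbim_act b c z) = fbim_act (theta b) (theta c) (arrow_map z).
Proof.
elim/fbim_ind: z => [|y z IHy IHz|b' x c'].
- by rewrite !(fbim_act0, arrow_map0).
- by rewrite fbim_actB !arrow_mapB IHy IHz fbim_actB.
- by rewrite fbim_actE !arrow_mapE fbim_actE !thetaM.
Qed.

End Transport.

Section Freeness.
Variable V : representation P.

Definition vertex_sum := dprod (fun j : 'I_n => V j).
HB.instance Definition _ := GRing.Zmodule.on vertex_sum.

Definition vertex_scale (r : R^c) (v : vertex_sum) : vertex_sum := fun j =>
  ract (v j) (vproj j r).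

Lemma vertex_scaleA (r s : R^c) v : vertex_scale r (vertex_scale s v) = vertex_scale (r * s) v.
Proof. by apply: dprodP => j; rewrite /vertex_scale -ractM -vprojM. Qed.

Lemma vertex_scale1 : left_id 1 vertex_scale.
Proof. by move=> v; apply: dprodP => j; rewrite /vertex_scale vproj1 ract1. Qed.

Lemma vertex_scaleDr : right_distributive vertex_scale +%R.
Proof. by move=> r v w; apply: dprodP => j; apply: ractDl. Qed.

Lemma vertex_scaleDl v : {morph vertex_scale^~ v : r s / r + s}.
Proof.
move=> r s; apply: dprodP => j; rewrite -[RHS]/(ract _ _ + ract _ _) -ractDr.
congr ract; apply: (addIr (- vproj j s)).
by rewrite -[LHS]vprojB !addrK.
Qed.

HB.instance Definition _ := GRing.Zmodule_isLmodule.Build R^c vertex_sum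
  vertex_scaleA vertex_scale1 vertex_scaleDr vertex_scaleDl.

Definition vertex_mul (v : vertex_sum) (m : M) : vertex_sum := fun j =>
  \sum_i rep_act (v i)
    (arrow_map (m (vertex_of i, vertex_of j)) : pm_bimod (p := P) i j).

Lemma vertex_mulDl v w m : vertex_mul (v + w) m = vertex_mul v m + vertex_mul w m.
Proof.
apply: dprodP => j; rewrite dprodDE -big_split; apply: eq_bigr => i _.
exact: rep_actDl.
Qed.

Lemma vertex_mulDr v m m' : vertex_mul v (m + m') = vertex_mul v m + vertex_mul v m'.
Proof.
apply: dprodP => j; rewrite dprodDE -big_split; apply: eq_bigr => i _.
by rewrite arrow_mapD rep_actDr.
Qed.

Lemma vertex_mulA v (r : R) m : vertex_mul (ract v r) m = vertex_mul v (lact r m).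
Proof.
apply: dprodP => j; apply: eq_bigr => i _; rewrite rep_actA vprojE.
congr rep_act; rewrite -[LHS]/(fbim_act _ 1 _) -(theta1 j) -arrow_map_act.
by [].
Qed.

Lemma vertex_mul_ract v m (r : R) :
  vertex_mul v ((r : R^c) *: m) = ract (vertex_mul v m) r.
Proof.
apply: dprodP => j; rewrite -[RHS]/(ract (vertex_mul v m j) (vproj j r)).
rewrite ract_suml; apply: eq_bigr => i _; rewrite -rep_act_ract vprojE.
congr rep_act; rewrite -[RHS]/(fbim_act 1 _ _) -(theta1 i) -arrow_map_act.
by [].
Qed.

(** The tensor algebra T acts on the sum of the V_j, and since f is bijective the action is carried
    over to A along [finv]. *)
Lemma vert_arr_free : exists act, acts_through (Q := natural_quiver t) (C := C)
  vert arr (V := V) act.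
Proof.
exists (fun v a => talg_act vertex_mul (v : vertex_sum) (finv a)).
have mM v x y := talg_actM vertex_mulDl vertex_mulDr vertex_mulA vertex_mul_ract v x y.
have m0 v r : talg_act vertex_mul v (tin0 M r) = ract v r.
  exact: (talg_act_tin0 vertex_mulDl vertex_mulDr vertex_mulA vertex_mul_ract).
split=> [v w a|v a b|v a b|v i c|v i j l].
- exact: (talg_actDl vertex_mulDl vertex_mulDr vertex_mulA vertex_mul_ract v w).
- rewrite finvD.
  exact: (talg_actDr vertex_mulDl vertex_mulDr vertex_mulA vertex_mul_ract).
- by rewrite finvM mM.
- rewrite /vert finvfK m0; apply: dprodP => j.
  rewrite -[LHS]/(ract (v j) (vproj j (single (thetaV c)))) vprojE.
  have [e|ne] := eqVneq i j; first by case: j / e; rewrite dsingleE singleE thetaVK.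
  rewrite dsingle_neq // single_neq ?theta0 ?ract0r //.
  by apply: contraNneq ne => /vertex_of_inj ->.
- rewrite /arr finvfK -[tin1 _]mul1r.
  rewrite (talg_act_tin1 vertex_mulDl vertex_mulDr vertex_mulA vertex_mul_ract).
  rewrite -(tin0_1 M) m0 ract1; apply: dprodP => j'.
  set z := fbelt _ _ _.
  have z0 i' : (i, j) != (i', j') ->
      single_path z (vertex_of i', vertex_of j') = 0.
    move=> ne; apply: single_path_neq; apply: contraNneq ne.
    by move=> [/vertex_of_inj -> /vertex_of_inj ->].
  rewrite /vertex_mul (bigD1 i) //= big1 ?addr0 => [|i' ne]; last first.
    rewrite z0 ?arrow_map0 ?rep_act0r //.
    by rewrite xpair_eqE negb_and eq_sym ne.
  have [e|ne] := eqVneq j j'; last first.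
    rewrite dsingle_neq // z0 ?arrow_map0 ?rep_act0r //.
    by rewrite xpair_eqE negb_and ne orbT.
  case: j' / e z0 => _.
  by rewrite single_pathE arrow_mapE !theta1 arrow_decodeK dsingleE.
Qed.

End Freeness.

(** * Finite dimension of A *)

Lemma finite_span_vert : finite_span (fun a => exists r, a = f (tin0 M r)).
Proof.
pose b j (l : 'I_(kb_dim (vertex_kbasis j))) := f (tin0 M (single (kb_elt _ l))).
have [I [g gS]] := finite_span_bigU (fun j => finite_span_fin (@b j)).
exists I, g => _ [r ->]; rewrite tin0_sum f_sum.
have Sg := kspan_subgroup g; apply: (subgroup_sum Sg) => j _.
rewrite [r _](kb_sum (vertex_kbasis j)).
have -> : single (\sum_l kb_coord (vertex_kbasis j) l (r (vertex_of j)) *: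
    kb_elt (vertex_kbasis j) l) =
    \sum_l kb_coord (vertex_kbasis j) l (r (vertex_of j)) *:
    single (kb_elt (vertex_kbasis j) l).
  rewrite (big_morph (@single _) (@dsingleD _ _ (vertex_of j)) (@dsingle0 _ _ _)).
  by apply: eq_bigr => l _; rewrite singleZ.
rewrite (big_morph _ (@tin0D _ _ M) (tin0_0 M)) f_sum.
apply: (subgroup_sum Sg) => l _; rewrite tin0Z fZ; apply/kspanZ/gS.
by exists j, l.
Qed.

Lemma finite_span_arr : finite_span (fun a => exists m, a = f (@tin1 _ _ M m)).
Proof.
pose arrows a := exists j : 'I_n, exists i : 'I_n, exists l : 'I_(t i j), a = arr l.
have arrows_fin : finite_span arrows.
  apply: finite_span_bigU => j; apply: finite_span_bigU => i.
  exact: (finite_span_fin (@arr i j)).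
have := finite_span_mul (finite_span_mul finite_span_vert arrows_fin) finite_span_vert.
move=> /finite_span_sub; apply=> _ [m ->].
rewrite -[m](sum_dsingle (m : dprod path_part)).
rewrite (big_morph _ (@tin1D _ _ M) (tin1_0 M)) f_sum.
apply: (subgroup_sum (addspan_subgroup _)) => -[p q] _.
have [[i <-] [j <-]] := (vertex_of_onto p, vertex_of_onto q).
move: (m _) => z; rewrite -[dsingle _]/(@single_path (vertex_of i) (vertex_of j) z).
elim/fbim_ind: z => [|z z' IHz IHz'|b x c].
- by rewrite single_path0 tin1_0 f0; apply: subgroup0 (addspan_subgroup _).
- by rewrite single_pathB tin1B fB; apply: (subgroupB (addspan_subgroup _)).
rewrite arrowsE; apply: addspan_incl.
exists (vert (theta b) * arr (arrow_code x)), (vert (theta c)); split=> //.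
  exists (vert (theta b)), (arr (arrow_code x)); split=> //.
    by exists (single (thetaV (theta b))).
  by exists j, i, (arrow_code x).
by exists (single (thetaV (theta c))).
Qed.

Lemma finite_span_tpow m : finite_span (fun a => exists y : tpow M m, a = f (tinj y)).
Proof.
elim: m => [|m IHm]; first exact: finite_span_vert.
move/finite_span_mul: (IHm) => /(_ _ finite_span_arr)/finite_span_sub; apply=> _ [y ->].
have Sg := addspan_subgroup.
elim/tensor_ind: y => [|y z Sy Sz|y z].
- have -> : tinj (0 : tpow M m.+1) = 0.
    by have := tinjB (0 : tpow M m.+1) 0; rewrite !subrr.
  by rewrite f0; apply: subgroup0.
- by rewrite tinjB fB; apply: (subgroupB (Sg _ _)).
- apply: addspan_incl; exists (f (tinj y)), (f (tin1 z)).
  by rewrite tinj_tens fM; split=> //; [exists y|exists z].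
Qed.

(** A is spanned by the images of the tensor powers of degree below s, because f kills J^s; each of
    them is finite-dimensional. *)
Lemma finite_span_all :
  exists m (g : 'I_m -> A), forall a, exists c : 'I_m -> k, a = \sum_l c l *: g l.
Proof.
apply: finite_spanT; have [s s0] := f_nil.
exists (fun a => exists m : 'I_s, exists y : tpow M m, a = f (tinj y)).
  by apply: finite_span_bigU => m; apply: finite_span_tpow.
move=> a; rewrite -[a]finvK [finv a]tinj_sum f_sum.
apply: (subgroup_sum (addspan_subgroup _)) => i _.
have [lt_s|le_s] := ltnP i s.
  by apply: addspan_incl; exists (Ordinal lt_s), (finv a i).
suff -> : f (tinj (finv a i)) = 0 by apply: subgroup0 (addspan_subgroup _).
(* A tensor of degree s lies in J^s; a higher one has a left factor of degree s, whence the
   induction on i - s. *)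
move: (finv a i); rewrite -(subnK le_s); elim: (i - s)%N => [|m IHm] y.
  by apply: s0; apply: tinj_idexp.
elim/tensor_ind: y => [|y z Sy Sz|y z].
- have -> : tinj (0 : tpow M (m + s).+1) = 0.
    by have := tinjB (0 : tpow M (m + s).+1) 0; rewrite !subrr.
  exact: f0.
- by rewrite (@tinjB _ _ _ (m + s).+1) fB Sy Sz subrr.
- by rewrite (@tinj_tens _ _ _ (m + s)) fM IHm mul0r.
Qed.

Lemma natural_equivalent :
  equivalent (RepCat P) (ModCat A) /\ equivalent (repCat P) (modCat A).
Proof.
apply: (presented_equivalent (Q := natural_quiver t) (C := C) (vert := vert) (arr := arr)).
- exact: vertB.
- exact: vertM.
- exact: vertZ.
- exact: vert_orth.
- exact: vert_sum1.
- exact: vert_arr.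
- exact: arr_vert.
- exact: vert_arr_generate.
- exact: vert_arr_free.
- exact: finite_span_all.
Qed.

End NaturalPresentation.
End RadicalOfQuotient.

Theorem proposition7p1 (k : fieldType) (A : algType k)
    (A_artinian : artinian A) (A_gabriel : gabriel_type A)
    (A_hereditary : hereditary A)
    (D : radical_quotient A) (t : 'I_(rq_size D) -> 'I_(rq_size D) -> nat)
    (t_natural : natural_arrow_number t) :
  equivalent (RepCat (natural_premodulation t)) (ModCat A) /\
  equivalent (repCat (natural_premodulation t)) (modCat A).
Proof.
have [Q [B [q0 [I [B_simple [I_ideal [s s_gt0 JsI] IJ2] [f [f_surj f_ker]]]]]]] :=
  A_gabriel.
have f_nil : exists s, forall x, idexp (@gpaJ k Q B q0) s x -> f x = 0.
  by exists s => x /JsI/f_ker.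
have f_low x : f x = 0 -> tlow 2 x by move=> /f_ker/IJ2; apply: idexp_tpos_tlow.
have f_inj : injective f.
  move=> x y xy; apply/eqP; rewrite -subr_eq0; apply/eqP.
  apply: (hereditary_quotient_inj f_surj f_low f_nil A_hereditary).
  by have -> : f (x - y) = f x - f y; [exact: rmorphB|rewrite xy subrr].
exact: (natural_equivalent f_surj f_inj f_nil B_simple t_natural).
Qed.
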